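(* With the notation of the context, let $\phi\in\mathcal H$, let $\Phi=(1,0)\in\mathcal H$, and consider the problem of finding $\psi\in\mathcal H$ such that $$P\psi=P\phi\quad\text{and}\quad \pi_+\psi=0. \qquad(\ast)$$ 1. If the constants are not controlled and $\int_\Omega h>0$, then $(\ast)$ has a solution if and only if $(\Phi-PB_-\Phi|\phi)_{\mathcal H}=0$. In this case the solution is unique and given by $\psi=B_-P\phi$. 2. If the constants are not controlled and $\int_\Omega h=0$ (balanced case), then $(\Phi-PB_-\Phi|\Phi)_{\mathcal H}\neq0$ and $(\ast)$ has a unique solution, given by $$\psi=B_-P\phi+\frac{(\Phi-PB_-\Phi|\phi)_{\mathcal H}}{(\Phi-PB_-\Phi|\Phi)_{\mathcal H}}\,(\phi_0-B_-\Phi).$$ 3. In every other case (constants controlled, or constants not controlled and $\int_\Omega h<0$), $\psi=B_-P\phi$ is the unique solution of $(\ast)$.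
   Context: Let $\Omega\subset\mathbb R^2$ be a bounded connected Lipschitz domain whose boundary is partitioned (up to null sets) into $\Gamma_N,\Gamma_D,\Gamma_R,\Gamma_\sharp$ (Neumann, Dirichlet, Robin, periodic parts), each possibly empty, the nonempty ones having positive measure; $\Gamma_\sharp$ consists of pairs of opposite pieces identified by translations, and ''periodic on $\Gamma_\sharp$'' means that traces agree under this identification. Let $h\in L^\infty(\Omega)$, let $c,\sigma>0$ be scalar functions in $L^\infty(\Omega)$ with bounded inverses, and let $a>0$ be a constant. The constants are *controlled* if $\Gamma_D\cup\Gamma_R\neq\emptyset$, and *not controlled* otherwise. The *balanced case* is: constants not controlled and $\int_\Omega h=0$. Let $V=\{s\in H^1(\Omega): s=0\text{ on }\Gamma_D,\ s\text{ periodic on }\Gamma_\sharp\}$; let $H=V$ if the constants are controlled and $H=V/\mathbb R$ (quotient by constants) if not. Let $\mathcal H=L^2(\Omega)\times H$ with scalar product $$((u,s)|(u',s'))_{\mathcal H}=\int_\Omega (cuu'+\sigma\nabla s\cdot\nabla s')+\int_{\Gamma_R}a\,ss'.$$ Let $\mathcal A(u,s)=(c^{-1}hu-c^{-1}\operatorname{div}(\sigma\nabla s),\,u)$ (second component taken in $H$) with domain $\mathcal D(\mathcal A)$ the set of $(u,s)\in\mathcal H$ with $u\in V$, $\operatorname{div}(\sigma\nabla s)\in L^2(\Omega)$, $\sigma\nabla s\cdot n=0$ on $\Gamma_N$, $\sigma\nabla s\cdot n=-as$ on $\Gamma_R$, and $\sigma\nabla s$ having periodic flux on $\Gamma_\sharp$.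 $\mathcal A$ is self-adjoint and has an orthogonal Hilbert basis of eigenvectors of $\mathcal H$. Its nonzero eigenvalues, counted with multiplicity, are $\cdots\le\lambda_{-2}\le\lambda_{-1}<0<\lambda_1\le\lambda_2\le\cdots$, with $\lambda_{\pm n}\to\pm\infty$, and pairwise orthogonal eigenvectors $\phi_i=(U_i,\lambda_i^{-1}U_i)$, $i\in\mathbb Z\setminus\{0\}$. The kernel of $\mathcal A$ is $\{0\}$, except in the balanced case, where it is $\mathbb R\phi_0$ with $\phi_0=(1,\Delta_\sigma^{-1}h)$; here $\Delta_\sigma^{-1}f$ denotes the unique $s\in H$ with $\operatorname{div}(\sigma\nabla s)=f$, $\sigma\nabla s\cdot n=0$ on $\Gamma_N$, $\sigma\nabla s\cdot n+as=0$ on $\Gamma_R$ and periodic flux on $\Gamma_\sharp$ (when the constants are not controlled, it is defined for $f\in L^2(\Omega)$ of zero average). $P$ is the orthogonal projection $P(u,s)=(u,0)$ of $\mathcal H$. $\pi_+$ (resp. $\pi_-$) is the orthogonal projection of $\mathcal H$ onto the closed span of $\{\phi_i:i>0\}$ (resp. $\{\phi_i:i<0\}$), and $\mathcal R(\pi_\pm)=\pi_\pm(\mathcal H)$. It is known that $\pi_-P\pi_-$ is invertible with bounded inverse on $\mathcal R(\pi_-)$, and one sets $B_-=\pi_-(\pi_-P\pi_-)^{-1}\pi_-$, a bounded self-adjoint operator of $\mathcal H$. *)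

(* Defs.v *)
From HB Require Import structures.
From mathcomp Require Export all_boot all_order all_algebra.
From mathcomp Require Export all_classical all_reals all_analysis.
Set Implicit Arguments.
Unset Strict Implicit.
Unset Printing Implicit Defensive.
Export Order.TTheory GRing.Theory Num.Theory.
Export numFieldNormedType.Exports.

Global Open Scope classical_set_scope.
Global Open Scope ring_scope.

Section plane.
Context {R : realType}.
Implicit Types (p q v : R * R) (A : set (R * R)) (f : R * R -> R).

Definition dot p q : R := p.1 * q.1 + p.2 * q.2.

(* The canonical norm of R * R is the sup norm, hence these. *)
Definition edist p q : R := Num.sqrt (dot (p - q) (p - q)).

Definition ediam A : \bar R :=
  ereal_sup (0%E |` [set (edist pq.1 pq.2)%:E | pq in A `*` A]).

Definition lebesgue2 : {measure set (measurableTypeR R * measurableTypeR R) -> \bar R} :=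
  (@lebesgue_measure R \x @lebesgue_measure R)%E.

(* One-dimensional Hausdorff outer measure of the Euclidean plane.  On the
   boundary of a Lipschitz domain it is the arc length. *)
Definition delta_cover (delta : R) A : set (set (R * R))^nat :=
  [set F | A `<=` \bigcup_k F k /\ forall k, (ediam (F k) <= delta%:E)%E].

Definition hausdorff_delta (delta : R) A : \bar R :=
  ereal_inf [set (\sum_(k <oo) ediam (F k))%E | F in delta_cover delta A].

Definition hausdorff1 A : \bar R :=
  ereal_sup [set hausdorff_delta delta A | delta in [set d : R | 0 < d]].

Lemma ediam_ge0 A : (0 <= ediam A)%E.
Proof. by apply: ereal_sup_ubound; left. Qed.

Lemma ediam0 : ediam set0 = 0%E.
Proof.
rewrite /ediam [X in _ |` X](_ : _ = set0) ?setU0 ?ereal_sup1//.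
by rewrite set0X image_set0.
Qed.

Let weight (d : R) (A : set (g_sigma_algebraType [set: set (R * R)])) : \bar R :=
  if (ediam A <= d%:E)%E then ediam A else +oo%E.

Let weight0 d : 0 < d -> weight d set0 = 0%E.
Proof. by move=> d0; rewrite /weight ediam0 lee_fin ltW. Qed.

Let weight_ge0 d A : (0 <= weight d A)%E.
Proof. by rewrite /weight; case: ifP => // _; exact: ediam_ge0. Qed.

Let hausdorff_deltaE d A : hausdorff_delta d A = mu_ext (weight d) A.
Proof.
apply/eqP; rewrite eq_le; apply/andP; split.
  apply: le_ereal_inf_tmp => _ [F [mF AF] <-].
  have [Fd|] := pselect (forall k, (ediam (F k) <= d%:E)%E).
    apply: ereal_inf_lbound; exists F => //.
    by apply: congr_lim; apply/funext => n; apply: eq_bigr => k _; rewrite /weight Fd.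
  move=> /existsNP[k /negP Fk].
  rewrite [leRHS](@eseries_pinfty _ _ _ k) ?leey//.
    by move=> n _; rewrite gt_eqF// (lt_le_trans _ (weight_ge0 d _))// ltNy0.
  by rewrite /weight (negbTE Fk).
apply: le_ereal_inf_tmp => _ [F [AF Fd] <-].
apply: ereal_inf_lbound; exists F; first by split=> // i; exact: sub_sigma_algebra.
by apply: congr_lim; apply/funext => n; apply: eq_bigr => k _; rewrite /weight Fd.
Qed.

Let hausdorff1_0 : hausdorff1 set0 = 0%E.
Proof.
apply/eqP; rewrite eq_le; apply/andP; split.
  apply: ge_ereal_sup => _ [d /= d0 <-].
  by rewrite hausdorff_deltaE mu_ext0// ?weight0.
apply: (@le_trans _ _ (hausdorff_delta 1 set0)).
  by rewrite hausdorff_deltaE mu_ext_ge0// weight0.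
by apply: ereal_sup_ubound; exists 1 => //=.
Qed.

Let hausdorff1_ge0 A : (0 <= hausdorff1 A)%E.
Proof.
apply: (@le_trans _ _ (hausdorff_delta 1 A)).
  by rewrite hausdorff_deltaE mu_ext_ge0// weight0.
by apply: ereal_sup_ubound; exists 1 => //=.
Qed.

Let hausdorff1_le : {homo hausdorff1 : A B / A `<=` B >-> (A <= B)%E}.
Proof.
move=> A B AB; apply: ge_ereal_sup => _ [d /= d0 <-].
apply: (@le_trans _ _ (hausdorff_delta d B)).
  by rewrite !hausdorff_deltaE; exact: le_mu_ext.
by apply: ereal_sup_ubound; exists d.
Qed.

Let hausdorff1_sigma_subadditive : sigma_subadditive hausdorff1.
Proof.
move=> F; apply: ge_ereal_sup => _ [d /= d0 <-].
rewrite hausdorff_deltaE.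
have /le_trans := @mu_ext_sigma_subadditive _
  (g_sigma_algebraType [set: set (R * R)]) R _ (weight_ge0 d) F; apply.
apply: lee_nneseries => [k _ _|k _]; first exact: mu_ext_ge0.
by rewrite -hausdorff_deltaE; apply: ereal_sup_ubound; exists d.
Qed.

HB.instance Definition _ := isOuterMeasure.Build R (R * R)%type hausdorff1
  hausdorff1_0 hausdorff1_ge0 hausdorff1_le hausdorff1_sigma_subadditive.

Definition hausdorff1_outer : {outer_measure set (R * R) -> \bar R} := hausdorff1.

Definition arclength :
    {measure set (caratheodory_type hausdorff1_outer) -> \bar R} :=
  hausdorff1_outer.

End plane.

Notation measurable_arc := (hausdorff1_outer.-cara.-measurable).

Section domains.
Context {R : realType}.
Implicit Types (Om A : set (R * R)) (p q nu : R * R) (f phi s : R * R -> R).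
Implicit Types (F G : (R * R -> R) * (R * R -> R)).

Definition boundary Om := closure Om `\` interior Om.

(* Near each boundary point, in the rotated orthonormal frame (e, e'), Om is
   the strict epigraph of a Lipschitz function. *)
Definition lipschitz_domain Om :=
  forall p, boundary Om p -> exists (e : R * R) (r : R) (g : R -> R),
    [/\ dot e e = 1, 0 < r, lipschitz g &
      forall q, edist q p < r ->
        (Om q <-> g (dot (q - p) e) < dot (q - p) (- e.2, e.1))].

Definition is_outer_normal Om p nu :=
  dot nu nu = 1 /\
  forall eps : R, 0 < eps -> exists2 r : R, 0 < r &
    forall q, edist q p < r ->
      (dot (q - p) nu < - (eps * edist q p) -> Om q) /\
      (eps * edist q p < dot (q - p) nu -> ~ Om q).

Definition partial1 f : R * R -> R := fun p => derive1 (fun t => f (t, p.2)) p.1.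
Definition partial2 f : R * R -> R := fun p => derive1 (fun t => f (p.1, t)) p.2.

Fixpoint Ck (k : nat) f : Prop :=
  if k is k'.+1 then
    [/\ continuous f,
        forall p, derivable (fun t => f (t, p.2)) p.1 1,
        forall p, derivable (fun t => f (p.1, t)) p.2 1,
        Ck k' (partial1 f) & Ck k' (partial2 f)]
  else continuous f.

Definition test_function Om phi :=
  (forall k, Ck k phi) /\
  exists K : set (R * R),
    [/\ compact K, K `<=` Om & forall p, ~ K p -> phi p = 0].

Definition L2 Om f := f \_ Om \in Lfun lebesgue2 2%:E.
Definition Linfty Om f := f \_ Om \in Lfun lebesgue2 +oo%E.

Definition vdot F G : R * R -> R := fun p => F.1 p * G.1 p + F.2 p * G.2 p.
Definition vscale f G := (f * G.1, f * G.2) : (R * R -> R) * (R * R -> R).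

Definition weak_gradient Om s G :=
  [/\ L2 Om G.1, L2 Om G.2 &
   forall phi, test_function Om phi ->
     (\int[lebesgue2]_(p in Om) (s p * partial1 phi p) =
       - (\int[lebesgue2]_(p in Om) (G.1 p * phi p))) /\
     (\int[lebesgue2]_(p in Om) (s p * partial2 phi p) =
       - (\int[lebesgue2]_(p in Om) (G.2 p * phi p)))].

Definition weak_divergence Om F d :=
  L2 Om d /\
  forall phi, test_function Om phi ->
    \int[lebesgue2]_(p in Om) vdot F (partial1 phi, partial2 phi) p =
      - (\int[lebesgue2]_(p in Om) (d p * phi p)).

Definition sobolev1 Om : set (R * R -> R) :=
  [set s | L2 Om s /\ exists G, weak_gradient Om s G].

(* Both are unique up to a null set; values are meaningful only when they exist. *)
Definition grad Om s : (R * R -> R) * (R * R -> R) :=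
  xget (cst 0, cst 0) [set G | weak_gradient Om s G].
Definition divg Om F : R * R -> R := xget (cst 0) [set d | weak_divergence Om F d].

(* The trace operator H^1(Om) -> L^2(boundary Om), characterised by the trace
   theorem (which makes it unique up to null sets). *)
Definition trace_operator Om (tr : (R * R -> R) -> (R * R -> R)) :=
  [/\ forall s, sobolev1 Om s -> (tr s) \_ (boundary Om) \in Lfun arclength 2%:E,
      forall (k : R) s s', sobolev1 Om s -> sobolev1 Om s' ->
        tr (k *: s + s') = k *: tr s + tr s' %[ae arclength in boundary Om],
      exists C : R, forall s, sobolev1 Om s ->
        (\int[arclength]_(p in boundary Om) (tr s p ^+ 2)) <=
          C * (\int[lebesgue2]_(p in Om)
                 (s p ^+ 2 + vdot (grad Om s) (grad Om s) p)) &
      forall s, sobolev1 Om s -> {within closure Om, continuous s} ->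
        tr s = s %[ae arclength in boundary Om]].

End domains.

(* The periodic part of the boundary consists of the pairs (Gm k, Gp k), with
   Gp k the translate of Gm k by tau k. *)
Record pb_data (R : realType) := PbData {
  dom : set (R * R);
  GN : set (R * R);
  GD : set (R * R);
  GR : set (R * R);
  npairs : nat;
  Gm : 'I_npairs -> set (R * R);
  Gp : 'I_npairs -> set (R * R);
  tau : 'I_npairs -> R * R;
  coef_h : R * R -> R;
  coef_c : R * R -> R;
  coef_sigma : R * R -> R;
  coef_a : R }.

Arguments Gm {R} _ _.
Arguments Gp {R} _ _.
Arguments tau {R} _ _.

Section problem.
Context {R : realType} (D : pb_data R) (tr : (R * R -> R) -> (R * R -> R)).

Local Notation Om := (dom D).
Local Notation h := (coef_h D).
Local Notation c := (coef_c D).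
Local Notation sigma := (coef_sigma D).
Local Notation a := (coef_a D).
Local Notation state := ((R * R -> R) * (R * R -> R))%type.
Local Notation intO f := (\int[lebesgue2]_(p in Om) f p) (only parsing).

Definition Gper := \bigcup_k (Gm D k `|` Gp D k).

Definition arc_disjoint (A B : set (R * R)) := arclength (A `&` B) = 0%E.

Definition admissible_domain :=
  [/\ Om !=set0, open Om, connected Om, bounded_set Om & lipschitz_domain Om].

Definition admissible_partition :=
  [/\ forall A, [\/ A = GN D, A = GD D, A = GR D | A = Gper] ->
        [/\ A `<=` boundary Om, measurable_arc A &
            A !=set0 -> (0 < arclength A)%E],
      arclength (boundary Om `\` (GN D `|` GD D `|` GR D `|` Gper)) = 0%E,
      [/\ arc_disjoint (GN D) (GD D), arc_disjoint (GN D) (GR D) &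
          arc_disjoint (GD D) (GR D)] &
      [/\ arc_disjoint (GN D) Gper, arc_disjoint (GD D) Gper &
          arc_disjoint (GR D) Gper]].

Definition admissible_pairs :=
  [/\ forall k, measurable_arc (Gm D k) /\ measurable_arc (Gp D k),
      forall k, Gp D k = [set p + tau D k | p in Gm D k],
      forall k, \forall p \ae arclength, Gm D k p ->
        forall nu, is_outer_normal Om p nu ->
          is_outer_normal Om (p + tau D k) (- nu),
      forall k, arc_disjoint (Gm D k) (Gp D k) &
      forall k l, k != l ->
        arc_disjoint (Gm D k `|` Gp D k) (Gm D l `|` Gp D l)].

Definition admissible_coefs :=
  [/\ Linfty Om h,
      [/\ Linfty Om c, Linfty Om (fun p => (c p)^-1) &
          \forall p \ae lebesgue2, Om p -> 0 < c p],
      [/\ Linfty Om sigma, Linfty Om (fun p => (sigma p)^-1) &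
          \forall p \ae lebesgue2, Om p -> 0 < sigma p] &
      0 < a].

Definition admissible :=
  [/\ admissible_domain, admissible_partition, admissible_pairs & admissible_coefs].

Definition controlled := GD D `|` GR D !=set0.

Definition balanced := ~ controlled /\ intO h = 0.

Definition V : set (R * R -> R) :=
  [set s | [/\ sobolev1 Om s,
      tr s = cst 0 %[ae arclength in GD D] &
      forall k, \forall p \ae arclength, Gm D k p -> tr s (p + tau D k) = tr s p]].

(* H is represented by V itself, and the quotient by the equality eqH. *)
Definition eqH (s s' : R * R -> R) := exists2 k : R,
  (controlled -> k = 0) & s = (fun p => s' p + k) %[ae lebesgue2 in Om].

(* L^2 x H: a pair of functions stands for the class of the pairs equal to it
   in the sense of eqHH. *)
Definition HH : set state := [set x | L2 Om x.1 /\ V x.2].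

Definition eqHH (x y : state) :=
  x.1 = y.1 %[ae lebesgue2 in Om] /\ eqH x.2 y.2.

Definition sprod (x y : state) : R :=
  (\int[lebesgue2]_(p in Om)
     (c p * x.1 p * y.1 p + sigma p * vdot (grad Om x.2) (grad Om y.2) p)) +
  (\int[arclength]_(p in GR D) (a * tr x.2 p * tr y.2 p)).

Definition hnorm (x : state) : R := Num.sqrt (sprod x x).

Definition flux (s : R * R -> R) := vscale sigma (grad Om s).

Definition has_div (F : state) := exists d, weak_divergence Om F d.

(* <F.n, v> on the boundary of Om: the normal trace of a field F with square
   integrable divergence is defined by Green's formula. *)
Definition normal_trace (F : state) (v : R * R -> R) : R :=
  \int[lebesgue2]_(p in Om) (vdot F (grad Om v) p + divg Om F p * v p).

(* sigma grad s . n = 0 on GN, = - a s on GR and periodic on Gper (opposite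
   values at paired points, whose outer normals are opposite).  This is tested
   against the elements of V: they vanish on GD, and are periodic, so that the
   contributions of the paired points cancel. *)
Definition flux_conditions (s : R * R -> R) :=
  forall v, V v ->
    normal_trace (flux s) v =
      - (\int[arclength]_(p in GR D) (a * tr s p * tr v p)).

Definition opA (x : state) : state :=
  (fun p => (c p)^-1 * h p * x.1 p - (c p)^-1 * divg Om (flux x.2) p, x.1).

Definition domA : set state :=
  [set x | [/\ HH x, V x.1, has_div (flux x.2) & flux_conditions x.2]].

(* s = Delta_sigma^-1 f, up to eqH. *)
Definition is_Delta_inv (f s : R * R -> R) :=
  [/\ V s, weak_divergence Om (flux s) f & flux_conditions s].

Definition opP (x : state) : state := (x.1, cst 0).

Definition lin_comb n (k : 'I_n -> R) (x : 'I_n -> state) : state :=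
  \sum_(i < n) k i *: x i.

Definition closed_span (S : set state) : set state :=
  [set x | HH x /\ forall eps : R, 0 < eps ->
     exists n (k : 'I_n -> R) (y : 'I_n -> state),
       (forall i, S (y i)) /\ hnorm (x - lin_comb k y) < eps].

Definition orth_proj (S : set state) (p : state -> state) :=
  forall x, HH x -> S (p x) /\ forall y, S y -> sprod (x - p x) y = 0.

Definition proj_range (p : state -> state) : set state :=
  [set x | HH x /\ exists2 y, HH y & eqHH x (p y)].

(* T is a bounded inverse of M on S. *)
Definition bounded_inverse_on (S : set state) (M T : state -> state) :=
  [/\ forall x, S x -> S (T x),
      forall x, S x -> eqHH (M (T x)) x,
      forall x, S x -> eqHH (T (M x)) x &
      exists C : R, forall x, S x -> hnorm (T x) <= C * hnorm x].

Section spectrum.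
Variables (lam : int -> R) (U : int -> R * R -> R) (s0 : R * R -> R).

Definition eigvec (i : int) : state := (U i, (lam i)^-1 *: U i).
Definition kervec : state := (cst 1, s0).

(* As the family is total, it lists every nonzero eigenvalue with its
   multiplicity. *)
Definition eigenbasis :=
  [/\ [/\ forall i, 0 < i -> 0 < lam i,
          forall i, i < 0 -> lam i < 0,
          forall i j, i != 0 -> j != 0 -> i <= j -> lam i <= lam j,
          (lam n%:Z)%:E @[n --> \oo] --> +oo%E &
          (lam (- n%:Z))%:E @[n --> \oo] --> -oo%E],
      forall i, i != 0 ->
        [/\ domA (eigvec i), ~ eqHH (eigvec i) 0 &
            eqHH (opA (eigvec i)) (lam i *: eigvec i)],
      forall i j, i != 0 -> j != 0 -> i != j -> sprod (eigvec i) (eigvec j) = 0,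
      balanced -> is_Delta_inv h s0 &
      HH `<=` closed_span [set x | (exists2 i, i != 0 & x = eigvec i) \/
                                   (balanced /\ x = kervec)]].

Definition pos_space := closed_span [set eigvec i | i in [set i : int | 0 < i]].
Definition neg_space := closed_span [set eigvec i | i in [set i : int | i < 0]].

End spectrum.

Section pseudo_inverse.
Variables (pip pim T : state -> state).

Definition opB (x : state) : state := pim (T (pim x)).

Definition solution (phi psi : state) :=
  [/\ HH psi, eqHH (opP psi) (opP phi) & eqHH (pip psi) 0].

Definition unique_solution (phi psi : state) :=
  solution phi psi /\ forall psi', solution phi psi' -> eqHH psi' psi.

End pseudo_inverse.

End problem.

(* Main.v *)
Require Import Defs.
From mathcomp Require Import measurable_realfun ess_sup_inf ring lra.
Set Implicit Arguments.
Unset Strict Implicit.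
Unset Printing Implicit Defensive.

(* Modulo null elements, psi solves the problem when psi.1 = phi.1 and psi is
   orthogonal to every phi_i, i > 0.  Since B_- P phi is orthogonal to phi_i for
   i >= 0, everything rests on two facts.

   (1) Let f in L^2 be such that x = (f, 0) is orthogonal to phi_i for i < 0 and to
   the kernel; the residual phi.1 - (B_- P phi).1 is such an f, up to a kernel
   component.  Let x_N be the partial sums of x and y_N = A^-1 x_N = (u_N, _).
   Then |x_N - x| -> 0 forces the gradients of u_N to tend to 0, and the spectral
   gap makes u_N a Cauchy sequence, so u_N tends to a constant k, which is 0 if the
   constants are controlled.  If they are not, the weak form tested against 1 gives
   k \int h = \int c f.  Finally (y_N | x) is a sum of terms a_n^2 / lambda_n >= 0,
   with limit k \int c f: if k \int c f <= 0, then f = 0.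

   (2) In the balanced case, if psi.1 = 0 and psi is orthogonal to phi_i for i > 0,
   then psi is orthogonal to phi_0.  Indeed (Az | z) = 2 (PAz | z) - \int h u^2 for
   z = (u, _), so that on the span of the phi_i, i <= 0, an implicit Euler step
   (1 - tau A)^-1 multiplies \int c u^2 by at most 2, whereas it damps every mode
   but phi_0: after k steps the first component of psi is still 0, and it tends to
   that of the component of psi along phi_0. *)

(** * Orthogonal families in semi-inner product spaces *)

(** States are plain functions, so the scalar products are only semi-inner products, well behaved on
    a subset [HS] of a module of all functions. Their null vectors are the pairs whose first
    component vanishes almost everywhere and whose second one is almost everywhere constant, with
    constant 0 if the constants are controlled. Equality in the space becomes nullity of a
    difference, and by Cauchy-Schwarz null vectors are invisible to every pairing. Neither [(f, 0)]
    nor [psi] need lie in the domain of A, so its inverse and its resolvent are applied to finite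
    spectral sums only, and every conclusion is a limit of inequalities on such sums. Completeness
    is used for L^2 alone: in place of a Poincaré inequality, the limit of [u_N] is identified as a
    function with zero weak gradient on a connected open set. The maps [pip], [pim] and [T] are
    arbitrary functions, determined only up to null states and not known to be linear. Hence B_- is
    never computed with; it enters through identities tested against the range of pi_-. *)

Record semi_inner (R : realType) (E : lmodType R) (HS : set E)
    (ip : E -> E -> R) : Prop := SemiInner {
  semi_inner0 : HS 0;
  semi_innerP : forall k x y, HS x -> HS y -> HS (k *: x + y);
  semi_innerl : forall k x y z, HS x -> HS y -> HS z ->
    ip (k *: x + y) z = k * ip x z + ip y z;
  semi_innerC : forall x y, HS x -> HS y -> ip x y = ip y x;
  semi_inner_ge0 : forall x, HS x -> 0 <= ip x x }.

Section semi_inner_theory.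
Context {R : realType} {E : lmodType R} {HS : set E} {ip : E -> E -> R}.
Hypothesis H : semi_inner HS ip.
Implicit Types (x y z : E) (k : R).

Let H0 := semi_inner0 H.
Let HP := semi_innerP H.

Lemma sub_D x y : HS x -> HS y -> HS (x + y).
Proof. by move=> hx hy; rewrite -(scale1r x); exact: HP. Qed.
Lemma sub_Z k x : HS x -> HS (k *: x).
Proof. by move=> hx; rewrite -(addr0 (k *: x)); exact: HP. Qed.
Lemma sub_N x : HS x -> HS (- x).
Proof. by move=> hx; rewrite -scaleN1r; exact: sub_Z. Qed.
Lemma sub_B x y : HS x -> HS y -> HS (x - y).
Proof. by move=> hx hy; apply: sub_D => //; exact: sub_N. Qed.
Lemma sub_sum (I : Type) (s : seq I) (f : I -> E) :
  (forall i, HS (f i)) -> HS (\sum_(i <- s) f i).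
Proof.
move=> hf; elim: s => [|i s ih]; first by rewrite big_nil.
by rewrite big_cons; exact: sub_D.
Qed.

Lemma ipDl x y z : HS x -> HS y -> HS z -> ip (x + y) z = ip x z + ip y z.
Proof.
by move=> hx hy hz; rewrite -[in LHS](scale1r x) (semi_innerl H)// mul1r.
Qed.
Lemma ip0l z : HS z -> ip 0 z = 0.
Proof.
by move=> hz; have := ipDl H0 H0 hz; rewrite addr0; lra.
Qed.
Lemma ipZl k x z : HS x -> HS z -> ip (k *: x) z = k * ip x z.
Proof.
by move=> hx hz; rewrite -(addr0 (k *: x)) (semi_innerl H)// ip0l// addr0.
Qed.
Lemma ipNl x z : HS x -> HS z -> ip (- x) z = - ip x z.
Proof. by move=> hx hz; rewrite -scaleN1r ipZl// mulN1r. Qed.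
Lemma ipBl x y z : HS x -> HS y -> HS z -> ip (x - y) z = ip x z - ip y z.
Proof. by move=> hx hy hz; rewrite ipDl ?ipNl//; exact: sub_N. Qed.

Let C := semi_innerC H.

Lemma ipDr x y z : HS x -> HS y -> HS z -> ip z (x + y) = ip z x + ip z y.
Proof. by move=> hx hy hz; rewrite (C hz (sub_D hx hy)) ipDl// (C hx hz) (C hy hz). Qed.
Lemma ip0r z : HS z -> ip z 0 = 0.
Proof. by move=> hz; rewrite (C hz H0) ip0l. Qed.
Lemma ipZr k x z : HS x -> HS z -> ip z (k *: x) = k * ip z x.
Proof. by move=> hx hz; rewrite (C hz (sub_Z k hx)) ipZl// (C hx hz). Qed.
Lemma ipNr x z : HS x -> HS z -> ip z (- x) = - ip z x.
Proof. by move=> hx hz; rewrite (C hz (sub_N hx)) ipNl// (C hx hz). Qed.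
Lemma ipBr x y z : HS x -> HS y -> HS z -> ip z (x - y) = ip z x - ip z y.
Proof. by move=> hx hy hz; rewrite ipDr ?ipNr//; exact: sub_N. Qed.

Lemma ip_suml (I : Type) (s : seq I) (f : I -> E) z :
  (forall i, HS (f i)) -> HS z ->
  ip (\sum_(i <- s) f i) z = \sum_(i <- s) ip (f i) z.
Proof.
move=> hf hz; elim: s => [|i s ih]; first by rewrite !big_nil ip0l.
by rewrite !big_cons ipDl ?ih//; exact: sub_sum.
Qed.

Lemma ip_sqD x y : HS x -> HS y ->
  ip (x + y) (x + y) = ip x x + 2 * ip x y + ip y y.
Proof.
move=> hx hy; rewrite ipDl ?ipDr//; last exact: sub_D.
by rewrite (C hy hx); ring.
Qed.

Lemma ip_sqB x y : HS x -> HS y ->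
  ip (x - y) (x - y) = ip x x - 2 * ip x y + ip y y.
Proof.
move=> hx hy; rewrite ip_sqD ?ipNr ?ipNl//; try exact: sub_N.
by ring.
Qed.

Lemma ip_sqC x y : HS x -> HS y -> ip (x - y) (x - y) = ip (y - x) (y - x).
Proof. by move=> hx hy; rewrite !ip_sqB// (C hx hy); ring. Qed.

Lemma cauchy_schwarz x y : HS x -> HS y -> ip x y ^+ 2 <= ip x x * ip y y.
Proof.
move=> hx hy; have key t : 0 <= ip x x - 2 * t * ip x y + t ^+ 2 * ip y y.
  have := semi_inner_ge0 H (sub_B hx (sub_Z t hy)).
  rewrite ip_sqB//; last exact: sub_Z.
  by rewrite ipZr// ipZl ?ipZr//; [lra | exact: sub_Z].
have y0 := semi_inner_ge0 H hy; have x0 := semi_inner_ge0 H hx.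
have [yy|yy] := eqVneq (ip y y) 0.
  have [->|xy] := eqVneq (ip x y) 0; first by rewrite expr0n mulr_ge0.
  (* For a null [y] the quadratic is affine in [t]; this [t] would give it the negative value
     [- ip x x - 2]. *)
  have := key ((ip x x + 1) / ip x y).
  rewrite yy mulr0 addr0 -mulrA mulfVK//; lra.
have yp : 0 < ip y y by rewrite lt_neqAle eq_sym yy.
have := key (ip x y / ip y y) => k.
rewrite -ler_pdivrMr//.
suff -> : ip x y ^+ 2 / ip y y = ip x x - (ip x x -
    2 * (ip x y / ip y y) * ip x y + (ip x y / ip y y) ^+ 2 * ip y y) by lra.
by field.
Qed.

Lemma ip_null x y : HS x -> HS y -> ip x x = 0 -> ip x y = 0.
Proof.
move=> hx hy x0; have := cauchy_schwarz hx hy; rewrite x0 mul0r => h.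
by apply/eqP; rewrite -sqrf_eq0 eq_le h sqr_ge0.
Qed.

Lemma ip_nullr x y : HS x -> HS y -> ip x x = 0 -> ip y x = 0.
Proof. by move=> hx hy x0; rewrite C// ip_null. Qed.

Lemma cvg_ip (u : nat -> E) x y : (forall n, HS (u n)) -> HS x -> HS y ->
  ip (u n - x) (u n - x) @[n --> \oo] --> 0 -> ip (u n) y @[n --> \oo] --> ip x y.
Proof.
move=> hu hx hy ux.
apply/cvgrPdist_le => /= e e0.
have yy := semi_inner_ge0 H hy.
(* The [+ 1] keeps the quotient meaningful when [y] is null. *)
have e1 : 0 < e ^+ 2 / (ip y y + 1) by rewrite divr_gt0 ?exprn_gt0//; lra.
move/cvgrPdist_le : ux => /(_ _ e1); apply: filterS => n /=.
rewrite sub0r normrN ger0_norm; last exact/(semi_inner_ge0 H)/sub_B.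
rewrite ler_pdivlMr; last by lra.
move=> le1.
rewrite -ipBl// -(@ler_pXn2r _ 2) ?nnegrE ?(ltW e0)// real_normK ?num_real//.
have hxu := sub_B hx (hu n).
apply: le_trans (cauchy_schwarz hxu hy) _.
apply: le_trans le1.
have -> : ip (x - u n) (x - u n) = ip (u n - x) (u n - x).
  exact: ip_sqC.
rewrite ler_wpM2l//; last by lra.
exact/(semi_inner_ge0 H)/sub_B.
Qed.

End semi_inner_theory.

Section orthogonal_family.
Context {R : realType} {E : lmodType R} {HS : set E} {ip : E -> E -> R}.
Hypothesis H : semi_inner HS ip.
Variable e : nat -> E.
Hypothesis He : forall n, HS (e n).
Hypothesis orth : forall n m, n != m -> ip (e n) (e m) = 0.
Hypothesis total : forall x, HS x -> forall eps : R, 0 < eps ->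
  exists n (k : 'I_n -> R) (i : 'I_n -> nat),
    let z := x - \sum_j k j *: e (i j) in ip z z < eps.
Implicit Types (x y z : E) (k : R).

(** Null vectors are allowed in the family: division by 0 gives them the coefficient 0, which is
    consistent because they pair to 0 with everything. *)
Definition fourier x n := ip x (e n) / ip (e n) (e n).
Definition comb (b : nat -> R) N := \sum_(n < N) b n *: e n.
Definition psum x N := comb (fourier x) N.

Lemma comb_in b N : HS (comb b N).
Proof. by apply: (sub_sum H) => i; exact: (sub_Z H). Qed.

Lemma ip_comb b N y : HS y -> ip (comb b N) y = \sum_(n < N) b n * ip (e n) y.
Proof.
move=> hy; rewrite (ip_suml H)//; last by move=> i; exact: (sub_Z H).
by apply: eq_bigr => i _; rewrite (ipZl H).
Qed.

Lemma ip_comb_e b N m : ip (comb b N) (e m) = (m < N)%:R * b m * ip (e m) (e m).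
Proof.
rewrite ip_comb//; case: ltnP => mN.
  rewrite (bigD1 (Ordinal mN))//= big1 ?addr0 ?mul1r// => i im.
  by rewrite orth ?mulr0//; apply: contra im => /eqP im; apply/eqP/val_inj.
rewrite big1 ?mul0r// => i _; rewrite orth ?mulr0//.
by rewrite ltn_eqF// (leq_trans _ mN).
Qed.

Lemma ip_comb_comb b b' N : ip (comb b N) (comb b' N) =
  \sum_(n < N) b n * b' n * ip (e n) (e n).
Proof.
rewrite ip_comb; last exact: comb_in.
apply: eq_bigr => i _.
rewrite (semi_innerC H (He i) (comb_in b' N)) ip_comb_e ltn_ord /=.
by ring.
Qed.

Lemma fourierM x n : HS x -> fourier x n * ip (e n) (e n) = ip x (e n).
Proof.
move=> hx; rewrite /fourier; have [e0|e0] := eqVneq (ip (e n) (e n)) 0.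
  by rewrite e0 mulr0 (ip_nullr H).
by rewrite divfK.
Qed.

Lemma psum_orth x N m : HS x -> (m < N)%N -> ip (x - psum x N) (e m) = 0.
Proof.
move=> hx mN; rewrite (ipBl H)//; last exact: comb_in.
by rewrite ip_comb_e mN mul1r fourierM// subrr.
Qed.

(** Pythagoras: [x - psum x N] is orthogonal to the first [N] modes, so [psum x N] is at least as
    close to [x] as any combination of them. *)
Lemma psum_cvg x : HS x ->
  ip (psum x N - x) (psum x N - x) @[N --> \oo] --> 0.
Proof.
move=> hx; apply/cvgrPdist_lt => /= eps eps0.
have [n [k [i /= lt_eps]]] := total hx eps0.
(* From this rank on, all the modes of the approximating combination are among those of the partial
   sum. *)
exists (\max_j (i j).+1)%N => //= N /= leN.
have hp : HS (psum x N) := comb_in _ N.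
rewrite sub0r normrN ger0_norm; last exact: (semi_inner_ge0 H (sub_B H hp hx)).
apply: le_lt_trans lt_eps.
set c := \sum_j _.
have hc : HS c by apply: (sub_sum H) => j; exact: (sub_Z H).
have hxp := sub_B H hx hp; have hpc := sub_B H hp hc.
have -> : x - c = (x - psum x N) + (psum x N - c) by rewrite addrA subrK.
rewrite (ip_sqD H)//.
suff -> : ip (x - psum x N) (psum x N - c) = 0.
  have -> : ip (psum x N - x) (psum x N - x) = ip (x - psum x N) (x - psum x N).
    exact: (ip_sqC H).
  by have := semi_inner_ge0 H hpc; lra.
rewrite (ipBr H)// !(semi_innerC H hxp)// /psum !ip_comb//.
rewrite big1 => [|j _]; last first.
  by rewrite (semi_innerC H)// psum_orth ?mulr0.
rewrite (ip_suml H)// => [|j]; last exact: (sub_Z H).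
rewrite big1 ?subr0// => j _.
rewrite (ipZl H)// (semi_innerC H)// psum_orth ?mulr0//.
by apply: leq_trans leN; exact: (leq_bigmax j).
Qed.

(** Each partial sum of [x] is orthogonal to [y], mode by mode, and the pairing is continuous. This
    replaces any decomposition of the space into closed spectral subspaces. *)
Lemma orth_complement x y : HS x -> HS y ->
  (forall n, ip x (e n) = 0 \/ ip y (e n) = 0) -> ip x y = 0.
Proof.
move=> hx hy xy.
have : ip (psum x N) y @[N --> \oo] --> ip x y.
  by apply: (cvg_ip H) => //; [move=> n; exact: comb_in | exact: psum_cvg].
have -> : (fun N => ip (psum x N) y) = cst 0.
  apply/funext => N; rewrite ip_comb// big1// => i _.
  rewrite /fourier; have [->|y0] := xy i; first by rewrite !mul0r.
  by rewrite (semi_innerC H (He i) hy) y0 mulr0.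
by move=> /cvg_lim <-//; rewrite lim_cst.
Qed.

Lemma psum_le x N : HS x -> ip (psum x N) (psum x N) <= ip x x.
Proof.
move=> hx; have hp : HS (psum x N) := comb_in _ N.
have hxp := sub_B H hx hp.
have -> : ip x x = ip ((x - psum x N) + psum x N) ((x - psum x N) + psum x N).
  by rewrite subrK.
rewrite (ip_sqD H)//.
have -> : ip (x - psum x N) (psum x N) = 0.
  rewrite (semi_innerC H)// ip_comb// big1// => i _.
  by rewrite (semi_innerC H)// psum_orth ?mulr0.
by have := semi_inner_ge0 H hxp; lra.
Qed.

Lemma bessel_null x : HS x -> (forall n, ip x (e n) = 0) -> ip x x = 0.
Proof. by move=> hx x0; apply: orth_complement => // n; left. Qed.

End orthogonal_family.

Arguments fourier {R E} ip e x n.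
Arguments comb {R E} e b N.
Arguments psum {R E} ip e x N.

Section combinations.
Context {R : realType} {E : lmodType R} {HS : set E} {ip : E -> E -> R}.
Hypothesis H : semi_inner HS ip.
Variable e : nat -> E.
Hypothesis He : forall n, HS (e n).
Hypothesis orth : forall n m, n != m -> ip (e n) (e m) = 0.
Implicit Types (b : nat -> R) (N M : nat).

Lemma eq_comb b b' N : (forall n, b n *: e n = b' n *: e n) ->
  comb e b N = comb e b' N.
Proof. by move=> bb'; apply: eq_bigr. Qed.

Lemma combS b N : comb e b N.+1 = comb e b N + b N *: e N.
Proof. by rewrite /comb big_ord_recr. Qed.

Lemma combB b b' N : comb e b N - comb e b' N = comb e (fun n => b n - b' n) N.
Proof.
by rewrite /comb -sumrB; apply: eq_bigr => i _; rewrite scalerBl.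
Qed.

Lemma combZ k b N : k *: comb e b N = comb e (fun n => k * b n) N.
Proof. by rewrite /comb scaler_sumr; apply: eq_bigr => i _; rewrite scalerA. Qed.

(** Truncation is encoded in the coefficients, so that a tail is again a [comb] of the same length
    and can be compared mode by mode. *)
Lemma comb_trunc b N M : (N <= M)%N ->
  comb e b M - comb e b N = comb e (fun n => (N <= n)%:R * b n) M.
Proof.
elim: M => [|M ih].
  by rewrite leqn0 => /eqP ->; rewrite /comb !big_ord0 subrr.
rewrite leq_eqVlt => /predU1P[->|NM].
  rewrite subrr /comb big1// => i _.
  by rewrite leqNgt ltn_ord mul0r scale0r.
rewrite !combS -ih//; have -> : (N <= M)%N by [].
by rewrite mul1r addrAC.
Qed.

Lemma comb_delta b N m : (m < N)%N ->
  comb e b N - b m *: e m = comb e (fun n => (n != m)%:R * b n) N.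
Proof.
move=> mN; rewrite /comb (bigD1 (Ordinal mN))//= [X in X - _]addrC addrK.
rewrite [RHS](bigD1 (Ordinal mN))//= eqxx mul0r scale0r add0r.
apply: eq_bigr => i im; have -> : (i : nat) != m; last by rewrite mul1r.
by apply: contra im => /eqP im; apply/eqP/val_inj.
Qed.

Lemma ip_comb_le b b' N :
  (forall n, b n ^+ 2 * ip (e n) (e n) <= b' n ^+ 2 * ip (e n) (e n)) ->
  ip (comb e b N) (comb e b N) <= ip (comb e b' N) (comb e b' N).
Proof.
move=> bb'; rewrite !(ip_comb_comb H He orth).
by apply: ler_sum => i _; rewrite -!expr2.
Qed.

(** The tail [x - psum ip e x N] is the orthogonal sum of [x - psum ip e x M] and of the difference
    of the partial sums. *)
Lemma psum_cauchy x N M : HS x -> (N <= M)%N ->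
  ip (psum ip e x M - psum ip e x N) (psum ip e x M - psum ip e x N) <=
  ip (psum ip e x N - x) (psum ip e x N - x).
Proof.
move=> hx NM.
have hM : HS (psum ip e x M) := comb_in H He _ _.
have hN : HS (psum ip e x N) := comb_in H He _ _.
rewrite (ip_sqC H hN hx).
have hxM := sub_B H hx hM; have hMN := sub_B H hM hN.
have -> : x - psum ip e x N = (x - psum ip e x M) + (psum ip e x M - psum ip e x N).
  by rewrite addrA subrK.
rewrite (ip_sqD H hxM hMN).
suff -> : ip (x - psum ip e x M) (psum ip e x M - psum ip e x N) = 0.
  by have := semi_inner_ge0 H hxM; lra.
rewrite {2 3}/psum comb_trunc// (semi_innerC H hxM (comb_in H He _ _)).
rewrite (ip_comb H He)// big1// => i _.
by rewrite (semi_innerC H (He _) hxM) (psum_orth H He orth)// mulr0.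
Qed.

End combinations.

(** * Weak eigenvalue problems *)

(* Weak form of the operator A: [pencil_rel z y] says that y = A z, where bc, bh
   and hf stand for the integrals of cuv, huv and the form of H. *)
Section pencil.
Context {R : realType} {F : lmodType R} (L V : set F) (bc bh hf : F -> F -> R).
Variables (one : F) (ctrl : Prop) (eta delta : R).
Hypotheses (Hc : semi_inner L bc) (Hv : semi_inner V hf) (VL : V `<=` L).
Hypothesis bhl : forall k x y z, L x -> L y -> L z ->
  bh (k *: x + y) z = k * bh x z + bh y z.
Hypotheses (eta0 : 0 < eta) (delta0 : 0 < delta).
Hypothesis bh_le : forall u, L u -> `|bh u u| <= eta * bc u u.
Hypothesis L1 : L one.
Hypothesis bh1 : exists2 g, L g & forall u, L u -> bh u one = bc u g.
Hypothesis V1 : ~ ctrl -> V one /\ forall v, V v -> hf v one = 0.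
(** The substitute for a Poincaré inequality. For the actual forms it comes from the completeness of
    L^2 and the connectedness of the domain, while the traces force the constant to be 0 in the
    controlled case. *)
Hypothesis closedV : forall u : nat -> F, (forall n, V (u n)) ->
  (forall eps : R, 0 < eps -> \forall N \near \oo, forall M, (N <= M)%N ->
     bc (u M - u N) (u M - u N) < eps) ->
  hf (u n) (u n) @[n --> \oo] --> 0 ->
  exists k : R, (ctrl -> k = 0) /\
    bc (u n - k *: one) (u n - k *: one) @[n --> \oo] --> 0.

Definition pair_space : set (F * F) := [set x | L x.1 /\ V x.2].
Definition pair_ip (x y : F * F) : R := bc x.1 y.1 + hf x.2 y.2.
Local Notation HS := pair_space.
Local Notation ip := pair_ip.

Lemma pair_semi_inner : semi_inner HS ip.
Proof.
split.
- by split; [exact: (semi_inner0 Hc) | exact: (semi_inner0 Hv)].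
- move=> k x y [? ?] [? ?].
  by split; [exact: (semi_innerP Hc) | exact: (semi_innerP Hv)].
- move=> k x y z [? ?] [? ?] [? ?]; rewrite /ip /=.
  by rewrite (semi_innerl Hc)// (semi_innerl Hv)//; ring.
- move=> x y [? ?] [? ?]; rewrite /ip.
  by rewrite (semi_innerC Hc)// (semi_innerC Hv).
- move=> x [? ?]; rewrite /ip addr_ge0//.
    exact: (semi_inner_ge0 Hc).
  exact: (semi_inner_ge0 Hv).
Qed.
Let H := pair_semi_inner.

Definition pencil_rel (z y : F * F) := [/\ HS z, HS y, V z.1,
  forall v, V v -> hf z.2 v = bc y.1 v - bh z.1 v &
  forall v, V v -> hf y.2 v = hf z.1 v].

Lemma bh0l z : L z -> bh 0 z = 0.
Proof.
move=> hz; have h0 := semi_inner0 Hc.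
by have := bhl 1 h0 h0 hz; rewrite scaler0 addr0; lra.
Qed.

Lemma pencil_rel0 : pencil_rel 0 0.
Proof.
have h := semi_inner0 H; have hL := semi_inner0 Hc; have hV := semi_inner0 Hv.
split=> //= v vV; rewrite (ip0l Hv)// (ip0l Hc) ?bh0l ?subrr//; exact: VL.
Qed.

Lemma pencil_relP k z y z' y' : pencil_rel z y -> pencil_rel z' y' ->
  pencil_rel (k *: z + z') (k *: y + y').
Proof.
move=> [hz hy vz zy1 zy2] [hz' hy' vz' zy1' zy2'].
split; [exact: (semi_innerP H)|exact: (semi_innerP H)|exact: (semi_innerP Hv)| |].
  case: hz hy hz' hy' => ? ? [? ?] [? ?] [? ?] v vV /=.
  have vL := VL vV.
  rewrite (semi_innerl Hv)// zy1// zy1'// (semi_innerl Hc)// bhl//.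
  by ring.
case: hz hy hz' hy' => ? ? [? ?] [? ?] [? ?] v vV /=.
by rewrite (semi_innerl Hv)// zy2// zy2'// (semi_innerl Hv).
Qed.

(** The second relation turns [hf y.2 z.2] into [hf z.1 z.2], and the first one, tested against
    [z.1], turns this into a second copy of [bc y.1 z.1] minus [bh z.1 z.1]. *)
Lemma pencil_rel_ip z y : pencil_rel z y ->
  ip y z = 2 * bc y.1 z.1 - bh z.1 z.1.
Proof.
move=> [[hz1 hz2] [hy1 hy2] vz zy1 zy2]; rewrite /ip zy2//.
by rewrite (semi_innerC Hv vz hz2) zy1//; ring.
Qed.

(** [y.2] and [z.1] need only agree modulo null vectors of [hf], so the second relation is tested
    against both of them. *)
Lemma pencil_rel_hf z y : pencil_rel z y -> hf z.1 z.1 = hf y.2 y.2.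
Proof.
move=> [[hz1 hz2] [hy1 hy2] vz zy1 zy2].
by rewrite -zy2// (semi_innerC Hv hy2 vz) -zy2.
Qed.

(** Expand the square and drop the term in [tau ^+ 2]; the cross term is at most [tau * bh z.1 z.1],
    since [2 * bc y.1 z.1] is [ip y z + bh z.1 z.1] with [ip y z <= 0]. *)
Lemma euler_step tau z y : pencil_rel z y -> ip y z <= 0 -> 0 <= tau ->
  (1 - tau * eta) * bc z.1 z.1 <= bc (z - tau *: y).1 (z - tau *: y).1.
Proof.
move=> zy yz0 tau0; move: (pencil_rel_ip zy) => yzE.
have [[hz1 hz2] [hy1 hy2] vz zy1 zy2] := zy.
have hty := sub_Z Hc tau hy1.
rewrite /= (ip_sqB Hc)// (ipZr Hc)//.
have := semi_inner_ge0 Hc hty => t0.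
rewrite (semi_innerC Hc hz1 hy1).
have b0 := bh_le hz1.
have : bh z.1 z.1 <= eta * bc z.1 z.1 by rewrite (le_trans _ b0)// ler_norm.
move=> {}b0.
have e1 : tau * (2 * bc y.1 z.1) <= tau * (eta * bc z.1 z.1).
  by rewrite ler_wpM2l//; lra.
by lra.
Qed.

Variables (e : nat -> F * F) (l : nat -> R).
Hypothesis eA : forall n, pencil_rel (e n) (l n *: e n).
Hypothesis orth : forall n m, n != m -> ip (e n) (e m) = 0.
Hypothesis total : forall x, HS x -> forall eps : R, 0 < eps ->
  exists n (k : 'I_n -> R) (i : 'I_n -> nat),
    let z := x - \sum_j k j *: e (i j) in ip z z < eps.

Let He n : HS (e n). Proof. by have [] := eA n. Qed.

Lemma pencil_rel_comb b N :
  pencil_rel (comb e b N) (comb e (fun n => b n * l n) N).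
Proof.
elim: N => [|N ih]; first by rewrite /comb !big_ord0; exact: pencil_rel0.
rewrite !combS [X in pencil_rel X]addrC [X in pencil_rel _ X]addrC.
by rewrite -scalerA; apply: pencil_relP.
Qed.

Let nrm n := ip (e n) (e n).
Let nrm0 n : 0 <= nrm n. Proof. exact: (semi_inner_ge0 H). Qed.

Section positive_modes.
Variable f : F.
Hypothesis Lf : L f.
Hypothesis lpos : forall n, 0 < l n -> delta <= l n.
Hypothesis fneg : forall n, l n <= 0 -> ip (f, 0) (e n) = 0.

Let x : F * F := (f, 0).
Let hx : HS x. Proof. by split => //; exact: (semi_inner0 Hv). Qed.
Let a := fourier ip e x.
(** Coefficients of A^-1 applied to [x]. At the modes with [l n <= 0], the kernel included,
    [a n = 0] and the quotient is 0. *)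
Let b n := a n / l n.

Let a0 n : l n <= 0 -> a n = 0.
Proof. by move=> ln; rewrite /a /fourier fneg// mul0r. Qed.

Let bl n : b n * l n = a n.
Proof.
rewrite /b; have [ln|ln] := lerP (l n) 0; first by rewrite a0// !mul0r.
by rewrite divfK// gt_eqF.
Qed.

Let xs N := psum ip e x N.
Let ys N := comb e b N.
Let u N := (ys N).1.

Let yx N : pencil_rel (ys N) (xs N).
Proof.
have := pencil_rel_comb b N.
suff -> : comb e (fun n => b n * l n) N = xs N by [].
by apply: eq_comb => n; rewrite bl.
Qed.

Let xs_cvg : ip (xs N - x) (xs N - x) @[N --> \oo] --> 0.
Proof. exact: (psum_cvg H He orth total). Qed.

Let hxs N : HS (xs N). Proof. by have [] := yx N. Qed.
Let Vu N : V (u N). Proof. by have [] := yx N. Qed.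

(** As [x.2 = 0], the energy of [u N] is that of the second component of the error [xs N - x]. *)
Let hf_u : hf (u N) (u N) @[N --> \oo] --> 0.
Proof.
apply: (squeeze_cvgr _ (cvg_cst 0) xs_cvg); apply: nearW => N /=.
rewrite (semi_inner_ge0 Hv)//= (pencil_rel_hf (yx N)) /ip /=.
have := semi_inner_ge0 Hc (sub_B Hc (hxs N).1 Lf).
by rewrite subr0; lra.
Qed.

Let b_le n : b n ^+ 2 * nrm n <= (delta^-1 * a n) ^+ 2 * nrm n.
Proof.
rewrite ler_wpM2r// /b; have [ln|ln] := lerP (l n) 0.
  by rewrite a0// mul0r mulr0.
rewrite [a n / _]mulrC (exprMn 2 (l n)^-1) (exprMn 2 delta^-1) ler_wpM2r ?sqr_ge0//.
rewrite lerXn2r ?nnegrE ?invr_ge0 ?(ltW delta0) ?(ltW ln)//.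
by rewrite lef_pV2 ?posrE// lpos.
Qed.

(** The spectral gap makes division by [l n] bounded by [delta^-1] on the modes present, so the
    tails of [ys] are controlled by those of the convergent [xs]. *)
Let u_cauchy (eps : R) : 0 < eps -> \forall N \near \oo, forall M, (N <= M)%N ->
  bc (u M - u N) (u M - u N) < eps.
Proof.
move=> eps0.
have e1 : 0 < eps * delta ^+ 2 by rewrite mulr_gt0// exprn_gt0.
move/cvgrPdist_lt : xs_cvg => /(_ _ e1); apply: filterS => N /=.
rewrite sub0r normrN ger0_norm; last exact: (semi_inner_ge0 H (sub_B H (hxs N) hx)).
move=> lt_eps M NM.
have [[hyM1 hyM2] _ _ _ _] := yx M; have [[hyN1 hyN2] _ _ _ _] := yx N.
apply: (@le_lt_trans _ _ (ip (ys M - ys N) (ys M - ys N))).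
  have := semi_inner_ge0 Hv (sub_B Hv hyM2 hyN2).
  by rewrite /ip /=; lra.
have dlt : delta ^+ 2 > 0 by rewrite exprn_gt0.
rewrite -(ltr_pM2r dlt); apply: le_lt_trans lt_eps.
apply: le_trans (psum_cauchy H He orth hx NM).
rewrite /ys /psum !comb_trunc// -ler_pdivlMr// mulrC -exprVn.
have hcm : HS (comb e (fun n => (N <= n)%:R * a n) M) by exact: (comb_in H He).
rewrite expr2 -mulrA -(ipZl H)// -(ipZr H)//; last exact: (sub_Z H).
rewrite combZ; apply: (ip_comb_le H He orth) => n.
have [_|_] := boolP (N <= n)%N; rewrite ?mul0r ?mulr0 ?mul1r//.
Qed.

Lemma positive_span : exists k : R, [/\ (ctrl -> k = 0),
  (~ ctrl -> k * bh one one = bc f one) &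
  (k * bc f one <= 0 -> bc f f = 0)].
Proof.
have [k [ck uk]] := closedV Vu u_cauchy hf_u.
have Lk : L (k *: one) by exact: (sub_Z Hc).
have Lu N : L (u N) by exact: VL.
exists k; split => //.
  move=> nctrl; have [V1' hf1] := V1 nctrl.
  have [g Lg bhg] := bh1.
  (* [bh] has no sign, so Cauchy-Schwarz is applied to [bc] through the representative [g] of [bh]
     against [one]. *)
  have lim1 : bh (u N) one @[N --> \oo] --> k * bh one one.
    rewrite bhg// -(ipZl Hc)//.
    under eq_fun => N do rewrite bhg//.
    exact: (cvg_ip Hc).
  have lim2 : bh (u N) one @[N --> \oo] --> bc f one.
    have h10 : HS (one, 0) by split => //; exact: (semi_inner0 Hv).
    have := cvg_ip H hxs hx h10 xs_cvg.
    rewrite {2}/ip /= (ip0r Hv) ?addr0; last exact: (semi_inner0 Hv).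
    apply: cvg_trans; apply: near_eq_cvg; apply: nearW => N /=.
    have [_ [h1 h2] _ zy _] := yx N.
    rewrite /ip /= (ip0r Hv)// addr0.
    have := zy _ V1'; rewrite hf1; last by have [[]] := yx N.
    by rewrite -/(u N); lra.
  exact: (cvg_unique _ lim1 lim2).
move=> kle0.
have h1 : bc f f = ip x x.
  by rewrite /ip /= (ip0r Hv) ?addr0//; exact: (semi_inner0 Hv).
rewrite h1; apply: (bessel_null H He orth total hx) => n.
rewrite -(fourierM H He)//.
(* (u N | f) = (A^-1 xs N | x), a sum of nonnegative terms *)
pose t n := a n ^+ 2 / l n * nrm n.
have t0 m : 0 <= t m.
  rewrite /t mulr_ge0//; have [ln|ln] := lerP (l m) 0.
    by rewrite a0// expr0n mul0r.
  by rewrite divr_ge0 ?sqr_ge0 ?ltW.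
have sE N : bc (u N) f = \sum_(m < N) t m.
  have -> : bc (u N) f = ip (ys N) x.
    by rewrite /ip /= (ip0r Hv) ?addr0//; have [[]] := yx N.
  rewrite (ip_comb H He)//; apply: eq_bigr => i _.
  rewrite (semi_innerC H (He i) hx) -(fourierM H He)// -/a /t /b.
  by rewrite /nrm expr2; ring.
have lim : bc (u N) f @[N --> \oo] --> k * bc f one.
  by rewrite (semi_innerC Hc)// -(ipZl Hc)//; exact: (cvg_ip Hc).
have nd : nondecreasing_seq (fun N => bc (u N) f).
  by apply/nondecreasing_seqP => N; rewrite !sE big_ord_recr/= lerDl.
(* The partial sums of the nonnegative [t] increase to a nonpositive limit, so every term
   vanishes. *)
have tle : t n <= 0.
  apply: le_trans kle0; rewrite -(cvg_lim _ lim)//.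
  apply: (@le_trans _ _ (bc (u n.+1) f)).
    by rewrite sE big_ord_recr/= lerDr sumr_ge0.
  by apply: nondecreasing_cvgn_le => //; apply/cvg_ex; eexists; exact: lim.
have {tle}tn : t n = 0 by apply/eqP; rewrite eq_le tle t0.
rewrite -/a -/(nrm n).
have [ln|ln] := lerP (l n) 0; first by rewrite a0// mul0r.
have [an|an] := eqVneq (a n) 0; first by rewrite an mul0r.
have -> : nrm n = t n * (l n / a n ^+ 2).
  by rewrite /t; field; rewrite an gt_eqF.
by rewrite tn mul0r mulr0.
Qed.

End positive_modes.

Section nonpositive_modes.
Variables (psi : F * F) (n0 : nat).
Hypothesis hpsi : HS psi.
Hypothesis psi1 : bc psi.1 psi.1 = 0.
Hypothesis psipos : forall n, 0 < l n -> ip psi (e n) = 0.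
Hypothesis lneg : forall n, l n < 0 -> l n <= - delta.
Hypothesis ln0 : l n0 = 0.
Hypothesis ker : forall n, n != n0 -> l n = 0 -> e n = 0.
Hypothesis e1pos : 0 < bc (e n0).1 (e n0).1.

Let b := fourier ip e psi.
(** Chosen so that [1 - tau * eta = 2^-1] in [euler_step]: one step at most doubles the square norm
    of the first component, whatever the number of modes. *)
Let tau := (2 * eta)^-1.
Let tau0 : 0 < tau. Proof. by rewrite invr_gt0 mulr_gt0. Qed.
Let d n := (1 - tau * l n)^-1.
(* k implicit Euler steps for z' = A z, starting from a partial sum of psi: they
   damp every mode but the kernel, while the first component grows by a factor
   of at most 2 in square norm. *)
Let z k N := comb e (fun n => b n * d n ^+ k) N.

Let b0 n : 0 < l n -> b n = 0.
Proof. by move=> ln; rewrite /b /fourier psipos// mul0r. Qed.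

Let step k N : bc (z k.+1 N).1 (z k.+1 N).1 <= 2 * bc (z k N).1 (z k N).1.
Proof.
have zy := pencil_rel_comb (fun n => b n * d n ^+ k.+1) N.
rewrite -/(z k.+1 N) in zy.
set y := comb e _ N in zy.
(* [psi] has no mode with a positive eigenvalue, so A is nonpositive on these combinations. *)
have yz : ip y (z k.+1 N) <= 0.
  rewrite (ip_comb_comb H He orth); apply: sumr_le0 => i _.
  rewrite -(mulr0 0); have [li|li] := lerP (l i) 0; last first.
    by rewrite b0// !mul0r.
  rewrite mul0r; apply: mulr_le0_ge0; last exact: nrm0.
  have -> : b i * d i ^+ k.+1 * l i * (b i * d i ^+ k.+1) =
    (b i * d i ^+ k.+1) ^+ 2 * l i by ring.
  by rewrite mulr_ge0_le0// sqr_ge0.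
have := euler_step zy yz (ltW tau0).
(* The step is implicit: [1 - tau * l n] undoes one factor [d n] of each coefficient. *)
suff -> : z k.+1 N - tau *: y = z k N.
  have -> : 1 - tau * eta = 2^-1.
    by rewrite /tau; field; rewrite gt_eqF.
  by lra.
rewrite combZ combB; apply: eq_comb => n; congr (_ *: _).
have [ln|ln] := lerP (l n) 0; last by rewrite b0// !mul0r mulr0 subrr.
have dn : 1 - tau * l n != 0.
  have : tau * l n <= 0 by rewrite mulr_ge0_le0// ltW.
  by move=> h; apply: lt0r_neq0; lra.
rewrite exprS (_ : _ - _ = b n * d n ^+ k * (d n * (1 - tau * l n))); last by ring.
by rewrite /d mulVf// mulr1.
Qed.

Let z_le k N : bc (z k N).1 (z k N).1 <= 2 ^+ k * bc (z 0 N).1 (z 0 N).1.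
Proof.
elim: k => [|k ih]; first by rewrite expr0 mul1r.
by apply: le_trans (step k N) _; rewrite exprS -mulrA ler_pM2l.
Qed.

(** The gap [l n <= - delta] gives [d n <= rho < 1] at every negative mode. *)
Let rho := (1 + tau * delta)^-1.

Let d_le n k : n != n0 -> (b n * d n ^+ k) ^+ 2 * nrm n <=
  (rho ^+ k * b n) ^+ 2 * nrm n.
Proof.
move=> nn0; have [ln|ln|ln] := ltrgtP (l n) 0.
- rewrite ler_wpM2r// [b n * _]mulrC (exprMn 2 (d n ^+ k)) (exprMn 2 (rho ^+ k)).
  rewrite ler_wpM2r ?sqr_ge0//.
  rewrite lerXn2r ?nnegrE//.
  + rewrite exprn_ge0// invr_ge0.
    have : tau * l n <= 0 by rewrite mulr_ge0_le0// ltW.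
    by lra.
  + by rewrite exprn_ge0// invr_ge0 addr_ge0// mulr_ge0 ?ltW.
  + have : tau * l n <= tau * - delta by rewrite ler_pM2l// lneg.
    have : 0 < tau * delta by rewrite mulr_gt0.
    move=> h1 h2.
    rewrite lerXn2r ?nnegrE ?invr_ge0//; [lra|lra|].
    by rewrite lef_pV2 ?posrE; lra.
- by rewrite b0// mul0r mulr0.
(* Any other mode with eigenvalue 0 is the zero vector. *)
- by rewrite /nrm ker// (ip0r H) ?mulr0//; exact: (semi_inner0 H).
Qed.

Let hpsum N : HS (psum ip e psi N). Proof. exact: (comb_in H He). Qed.
Let hz k N : HS (z k N). Proof. exact: (comb_in H He). Qed.
(** Since [d n0 = 1], the steps leave the component along [e n0] unchanged, and [rest] consists of
    the damped modes. *)
Let rest k N := z k N - b n0 *: e n0.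

Let rest_le k N : (n0 < N)%N -> ip (rest k N) (rest k N) <= (rho ^+ k) ^+ 2 * ip psi psi.
Proof.
move=> n0N; rewrite /rest.
have -> : b n0 *: e n0 = (b n0 * d n0 ^+ k) *: e n0.
  by rewrite /d ln0 mulr0 subr0 invr1 expr1n mulr1.
rewrite [z k N - _](comb_delta e (fun n => b n * d n ^+ k) n0N).
apply: (@le_trans _ _ (ip (rho ^+ k *: psum ip e psi N) (rho ^+ k *: psum ip e psi N))).
  rewrite combZ; apply: (ip_comb_le H He orth) => n.
  have [->|nn0] := eqVneq n n0; last by rewrite mul1r d_le.
  by rewrite mul0r expr0n mul0r; exact: mulr_ge0 (sqr_ge0 _) (nrm0 _).
rewrite (ipZl H)// ?(ipZr H)//; last exact: (sub_Z H).
rewrite mulrA -expr2 ler_wpM2l ?sqr_ge0//.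
exact: (psum_le H He orth).
Qed.

Let C := bc (b n0 *: (e n0).1) (b n0 *: (e n0).1).

(** The kernel component is [z k N - rest k N]. The first component of [psi] being null, that of
    [z 0 N] has the size of that of [psum ip e psi N - psi], and [k] steps multiply its square by at
    most [2 ^+ k]. *)
Let C_le k N : (n0 < N)%N ->
  C <= 2 * 2 ^+ k * ip (psum ip e psi N - psi) (psum ip e psi N - psi)
       + 2 * (rho ^+ k) ^+ 2 * ip psi psi.
Proof.
move=> n0N.
have hr : HS (rest k N) by apply: (sub_B H) => //; exact: (sub_Z H).
have -> : C = bc ((z k N).1 - (rest k N).1) ((z k N).1 - (rest k N).1).
  by rewrite /C /rest /= opprB addrC subrK.
have [hz1 hz2] := hz k N; have [hr1 hr2] := hr.
have p : bc ((z k N).1 - (rest k N).1) ((z k N).1 - (rest k N).1) <=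
    2 * bc (z k N).1 (z k N).1 + 2 * bc (rest k N).1 (rest k N).1.
  have := semi_inner_ge0 Hc (sub_D Hc hz1 hr1).
  by rewrite (ip_sqB Hc)// (ip_sqD Hc)//; lra.
apply: (le_trans p).
have r1 : bc (rest k N).1 (rest k N).1 <= (rho ^+ k) ^+ 2 * ip psi psi.
  apply: le_trans (rest_le k n0N); rewrite /ip.
  by have := semi_inner_ge0 Hv hr2; lra.
have r2 : bc (z k N).1 (z k N).1 <=
    2 ^+ k * ip (psum ip e psi N - psi) (psum ip e psi N - psi).
  apply: le_trans (z_le k N) _; rewrite ler_wpM2l ?exprn_ge0//.
  have -> : z 0 N = psum ip e psi N.
    by apply: eq_comb => n; rewrite expr0 mulr1.
  have [hp1 hp2] := hpsum N; have [hq1 hq2] := hpsi.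
  have := semi_inner_ge0 Hv (sub_B Hv hp2 hq2).
  rewrite /ip /= (ip_sqB Hc)// psi1 (ip_nullr Hc hq1 hp1)//.
  by lra.
by lra.
Qed.

(** The order of the limits matters: with [k] fixed, [N] goes to infinity and the truncation error
    beats the factor [2 ^+ k]; only then does [k] go to infinity, so that [rho ^+ k] kills the rest.
    Hence the kernel component has a null first component, whereas that of [e n0] is not null. *)
Lemma nonpositive_orth_kernel : ip psi (e n0) = 0.
Proof.
have C_le1 k : C <= 2 * (rho ^+ k) ^+ 2 * ip psi psi.
  have cv : (2 * 2 ^+ k * ip (psum ip e psi N - psi) (psum ip e psi N - psi)
       + 2 * (rho ^+ k) ^+ 2 * ip psi psi) @[N --> \oo] -->
       2 * 2 ^+ k * 0 + 2 * (rho ^+ k) ^+ 2 * ip psi psi.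
    apply: cvgD; last exact: cvg_cst.
    by apply: cvgMr; exact: (psum_cvg H He orth total).
  rewrite mulr0 add0r in cv.
  rewrite -(cvg_lim _ cv)//; apply: limr_ge; first by apply/cvg_ex; eexists; exact: cv.
  by exists n0.+1 => // N /= n0N; exact: C_le.
have rho1 : `|rho| < 1.
  have td : 0 < tau * delta by rewrite mulr_gt0.
  rewrite ger0_norm /rho ?invr_ge0; last by lra.
  by rewrite invf_lt1; lra.
have cv : (2 * (rho ^+ k) ^+ 2 * ip psi psi) @[k --> \oo] --> 2 * (0 ^+ 2) * ip psi psi.
  apply: cvgMl; apply: cvgMr; rewrite expr2.
  under eq_fun do rewrite expr2.
  by apply: cvgM; exact: cvg_expr.
rewrite expr0n/= mulr0 mul0r in cv.
have C0 : C <= 0.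
  rewrite -(cvg_lim _ cv)//; apply: limr_ge; first by apply/cvg_ex; eexists; exact: cv.
  by apply: nearW => k; exact: C_le1.
have [he1 he2] := He n0.
move: C0; rewrite /C (ipZl Hc)//; last exact: (sub_Z Hc).
rewrite (ipZr Hc)// mulrA -expr2 pmulr_lle0// => bb.
have /eqP : b n0 ^+ 2 = 0 by apply/eqP; rewrite eq_le bb sqr_ge0.
rewrite sqrf_eq0 => /eqP bn0.
by rewrite -(fourierM H He)// -/b bn0 mul0r.
Qed.

End nonpositive_modes.

End pencil.

(** * Square-integrable functions *)

Section square_integrable.
Context d (T : measurableType d) (R : realType).
Variables (mu : {measure set T -> \bar R}) (D : set T).
Hypothesis mD : measurable D.
Implicit Types (f g u v w : T -> R).

(** Only the values on [D] count; [sqi_Lfun] identifies this set with the functions whose extension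
    by 0 is in L^2. *)
Definition sqi : set (T -> R) := [set f : T -> R |
  measurable_fun D f /\ mu.-integrable D (EFin \o (fun x => f x ^+ 2))].

Definition ae_bounded w := measurable_fun D w /\
  exists C : R, \forall x \ae mu, D x -> `|w x| <= C.

Lemma ae_le_integrable f g : measurable_fun D f -> mu.-integrable D (EFin \o g) ->
  (\forall x \ae mu, D x -> `|f x| <= g x) -> mu.-integrable D (EFin \o f).
Proof.
move=> mf ig fg; apply/integrableP; split; first exact/measurable_EFinP.
have [mg] := integrableP _ _ _ ig; apply: le_lt_trans.
apply: ae_ge0_le_integral => //.
- by apply: measurableT_comp => //; exact/measurable_EFinP.
- by apply: measurableT_comp => //.
- apply: filterS fg => x fg Dx; have := fg Dx; rewrite /= lee_fin.
  by move=> h; rewrite (le_trans h)// ler_norm.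
Qed.

Lemma ae_eq_Rintegral f g : measurable_fun D f -> measurable_fun D g ->
  f = g %[ae mu in D] -> \int[mu]_(x in D) f x = \int[mu]_(x in D) g x.
Proof.
move=> mf mg fg; congr fine; apply: ae_eq_integral => //.
- exact/measurable_EFinP.
- exact/measurable_EFinP.
- by apply: filterS fg => x fg Dx; rewrite fg.
Qed.

Lemma ae_ge0_Rintegral f : measurable_fun D f ->
  (\forall x \ae mu, D x -> 0 <= f x) -> 0 <= \int[mu]_(x in D) f x.
Proof.
move=> mf f0; rewrite (@ae_eq_Rintegral f (fun x => `|f x|))//.
- by apply: Rintegral_ge0 => x _.
- exact: measurableT_comp.
- by apply: filterS f0 => x f0 Dx; rewrite ger0_norm// f0.
Qed.

Lemma sqi_Lfun f : (f \_ D \in Lfun mu 2%:E) <-> sqi f.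
Proof.
split=> [h|[mf if2]].
  have mf : measurable_fun D f.
    apply/(measurable_restrictT _ mD).
    by move: h; rewrite inE => /andP[]; rewrite inE.
  split => //; apply/(integrable_mkcond _ mD).
  have := Lfun2_integrable_sqr h.
  apply: eq_integrable => // x _ /=.
  by rewrite !patchE; case: ifP => //; rewrite expr0n.
rewrite inE; apply/andP; split.
  by rewrite inE; exact/(measurable_restrictT _ mD).
rewrite inE /= /finite_norm unlock poweR_lty//.
have /integrableP[_] := (integrable_mkcond _ mD).1 if2.
apply: le_lt_trans; rewrite le_eqVlt; apply/orP; left; apply/eqP.
apply: eq_integral => x _ /=; rewrite !patchE powR_mulrn//.
case: ifP => _ /=; last by rewrite !normr0 expr0n.
by rewrite normrX.
Qed.

Lemma sqi_mul_integrable f g : sqi f -> sqi g ->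
  mu.-integrable D (EFin \o (fun x => f x * g x)).
Proof.
move=> [mf f2] [mg g2].
apply: (@ae_le_integrable _ (fun x => f x ^+ 2 + g x ^+ 2)).
- exact: measurable_funM.
- by have := integrableD mD f2 g2; exact: eq_integrable.
- apply: aeW => x _; rewrite normrM.
  have : 0 <= (`|f x| - `|g x|) ^+ 2 by rewrite sqr_ge0.
  have := sqr_ge0 (f x); have := sqr_ge0 (g x).
  rewrite -(real_normK (num_real (f x))) -(real_normK (num_real (g x))).
  by rewrite sqrrB; lra.
Qed.

Lemma sqi0 : sqi 0.
Proof.
split; first exact: measurable_cst.
by have := integrable0 mu D; apply: eq_integrable => // x _ /=; rewrite expr0n.
Qed.

Lemma sqiP k f g : sqi f -> sqi g -> sqi (k *: f + g).
Proof.
move=> hf hg; have fg := sqi_mul_integrable hf hg.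
case: hf hg => mf f2 [mg g2]; split.
  by apply: measurable_funD => //; exact: measurable_funM.
have := integrableD mD (integrableD mD (integrableZl mD (k ^+ 2) f2)
  (integrableZl mD (2 * k) fg)) g2.
apply: eq_integrable => // x _ /=; congr EFin.
by rewrite !fctE /= /GRing.scale /=; ring.
Qed.

Lemma ae_boundedM w f : ae_bounded w -> sqi f -> sqi (fun x => w x * f x).
Proof.
move=> [mw [C wC]] [mf f2]; split; first exact: measurable_funM.
apply: (@ae_le_integrable _ (fun x => C ^+ 2 * f x ^+ 2)).
- by apply: measurable_funX; exact: measurable_funM.
- exact: (integrableZl mD (C ^+ 2) f2).
- apply: filterS wC => x wC Dx; rewrite ger0_norm ?sqr_ge0//.
  rewrite exprMn ler_wpM2r ?sqr_ge0// -(real_normK (num_real (w x))).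
  by rewrite lerXn2r ?nnegrE ?wC// (le_trans _ (wC Dx)).
Qed.

Lemma sqi_wmul_integrable w f g : ae_bounded w -> sqi f -> sqi g ->
  mu.-integrable D (EFin \o (fun x => w x * f x * g x)).
Proof. by move=> hw hf hg; apply: sqi_mul_integrable => //; exact: ae_boundedM. Qed.

(** With [w] among [c], [h], [sigma] and constants, and Lebesgue measure or arc length, all the
    forms of the problem are of this type. *)
Definition wip w f g := \int[mu]_(x in D) (w x * f x * g x).

Lemma wip_linear w k f g u : ae_bounded w -> sqi f -> sqi g -> sqi u ->
  wip w (k *: f + g) u = k * wip w f u + wip w g u.
Proof.
move=> hw hf hg hu; rewrite /wip.
have i1 := sqi_wmul_integrable hw hf hu; have i2 := sqi_wmul_integrable hw hg hu.
rewrite -RintegralZl// -RintegralD//; last exact: (integrableZl mD k i1).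
apply: eq_Rintegral => x _; rewrite !fctE /= /GRing.scale /=.
by ring.
Qed.

Lemma wipC w f g : wip w f g = wip w g f.
Proof. by apply: eq_Rintegral => x _; rewrite mulrAC. Qed.

Lemma wip_ae w f f' g : ae_bounded w -> sqi f -> sqi f' -> sqi g ->
  f = f' %[ae mu in D] -> wip w f g = wip w f' g.
Proof.
move=> [mw _] [mf _] [mf' _] [mg _] ff'; apply: ae_eq_Rintegral.
- by apply: measurable_funM => //; exact: measurable_funM.
- by apply: measurable_funM => //; exact: measurable_funM.
- by apply: filterS ff' => x ff' Dx; rewrite ff'.
Qed.

Lemma wip_semi_inner w : ae_bounded w ->
  (\forall x \ae mu, D x -> 0 <= w x) -> semi_inner sqi (wip w).
Proof.
move=> hw w0; split.
- exact: sqi0.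
- exact: sqiP.
- by move=> *; exact: wip_linear.
- by move=> *; exact: wipC.
- move=> x [mx _]; apply: ae_ge0_Rintegral.
    by apply: measurable_funM => //; apply: measurable_funM => //; case: hw.
  apply: filterS w0 => t w0 Dt; rewrite -mulrA -expr2 mulr_ge0 ?sqr_ge0//.
  exact: w0.
Qed.

Lemma wip_le w w' f : ae_bounded w -> ae_bounded w' -> sqi f ->
  (\forall x \ae mu, D x -> w x <= w' x) -> wip w f f <= wip w' f f.
Proof.
move=> hw hw' hf ww'; rewrite -subr_ge0 /wip -RintegralB//; last 2 first.
- exact: sqi_wmul_integrable.
- exact: sqi_wmul_integrable.
case: hw hw' hf => mw _ [mw' _] [mf _].
apply: ae_ge0_Rintegral.
  by apply: measurable_funB; do 2 (apply: measurable_funM => //).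
apply: filterS ww' => x ww' Dx; rewrite -!mulrA -expr2 -mulrBl.
by rewrite mulr_ge0 ?sqr_ge0// subr_ge0 ww'.
Qed.

Lemma ae_bounded_cst k : ae_bounded (cst k).
Proof. by split; [exact: measurable_cst | exists `|k|; exact: aeW]. Qed.

Lemma wipZ k f g : sqi f -> sqi g -> wip (cst k) f g = k * wip (cst 1) f g.
Proof.
move=> hf hg; rewrite /wip -RintegralZl//.
  by apply: eq_Rintegral => x _ /=; rewrite mul1r mulrA.
exact: (sqi_wmul_integrable (ae_bounded_cst 1) hf hg).
Qed.

Lemma wip_eq0 w f : ae_bounded w -> (\forall x \ae mu, D x -> 0 < w x) ->
  sqi f -> wip w f f = 0 -> f = cst 0 %[ae mu in D].
Proof.
move=> hw w0 hf wf0.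
have iw := sqi_wmul_integrable hw hf hf.
have mwf := measurable_int _ iw.
have : (\int[mu]_(x in D) `|(w x * f x * f x)%:E|)%E = 0%E.
  rewrite -[RHS](_ : (wip w f f)%:E = 0%E); last by rewrite wf0.
  rewrite /wip /Rintegral fineK//; last exact: integrable_fin_num.
  apply: ae_eq_integral => //; first by apply: measurableT_comp.
  apply: filterS w0 => x w0 Dx; rewrite gee0_abs// lee_fin -mulrA -expr2.
  by rewrite mulr_ge0 ?sqr_ge0// ltW// w0.
move/(ae_eq_integral_abs _ mD mwf).1.
apply: filterS2 w0 => x w0 /[swap] Dx /(_ Dx) /= [] /eqP.
by rewrite !mulf_eq0 (gt_eqF (w0 Dx)) /= orbb => /eqP.
Qed.

Lemma Linfty_ae_bounded f : (f \_ D) \in Lfun mu +oo%E -> ae_bounded f.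
Proof.
rewrite inE => /andP[]; rewrite inE /= => mf; rewrite inE /= /finite_norm unlock.
have mfD : measurable_fun D f by exact/(measurable_restrictT _ mD).
(* The norm is an essential supremum only if the whole space has positive measure; otherwise every
   property holds almost everywhere. *)
case: ifPn => [_ lty|]; last first.
  rewrite -leNgt measure_le0 => /eqP mu0 _.
  by split=> //; exists 0; exact: measure0_ae.
split=> //.
have := ess_sup_ge mu (abse \o (EFin \o f \_ D)).
move: lty; case: (ess_sup _ _) => [r _|//|].
  move=> h; exists r; apply: filterS h => x /=.
  by rewrite patchE lee_fin => + Dx; rewrite mem_set.
(* An essential supremum equal to [-oo] puts an absolute value below [-oo] almost everywhere, so
   that nothing is left to bound. *)
move=> _ h; exists 0; apply: filterS h => x /=.
by rewrite leeNy_eq.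
Qed.

End square_integrable.

Lemma cauchy_subseq (R : realType) (P : nat -> nat -> R -> Prop) (e : nat -> R) :
  (forall k, 0 < e k) ->
  (forall eps : R, 0 < eps -> \forall N \near \oo, forall M, (N <= M)%N -> P N M eps) ->
  exists g : nat -> nat, (forall k, (g k <= g k.+1)%N) /\
    forall k M, (g k <= M)%N -> P (g k) M (e k).
Proof.
move=> e0 HP.
have /choice[N HN] k : exists N, forall n, (N <= n)%N ->
    forall M, (n <= M)%N -> P n M (e k).
  by have [N _ HN] := HP _ (e0 k); exists N.
(* Summing the ranks makes the sequence nondecreasing and keeps its [k]-th term above [N k]. *)
exists (fun k => \sum_(i < k.+1) N i)%N; split => k.
  by rewrite [leqRHS]big_ord_recr/= leq_addr.
by apply: HN; rewrite big_ord_recr/= leq_addl.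
Qed.

Lemma geometric_cauchy (R : realType) (u : nat -> R) (s : R) : 0 <= s ->
  (forall k, `|u k.+1 - u k| <= s * 2^-1 ^+ k) ->
  exists l : R, u @ \oo --> l /\ forall k, `|u k - l| <= 2 * s * 2^-1 ^+ k.
Proof.
move=> s0 us.
have tail k m : `|u (k + m)%N - u k| <= 2 * s * (2^-1 ^+ k - 2^-1 ^+ (k + m)).
  elim: m => [|m ih]; first by rewrite addn0 subrr normr0 subrr mulr0.
  rewrite addnS; have := us (k + m)%N.
  have := ler_normD (u (k + m).+1 - u (k + m)%N) (u (k + m)%N - u k).
  rewrite addrA subrK exprS; set x := 2^-1 ^+ (k + m) in ih *; set y := 2^-1 ^+ k in ih *.
  by move: ih; lra.
have bnd k m : `|u (k + m)%N - u k| <= 2 * s * 2^-1 ^+ k.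
  apply: le_trans (tail k m) _; rewrite ler_wpM2l//; first by rewrite mulr_ge0.
  by rewrite gerBl exprn_ge0// invr_ge0.
have cg : 2 * s * 2^-1 ^+ k @[k --> \oo] --> (0 : R).
  rewrite -[X in _ --> X](mulr0 (2 * s)); apply: cvgMr; apply: cvg_expr.
  by rewrite ger0_norm ?invr_ge0// invf_lt1//; lra.
have cu : cvgn u.
  apply/cauchy_cvgP/cauchy_exP => eps eps0.
  move/cvgrPdist_lt : cg => /(_ _ eps0)[k _ /(_ k (leqnn k))] /=.
  rewrite sub0r normrN => lt_eps.
  exists (u k) => //; exists k => // m /= km.
  rewrite /ball /= distrC -(subnKC km).
  by apply: le_lt_trans (bnd k _) _; apply: le_lt_trans lt_eps; rewrite ler_norm.
exists (limn u); split => // k.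
rewrite distrC; have c : (`|u n - u k|) @[n --> \oo] --> `|limn u - u k|.
  by apply: cvg_norm; apply: cvgB => //; exact: cvg_cst.
rewrite -(cvg_lim _ c)//; apply: limr_le; first by apply/cvg_ex; eexists; exact: c.
by exists k => // m /= km; rewrite -(subnKC km).
Qed.

(** * Completeness of L^2 *)

Section completeness.
Context d (T : measurableType d) (R : realType).
Variables (mu : {measure set T -> \bar R}) (D : set T).
Hypothesis mD : measurable D.
Local Notation sq := (wip mu D (cst 1)).
Local Notation sqi := (sqi mu D).

Let Hs : semi_inner sqi sq.
Proof.
apply: wip_semi_inner => //; first exact: ae_bounded_cst.
by apply: aeW => x _ /=.
Qed.

Lemma sq_EFin f : sqi f -> (\int[mu]_(x in D) (f x ^+ 2)%:E)%E = (sq f f)%:E.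
Proof.
move=> hf; have [mf f2] := hf.
rewrite /wip /Rintegral (_ : (\int[mu]_(x in D) (cst 1 x * f x * f x)%:E)%E =
  (\int[mu]_(x in D) (f x ^+ 2)%:E)%E); last first.
  by apply: eq_integral => x _ /=; rewrite mul1r expr2.
by rewrite fineK//; exact: integrable_fin_num.
Qed.

Section sub.
Variable u : nat -> T -> R.
Hypothesis hu : forall n, sqi (u n).
Hypothesis us : forall k, 4 ^+ k * sq (u k.+1 - u k) (u k.+1 - u k) <= 2^-1 ^+ k.+1.

Let w k : T -> R := u k.+1 - u k.
Let hw k : sqi (w k). Proof. exact: (sub_B Hs). Qed.
(** Where [S x] is finite, [|w k x|] is at most [sqrt (S x) * 2^-k]: the sequence converges
    geometrically, and the same integrable function dominates the squared error. *)
Let S x : \bar R := (\sum_(k <oo) (4 ^+ k * w k x ^+ 2)%:E)%E.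
Let mterm k : measurable_fun D (fun x => (4 ^+ k * w k x ^+ 2)%:E).
Proof.
apply/measurable_EFinP; apply: measurable_funM => //; apply: measurable_funX.
by have [] := hw k.
Qed.
Let term0 k x : (0 <= (4 ^+ k * w k x ^+ 2)%:E)%E.
Proof. by rewrite lee_fin mulr_ge0 ?sqr_ge0 ?exprn_ge0. Qed.

Let S0 x : (0 <= S x)%E. Proof. exact: nneseries_ge0. Qed.

Let mS : measurable_fun D S.
Proof. exact: ge0_emeasurable_sum. Qed.

Let intS : mu.-integrable D S.
Proof.
apply/integrableP; split => //.
under eq_integral do rewrite gee0_abs//.
rewrite integral_nneseries//.
apply: (@le_lt_trans _ _ (\sum_(k <oo) (1 / (2 ^ k.+1)%:R)%:E)%E); last first.
  by apply: (le_lt_trans (epsilon_trick0 _ _)) => //; exact: ltry.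
apply: lee_nneseries => [k _ _|k _]; first by apply: integral_ge0.
under eq_integral do rewrite EFinM.
have mw : measurable_fun D (fun x => (w k x ^+ 2)%:E).
  by apply/measurable_EFinP; apply: measurable_funX; have [] := hw k.
rewrite (ge0_integralZl_EFin mu mD _ mw); last exact: exprn_ge0.
  rewrite sq_EFin// -EFinM lee_fin div1r natrX -exprVn.
  exact: us.
by move=> x _; rewrite lee_fin sqr_ge0.
Qed.

Lemma fast_cauchy_cvg : exists v, sqi v /\
  sq (u k - v) (u k - v) @[k --> \oo] --> 0.
Proof.
(* The upper limit is measurable with no regard to convergence; it is the limit wherever [S] is
   finite. *)
pose v x : R := fine (limn_esup (fun k => (u k x)%:E)).
have mv : measurable_fun D v.
  apply: (measurableT_comp (fine_measurable measurableT)).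
  apply: measurable_fun_limn_esup => n.
  by apply/measurable_EFinP; have [] := hu n.
pose S' x := fine (S x).
have mS' : measurable_fun D S'.
  exact: (measurableT_comp (fine_measurable measurableT) mS).
have iS' : mu.-integrable D (EFin \o S').
  apply/integrableP; split.
    exact/measurable_EFinP.
  have [_] := integrableP _ _ _ intS; apply: le_lt_trans.
  apply: ge0_le_integral => //.
  - by apply: measurableT_comp => //; exact/measurable_EFinP.
  - by apply: measurableT_comp => //.
  - move=> x _; rewrite /S' /=; have := S0 x.
    by case: (S x) => //= r; rewrite leey.
have key : \forall x \ae mu, D x -> forall k,
    (u k x - v x) ^+ 2 <= 4 * (4^-1 ^+ k * S' x).
  apply: filterS (integrable_ae mD intS) => x /[swap] Dx /(_ Dx) Sfin.
  have SE : S x = (S' x)%:E by rewrite /S' fineK.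
  have S'0 : 0 <= S' x by rewrite -lee_fin -SE.
  have wS k : 4 ^+ k * w k x ^+ 2 <= S' x.
    rewrite -lee_fin -SE.
    apply: le_trans (nneseries_lim_ge k.+1 _); last by move=> *; exact: term0.
    by rewrite big_nat_recr//= leeDr// sume_ge0.
  have ws k : `|u k.+1 x - u k x| <= Num.sqrt (S' x) * 2^-1 ^+ k.
    have : `|w k x| ^+ 2 <= (Num.sqrt (S' x) * 2^-1 ^+ k) ^+ 2.
      rewrite real_normK ?num_real// exprMn sqr_sqrtr// -exprM mulnC exprM.
      rewrite (_ : 2^-1 ^+ 2 = 4^-1 :> R); last by rewrite expr2; lra.
      by rewrite exprVn ler_pdivlMr ?exprn_gt0// mulrC.
    by rewrite ler_pXn2r ?nnegrE ?mulr_ge0 ?sqrtr_ge0 ?exprn_ge0 ?invr_ge0.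
  have [l [ul lb]] := @geometric_cauchy R (u ^~ x) _ (sqrtr_ge0 _) ws.
  have vl : v x = l.
    have ul' : (u k x)%:E @[k --> \oo] --> l%:E by apply: cvg_EFin => //; exact: nearW.
    rewrite /v is_cvg_limn_esupE; last by apply/cvg_ex; eexists; exact: ul'.
    by rewrite (cvg_lim _ ul').
  move=> k; rewrite vl.
  have := lb k; rewrite -(@ler_pXn2r _ 2)// ?nnegrE//.
  rewrite real_normK ?num_real// => /le_trans; apply.
  rewrite !exprMn sqr_sqrtr// -exprM mulnC exprM.
  rewrite (_ : 2^-1 ^+ 2 = 4^-1 :> R); last by rewrite expr2; lra.
  by rewrite le_eqVlt; apply/orP; left; apply/eqP; ring.
have huv k : sqi (u k - v).
  split.
    by apply: measurable_funB => //; have [] := hu k.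
  apply: (@ae_le_integrable _ _ _ _ _ _ _ (fun x => (4 * 4^-1 ^+ k) * S' x)) => //.
  - by apply: measurable_funX; apply: measurable_funB => //; have [] := hu k.
  - exact: (integrableZl mD _ iS').
  - by apply: filterS key => x h Dx; rewrite ger0_norm ?sqr_ge0// -mulrA; exact: h.
exists v; split.
  have -> : v = u 0%N - (u 0%N - v) by rewrite opprB addrC subrK.
  exact: (sub_B Hs).
have le k : sq (u k - v) (u k - v) <= 4^-1 ^+ k * (4 * \int[mu]_(x in D) S' x).
  rewrite -lee_fin -sq_EFin// mulrA (mulrC _ 4) -RintegralZl//.
  rewrite /Rintegral fineK; last first.
    by apply: integrable_fin_num => //; exact: (integrableZl mD _ iS').
  apply: ae_ge0_le_integral => //.
  - by move=> x _; rewrite lee_fin sqr_ge0.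
  - by have [_ /(measurable_int _)] := huv k.
  - by move=> x _; rewrite lee_fin mulr_ge0// fine_ge0.
  - by apply: (measurable_int mu); exact: (integrableZl mD _ iS').
  - by apply: filterS key => x h Dx; rewrite lee_fin -mulrA; exact: h.
apply: (@squeeze_cvgr _ _ _ _ (cst 0) (fun k => 4^-1 ^+ k * (4 * \int[mu]_(x in D) S' x))).
- by apply: nearW => k; rewrite le andbT (semi_inner_ge0 Hs).
- exact: cvg_cst.
- rewrite -[X in _ --> X](mul0r (4 * \int[mu]_(x in D) S' x)).
  apply: cvgMl; apply: cvg_expr.
  by rewrite ger0_norm ?invr_ge0// invf_lt1//; lra.
Qed.

End sub.

Lemma L2_complete (u : nat -> T -> R) : (forall n, sqi (u n)) ->
  (forall eps : R, 0 < eps -> \forall N \near \oo, forall M, (N <= M)%N ->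
     sq (u M - u N) (u M - u N) < eps) ->
  exists v, sqi v /\ sq (u n - v) (u n - v) @[n --> \oo] --> 0.
Proof.
move=> hu cu.
(* The factor [4^-1 ^+ k] offsets the weights [4 ^+ k] required by [fast_cauchy_cvg], and
   [2^-1 ^+ k.+1] is summable. *)
have e0 k : 0 < 4^-1 ^+ k * 2^-1 ^+ k.+1 :> R.
  by rewrite mulr_gt0 ?exprn_gt0// invr_gt0.
have [g [gm gb]] := cauchy_subseq e0 cu.
have [|k|v [hv vg]] := @fast_cauchy_cvg (u \o g); first by move=> n; exact: hu.
  rewrite -ler_pdivlMl ?exprn_gt0// -exprVn; apply: ltW.
  by apply: gb; exact: gm.
exists v; split => //.
apply/cvgrPdist_lt => eps eps0.
have e4 : 0 < eps / 4 by rewrite divr_gt0.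
have [N _ HN] := cu _ e4.
move/cvgrPdist_lt : vg => /(_ _ e4)[K _ HK].
have cvgg : exists2 k, (K <= k)%N & forall n, (maxn N (g k) <= n)%N ->
    sq (u n - u (g k)) (u n - u (g k)) < eps / 4.
  have cvg0 : 4^-1 ^+ k @[k --> \oo] --> (0 : R).
    by apply: cvg_expr; rewrite ger0_norm ?invr_ge0// invf_lt1//; lra.
  move/cvgrPdist_lt : cvg0 => /(_ _ e4)[K' _ HK'].
  exists (maxn K K'); first exact: leq_maxl.
  move=> n; rewrite geq_max => /andP[_ gn].
  apply: (lt_trans (gb _ _ gn)).
  have /= := HK' (maxn K K') (leq_maxr _ _).
  rewrite sub0r normrN => /(le_lt_trans (ler_norm _)); apply: le_lt_trans.
  rewrite ger_pMr ?exprn_gt0 ?invr_gt0// exprn_ile1 ?invr_ge0//.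
  by rewrite invf_le1//; lra.
have [k Kk Hk] := cvgg.
exists (maxn N (g k)) => // n /= Nn.
rewrite sub0r normrN ger0_norm; last exact: (semi_inner_ge0 Hs (sub_B Hs (hu n) hv)).
have := Hk _ Nn; have /= := HK _ Kk.
rewrite sub0r normrN => /(le_lt_trans (ler_norm _)) h1 h2.
have ha := sub_B Hs (hu n) (hu (g k)); have hb := sub_B Hs (hu (g k)) hv.
have -> : u n - v = (u n - u (g k)) + (u (g k) - v) by rewrite addrA subrK.
(* Positivity at the difference of the two pieces bounds the square of their sum by twice the sum of
   their squares, hence the two [eps / 4]. *)
have := semi_inner_ge0 Hs (sub_B Hs ha hb).
by rewrite (ip_sqB Hs ha hb) (ip_sqD Hs ha hb); lra.
Qed.

End completeness.

(** * Smooth bumps and weak gradients *)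

Section smooth.
Context {R : realType}.
Implicit Types (f g : R -> R) (k : nat) (P : {poly R}).

Fixpoint smooth_upto k f : Prop :=
  if k is k'.+1 then
    exists2 f', (forall x : R, is_derive x 1 f (f' x)) & smooth_upto k' f'
  else True.

Definition smooth f := forall k, smooth_upto k f.

Lemma smooth_upto_pred k f : smooth_upto k.+1 f -> smooth_upto k f.
Proof.
elim: k f => // k ih f [f' df' sf']; exists f' => //.
exact: ih.
Qed.

Lemma smooth_derivable f : smooth f -> forall x : R, derivable f x 1.
Proof. by move=> /(_ 1)[f' df' _] x; have [] := df' x. Qed.

Lemma smooth_derive1 f : smooth f -> smooth (derive1 f).
Proof.
move=> sf k; have [f' df' sf'] := sf k.+1.
suff -> : derive1 f = f' by [].
by apply/funext => x; rewrite derive1E; have [_ ->] := df' x.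
Qed.

Lemma smooth_continuous f : smooth f -> continuous f.
Proof.
move=> sf x; apply/differentiable_continuous/derivable1_diffP.
exact: smooth_derivable.
Qed.

Lemma smooth_uptoD k f g : smooth_upto k f -> smooth_upto k g ->
  smooth_upto k (fun x => f x + g x).
Proof.
elim: k f g => // k ih f g [f' df sf] [g' dg sg].
exists (fun x => f' x + g' x); last exact: ih.
by move=> x; apply: is_deriveD.
Qed.

Lemma smooth_uptoM k f g : smooth_upto k f -> smooth_upto k g ->
  smooth_upto k (fun x => f x * g x).
Proof.
elim: k f g => // k ih f g sf sg.
have [f' df sf'] := sf; have [g' dg sg'] := sg.
exists (fun x => f x * g' x + g x * f' x).
  move=> x; apply: is_deriveM.
by apply: smooth_uptoD; apply: ih => //; exact: smooth_upto_pred.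
Qed.

Lemma smooth_upto_cst k (c : R) : smooth_upto k (cst c).
Proof. by elim: k c => // k ih c; exists (cst 0) => // x; exact: is_derive_cst. Qed.

Lemma smooth_upto_affine k f (c d : R) : smooth_upto k f ->
  smooth_upto k (fun x => f (c * x + d)).
Proof.
elim: k f => // k ih f [f' df sf].
exists (fun x => f' (c * x + d) * c); last first.
  apply: (smooth_uptoM (ih _ sf)); exact: smooth_upto_cst.
move=> x.
have h : is_derive x (1 : R) (fun x => c * x + d) c.
  have := @is_deriveD _ _ _ (fun x : R => c * x) (cst d) x 1 c 0.
  rewrite addr0; apply.
  by have := @is_deriveZ _ _ _ (@id R) c x 1 1; rewrite /GRing.scale /= mulr1; apply.
have := @is_derive1_comp R f (fun x => c * x + d) x _ _ (df _) h.
by rewrite mulrC.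
Qed.

Lemma smooth_uptoX k f n : smooth_upto k f -> smooth_upto k (fun x => f x ^+ n).
Proof.
move=> sf; elim: n => [|n ih]; first exact: (smooth_upto_cst k 1).
have -> : (fun x => f x ^+ n.+1) = (fun x => f x * f x ^+ n).
  by apply/funext => x; rewrite exprS.
exact: smooth_uptoM.
Qed.

(* This family of functions is stable under derivation. *)
Definition flat P : R -> R :=
  fun x => if 0 < x then P.[x^-1] * expR (- x^-1) else 0.

(** With [y = x^-1], one term of the exponential series gives [y ^+ i.+1 <= (i.+1)! * expR y], so
    each monomial times [expR (- y)] is at most a constant times [x]. *)
Lemma flat_bound P : exists C : R, forall x, `|flat P x| <= C * `|x|.
Proof.
exists (\sum_(i < size P) `|P`_i| * (i.+1)`!%:R) => x.
have C0 : 0 <= \sum_(i < size P) `|P`_i| * (i.+1)`!%:R :> R.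
  by apply: sumr_ge0 => i _; rewrite mulr_ge0.
rewrite /flat; case: ltP => x0; last by rewrite normr0 mulr_ge0.
have y0 : 0 < x^-1 by rewrite invr_gt0.
rewrite normrM (ger0_norm (expR_ge0 _)) (gtr0_norm x0) horner_coef.
apply: le_trans (ler_wpM2r (expR_ge0 _) (ler_norm_sum _ _ _)) _.
rewrite !mulr_suml; apply: ler_sum => i _.
rewrite normrM (ger0_norm (exprn_ge0 _ (ltW y0))) -!mulrA ler_wpM2l//.
rewrite -ler_pdivrMr// mulrAC -exprSr expRN ler_pdivrMr ?expR_gt0//.
have := expR_ge1Dxn i (ltW y0).
have f0 : (0 : R) < (i.+1)`!%:R by rewrite ltr0n fact_gt0.
move=> h; rewrite mulrC -ler_pdivrMr//; lra.
Qed.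

Lemma is_derive_flat P (x : R) :
  is_derive x 1 (flat P) (flat ('X^2 * (P - P^`())) x).
Proof.
have [x0|x0|->] := ltrgtP x 0.
- have -> : flat ('X^2 * (P - P^`())) x = 0 by rewrite /flat ltNge (ltW x0).
  apply: (@near_eq_is_derive _ _ _ (cst 0)) => //.
  near=> y; rewrite /flat ltNge.
  suff -> : y <= 0 by [].
  by near: y; apply: filterS (lt_nbhsl x0) => y /ltW.
- have -> : flat ('X^2 * (P - P^`())) x =
    ('X^2 * (P - P^`())).[x^-1] * expR (- x^-1) by rewrite /flat x0.
  pose F := (fun y : R => P.[y^-1] * expR (- y^-1)).
  suff dF : is_derive x (1 : R) F (('X^2 * (P - P^`())).[x^-1] * expR (- x^-1)).
    apply: near_eq_is_derive dF.
    near=> y; rewrite /flat; suff -> : 0 < y by [].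
    by near: y; exact: lt_nbhsr.
  have xn0 : x != 0 by rewrite gt_eqF.
  have dV : is_derive x (1 : R) (fun y : R => y^-1) (- x ^- 2).
    have := @is_deriveV R (@id R) x 1 1 xn0 _.
    by rewrite /GRing.scale /= mulr1; apply.
  have dP : is_derive (x^-1) (1 : R) (horner P) (P^`()).[x^-1].
    rewrite derivE derive1E; apply: derivableP; exact: derivable_horner.
  have h1 := @is_derive1_comp R (horner P) (fun y : R => y^-1) x _ _ dP dV.
  have dN : is_derive x (1 : R) (fun y : R => - y^-1) (x ^- 2).
    by have := @is_deriveN _ _ _ (fun y : R => y^-1) x 1 _ dV; rewrite opprK.
  have h2 := @is_derive1_comp R expR (fun y : R => - y^-1) x _ _ (is_derive_expR _) dN.
  have -> : ('X^2 * (P - P^`())).[x^-1] * expR (- x^-1) =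
      P.[x^-1] * (expR (- x^-1) / x ^+ 2) +
      expR (- x^-1) * (P^`().[x^-1] * - x ^- 2).
    by rewrite hornerM hornerXn hornerD hornerN; field.
  exact: (@is_deriveM _ _ _ _ x 1 _ _ h1 h2).
- have -> : flat ('X^2 * (P - P^`())) 0 = 0 by rewrite /flat ltxx.
  have [C hC] := flat_bound (P * 'X).
  have lim : (fun h => h^-1 *: ((flat P \o shift 0) (h *: 1) - flat P 0)) @ 0^' --> (0 : R).
    apply/cvgrPdist_le => /= e e0.
    near=> h.
    rewrite /= sub0r normrN /GRing.scale /= mulr1 addr0.
    have -> : flat P 0 = 0 by rewrite /flat ltxx.
    rewrite subr0.
    have -> : h^-1 * flat P h = flat (P * 'X) h.
      rewrite /flat; case: ifP => _; last by rewrite mulr0.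
      by rewrite hornerMX mulrA [h^-1 * _]mulrC.
    apply: (le_trans (hC h)).
    have hh : `|h| <= e / (`|C| + 1).
      near: h.
      by apply: dnbhs0_le; rewrite divr_gt0// ltr_wpDl.
    apply: (@le_trans _ _ ((`|C| + 1) * `|h|)).
      rewrite ler_wpM2r// (le_trans (ler_norm _))// lerDl//.
    by rewrite mulrC -ler_pdivlMr// ltr_wpDl.
  apply: DeriveDef; first by apply/cvg_ex; eexists; exact: lim.
  exact/cvg_lim.
Unshelve. all: by end_near. Qed.

Lemma smooth_flat P : smooth (flat P).
Proof.
move=> k; elim: k P => // k ih P.
by exists (flat ('X^2 * (P - P^`()))) => // x; exact: is_derive_flat.
Qed.

Definition hill (a b x : R) := flat 1 (x - a) * flat 1 (b - x).

Lemma flat1_ge0 x : 0 <= flat 1 x.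
Proof. by rewrite /flat; case: ifP => // _; rewrite hornerC mul1r expR_ge0. Qed.

Lemma flat1_le1 x : flat 1 x <= 1.
Proof.
rewrite /flat; case: ifP => // x0; rewrite hornerC mul1r.
by rewrite -[leRHS]expR0 ler_expR oppr_le0 invr_ge0 ltW.
Qed.

Lemma flat1_gt0 x : (0 < flat 1 x) = (0 < x).
Proof.
by rewrite /flat; case: ifP => // x0; rewrite ?ltxx// hornerC mul1r expR_gt0.
Qed.

Lemma hill_ge0 a b x : 0 <= hill a b x.
Proof. by rewrite mulr_ge0 ?flat1_ge0. Qed.

Lemma hill_le1 a b x : hill a b x <= 1.
Proof. by rewrite mulr_ile1 ?flat1_ge0 ?flat1_le1. Qed.

Lemma hill_gt0 a b x : a < x < b -> 0 < hill a b x.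
Proof. by move=> /andP[ax xb]; rewrite mulr_gt0 ?flat1_gt0 ?subr_gt0. Qed.

Lemma hill_eq0 a b x : ~~ (a < x < b) -> hill a b x = 0.
Proof.
rewrite negb_and -!leNgt /hill => /orP[xa|bx].
  by rewrite {1}/flat subr_gt0 ltNge xa mul0r.
by rewrite {2}/flat subr_gt0 ltNge bx mulr0.
Qed.

(** Smooth functions with values in [0, 1], zero off the open interval and converging pointwise to
    its indicator: they let dominated convergence pass from test functions to rectangles. *)
Definition bump (a b : R) (n : nat) (x : R) := 1 - (1 - hill a b x) ^+ n.

Lemma smooth_bump a b n : smooth (bump a b n).
Proof.
move=> k; apply: smooth_uptoD; first exact: smooth_upto_cst.
have sh : smooth_upto k (hill a b).
  apply: smooth_uptoM.
    have := smooth_upto_affine 1 (- a) (smooth_flat 1 k).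
    by congr smooth_upto; apply/funext => x; rewrite mul1r.
  have := smooth_upto_affine (- 1) b (smooth_flat 1 k).
  by congr smooth_upto; apply/funext => x; rewrite mulN1r addrC.
have s1 : smooth_upto k (fun x => 1 - hill a b x).
  apply: smooth_uptoD; first exact: smooth_upto_cst.
  have := smooth_uptoM (smooth_upto_cst k (- 1)) sh.
  by congr smooth_upto; apply/funext => x /=; rewrite mulN1r.
have := smooth_uptoM (smooth_upto_cst k (- 1)) (smooth_uptoX n s1).
by congr smooth_upto; apply/funext => x /=; rewrite mulN1r.
Qed.

Lemma bump_ge0 a b n x : 0 <= bump a b n x.
Proof.
rewrite subr_ge0 exprn_ile1// ?subr_ge0 ?hill_le1//.
by rewrite gerBl hill_ge0.
Qed.

Lemma bump_le1 a b n x : bump a b n x <= 1.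
Proof. by rewrite gerBl exprn_ge0// subr_ge0 hill_le1. Qed.

Lemma bump_eq0 a b n x : ~~ (a < x < b) -> bump a b n x = 0.
Proof. by move=> xab; rewrite /bump hill_eq0// subr0 expr1n subrr. Qed.

Lemma bump_cvg a b x : bump a b n x @[n --> \oo] --> ((a < x < b)%R%:R : R).
Proof.
case: (boolP (a < x < b)) => xab; last first.
  by under eq_fun do rewrite bump_eq0//; exact: cvg_cst.
rewrite -[X in _ --> X](subr0 1); apply: cvgB; first exact: cvg_cst.
apply: cvg_expr; have := hill_gt0 xab; have := hill_le1 a b x => h1 h2.
by rewrite ger0_norm ?subr_ge0// gtrBl.
Qed.

Lemma bump_gt0 a b x : a < x < b -> 0 < bump a b 1 x.
Proof. by move=> xab; rewrite /bump expr1 opprB addrC subrK hill_gt0. Qed.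

End smooth.

(** * Vanishing integrals and pi-systems *)

Section pi_system.
Context d (T : measurableType d) (R : realType).
Variable mu : {measure set T -> \bar R}.
Local Open Scope ereal_scope.

(** Dynkin's argument for a signed integrand. The map [f] allows one coordinate to be treated at a
    time, and then the whole plane with [f = id]. *)
Lemma integral0_pi_system d' (S : measurableType d') (G : set (set S))
    (f : T -> S) (D : set T) (g : T -> \bar R) :
  @measurable _ S = <<s G >> -> setI_closed G ->
  measurable_fun setT f -> measurable D -> mu.-integrable D g ->
  \int[mu]_(x in D) g x = 0 ->
  (forall A, G A -> \int[mu]_(x in D `&` f @^-1` A) g x = 0) ->
  forall A, measurable A -> \int[mu]_(x in D `&` f @^-1` A) g x = 0.
Proof.
move=> GE GI mf mD ig gD0 gG A mA.
have mpre B : measurable B -> measurable (D `&` f @^-1` B).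
  by move=> mB; apply: measurableI => //; rewrite -[_ @^-1` _]setTI; exact: mf.
have ipre B : measurable B -> mu.-integrable (D `&` f @^-1` B) g.
  by move=> mB; apply: integrableS ig => //; exact: mpre.
have {}mA : <<s G >> A by rewrite -GE.
move: A mA.
apply: (@dynkin_induction _ S G (fun A => \int[mu]_(x in D `&` f @^-1` A) g x = 0)).
- exact: GE.
- exact: GI.
- by rewrite preimage_setT setIT.
- exact: gG.
- move=> B mB B0.
  have := @integral_setU _ _ _ mu (D `&` f @^-1` B) (D `&` f @^-1` (~` B)) g (mpre _ mB)
    (mpre _ (measurableC mB)).
  rewrite -setIUr -preimage_setU setUv preimage_setT setIT gD0 B0 add0e => <- //.
  + exact: measurable_int ig.
  + by apply/disj_setPS => x [[_ ?] [_]].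
- move=> F mF tF F0.
  rewrite preimage_bigcup setI_bigcupr integral_bigcup.
  + by apply: eseries0 => i _ _; exact: F0.
  + by apply/trivIsetP => i j _ _ ij; move/trivIsetP : tF => /(_ i j I I ij) Fij;
      rewrite setIACA setIid -preimage_setI Fij preimage_set0 setI0.
  + by move=> k; exact: mpre.
  + by rewrite -setI_bigcupr -preimage_bigcup; apply: ipre; exact: bigcupT_measurable.
Qed.

End pi_system.

(** * Rectangles in the plane *)

Section plane_measure.
Context {R : realType}.
Local Notation MR := (measurableTypeR R).
Local Notation mu := (@lebesgue2 R).
Implicit Types (a b c d : R) (f g : R * R -> R).

Definition orect a b c d : set (R * R) := `]a, b[ `*` `]c, d[.
Definition crect a b c d : set (R * R) := `[a, b] `*` `[c, d].

Lemma measurable_orect a b c d : measurable (orect a b c d : set (MR * MR)).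
Proof. by apply: measurableX; exact: measurable_itv. Qed.

Lemma orectI a b c d a' b' c' d' : orect a b c d `&` orect a' b' c' d' =
  orect (Num.max a a') (Num.min b b') (Num.max c c') (Num.min d d').
Proof.
apply/seteqP; split=> -[x y]; rewrite /orect /= !in_itv /=
  !gt_max !lt_min.
  by move=> [[/andP[-> ->] /andP[-> ->]] [/andP[-> ->] /andP[-> ->]]].
by move=> [/andP[/andP[-> ->] /andP[-> ->]] /andP[/andP[-> ->] /andP[-> ->]]].
Qed.

Lemma measurable_rays : @measurable _ MR = <<s @RGenOInfty.G R >>.
Proof. exact: RGenOInfty.measurableE. Qed.

Lemma rays_setI_closed : setI_closed (@RGenOInfty.G R).
Proof.
move=> A B [x ->] [y ->]; exists (Num.max x y).
by apply/seteqP; split=> z /=; rewrite !in_itv /= !andbT gt_max => /andP.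
Qed.

Lemma orect_ray a b c d x y : orect a b c d `&` (`]x, +oo[ `*` `]y, +oo[) =
  orect (Num.max a x) b (Num.max c y) d.
Proof.
apply/seteqP; split=> -[s t]; rewrite /orect /= !in_itv /= !andbT !gt_max.
  by move=> [[/andP[-> ->] /andP[-> ->]] [-> ->]].
by move=> [/andP[/andP[-> ->] ->] /andP[/andP[-> ->] ->]].
Qed.

(** From quadrants, a pi-system argument in the first coordinate and another in the second reach the
    products of Borel sets, and a last one in the plane reaches all measurable sets. *)
Lemma orect_ae0 a b c d g : mu.-integrable (orect a b c d) (EFin \o g) ->
  (forall a' b' c' d', a <= a' -> b' <= b -> c <= c' -> d' <= d ->
    (\int[mu]_(p in orect a' b' c' d') (g p)%:E = 0)%E) ->
  g = cst 0 %[ae mu in orect a b c d].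
Proof.
move=> ig g0; set Q := orect a b c d.
have mQ : measurable (Q : set (MR * MR)) := measurable_orect _ _ _ _.
have ray x y : (\int[mu]_(p in Q `&` (`]x, +oo[ `*` `]y, +oo[)) (g p)%:E = 0)%E.
  by rewrite orect_ray; apply: g0; rewrite ?le_max ?lexx.
have cyl1 y : (\int[mu]_(p in Q `&` (snd @^-1` `]y, +oo[)) (g p)%:E = 0)%E.
  suff <- : Q `&` (`]a, +oo[ `*` `]y, +oo[) = Q `&` snd @^-1` `]y, +oo[ by exact: ray.
  apply/seteqP; split=> -[s t] [Qst /=].
    by case.
  move=> ty; split => //; split => //=; move: Qst => [/=].
  by rewrite !in_itv /= => /andP[-> _].
have Qg : (\int[mu]_(p in Q) (g p)%:E = 0)%E by apply: g0.
have step1 (A : set MR) y : measurable A ->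
    (\int[mu]_(p in (Q `&` snd @^-1` `]y, +oo[) `&` fst @^-1` A) (g p)%:E = 0)%E.
  have mS : measurable (Q `&` snd @^-1` `]y, +oo[ : set (MR * MR)).
    apply: measurableI => //; rewrite -[_ @^-1` _]setTI.
    by apply: (measurable_snd (T1 := MR) (T2 := MR)) => //; exact: measurable_itv.
  move=> mA; apply: (@integral0_pi_system _ (MR * MR)%type _ mu _ MR _ fst _ _
    measurable_rays rays_setI_closed) mA => //.
  - by apply: integrableS ig => // p [].
  - move=> B [x ->]; rewrite -setIA.
    suff -> : snd @^-1` `]y, +oo[ `&` fst @^-1` `]x, +oo[ = `]x, +oo[ `*` `]y, +oo[ :> set (MR * MR).
      exact: ray.
    by apply/seteqP; split=> -[s t] [].
have step2 (A B : set MR) : measurable A -> measurable B ->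
    (\int[mu]_(p in Q `&` (A `*` B)) (g p)%:E = 0)%E.
  move=> mA mB.
  have mQA : measurable (Q `&` fst @^-1` A : set (MR * MR)).
    apply: measurableI => //; rewrite -[_ @^-1` _]setTI.
    exact: (measurable_fst (T1 := MR) (T2 := MR)).
  have -> : Q `&` (A `*` B) = (Q `&` fst @^-1` A) `&` snd @^-1` B.
    by apply/seteqP; split=> -[s t] [] => [Qst []|[Qst] ? ?].
  apply: (@integral0_pi_system _ (MR * MR)%type _ mu _ MR _ snd _ _
    measurable_rays rays_setI_closed) mB => //.
  - by apply: integrableS ig => // p [].
  - apply: (@integral0_pi_system _ (MR * MR)%type _ mu _ MR _ fst _ _
    measurable_rays rays_setI_closed) mA => //.
    + move=> B0 [x ->].
      suff <- : Q `&` (`]x, +oo[ `*` `]c, +oo[) = Q `&` fst @^-1` `]x, +oo[ by exact: ray.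
      apply/seteqP; split=> -[s t] [Qst /=].
        by case.
      move=> ty; split => //; split => //=; move: Qst => [/= _].
      by rewrite !in_itv /= => /andP[-> _].
  - by move=> B0 [y ->]; rewrite setIAC; exact: step1.
have : ae_eq mu (Q : set (MR * MR)) (EFin \o g) (cst 0%E).
  apply: integral_ae_eq => //.
    move=> E EQ mE; rewrite integral0.
    have -> : E = Q `&` id @^-1` E by rewrite preimage_id setIC; apply/esym/setIidPl.
    have M := @measurable_prod_measurableType _ _ MR MR.
    apply: (@integral0_pi_system _ (MR * MR)%type _ mu _ (MR * MR)%type _ id _ _ M) => //.
    + move=> _ _ [A mA [B mB <-]] [A' mA' [B' mB' <-]].
      exists (A `&` A'); first exact: measurableI.
      by exists (B `&` B'); [exact: measurableI|rewrite setXI].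
    + by move=> _ [A mA [B mB <-]]; exact: step2.
by apply: filterS => p h Qp; have [] := h Qp.
Qed.

End plane_measure.

(** * Tensor products of bumps and the fundamental lemma *)

Section tensor.
Context {R : realType}.
Local Notation MR := (measurableTypeR R).
Local Notation mu := (@lebesgue2 R).
Implicit Types (al be : R -> R) (a b c d : R) (Om : set (R * R)).

Definition tensor al be (p : R * R) : R := al p.1 * be p.2.

Lemma partial1_tensor al be : smooth al ->
  partial1 (tensor al be) = tensor (derive1 al) be.
Proof.
move=> sal; apply/funext => -[x y]; rewrite /partial1 /tensor /=.
rewrite !derive1E (_ : (fun t => al t * be y) = (be y \o* al))//.
by rewrite deriveMr 1?mulrC//; exact: smooth_derivable.
Qed.

Lemma partial2_tensor al be : smooth be ->
  partial2 (tensor al be) = tensor al (derive1 be).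
Proof.
move=> sbe; apply/funext => -[x y]; rewrite /partial2 /tensor /=.
rewrite !derive1E (_ : (fun t => al x * be t) = (al x \*o be))//.
by rewrite deriveMl//; exact: smooth_derivable.
Qed.

Lemma continuous_tensor al be : continuous al -> continuous be ->
  continuous (tensor al be).
Proof.
move=> cal cbe p; apply: continuousM.
  by apply: continuous_comp; [exact: cvg_fst | exact: cal].
by apply: continuous_comp; [exact: cvg_snd | exact: cbe].
Qed.

Lemma Ck_tensor k al be : smooth al -> smooth be -> Ck k (tensor al be).
Proof.
elim: k al be => [|k ih] al be sal sbe /=.
  by apply: continuous_tensor; exact: smooth_continuous.
split.
- by apply: continuous_tensor; exact: smooth_continuous.
- move=> p; rewrite /tensor /= (_ : (fun t => _) = al * cst (be p.2))//.
  by apply: derivableM; [exact: smooth_derivable | exact: derivable_cst].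
- move=> p; rewrite /tensor /= (_ : (fun t => _) = cst (al p.1) * be)//.
  by apply: derivableM; [exact: derivable_cst | exact: smooth_derivable].
- by rewrite partial1_tensor//; apply: ih => //; exact: smooth_derive1.
- by rewrite partial2_tensor//; apply: ih => //; exact: smooth_derive1.
Qed.

(** The factors vanish off open intervals, so the closed rectangle serves as compact support; this
    is why the closed one has to lie in [Om]. *)
Lemma test_function_tensor Om a b c d al be : crect a b c d `<=` Om ->
  smooth al -> smooth be ->
  (forall x, ~~ (a < x < b) -> al x = 0) ->
  (forall x, ~~ (c < x < d) -> be x = 0) ->
  test_function Om (tensor al be).
Proof.
move=> QOm sal sbe al0 be0; split; first by move=> k; exact: Ck_tensor.
exists (crect a b c d); split => //.
  by apply: compact_setX; exact: segment_compact.
move=> [x y]; rewrite /crect /= !in_itv /= => /not_andP[] /negP xab.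
- rewrite /tensor /= al0 ?mul0r//; apply: contra xab => /andP[? ?].
  by rewrite !ltW.
- rewrite /tensor /= be0 ?mulr0//; apply: contra xab => /andP[? ?].
  by rewrite !ltW.
Qed.

Lemma measurable_tensor al be : continuous al -> continuous be ->
  measurable_fun setT (tensor al be : MR * MR -> MR).
Proof.
move=> cal cbe; apply: measurable_funM.
- apply: (measurableT_comp (continuous_measurable_fun cal)).
  exact: (measurable_fst (T1 := MR) (T2 := MR)).
- apply: (measurableT_comp (continuous_measurable_fun cbe)).
  exact: (measurable_snd (T1 := MR) (T2 := MR)).
Qed.

Lemma tensor_integrable Om g al be : measurable (Om : set (MR * MR)) ->
  mu.-integrable Om (EFin \o g) -> continuous al -> continuous be ->
  (exists C : R, forall p, `|tensor al be p| <= C) ->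
  mu.-integrable Om (EFin \o (fun p => g p * tensor al be p)).
Proof.
move=> mOm ig cal cbe [C hC].
have mg : measurable_fun Om g by apply/measurable_EFinP; exact: (measurable_int mu ig).
apply: (ae_le_integrable mOm (g := fun p => C * `|g p|)) => //.
- apply: measurable_funM => //; apply: measurable_funTS.
  exact: measurable_tensor.
- by have := integrableZl mOm C (integrable_norm ig); exact: eq_integrable.
- by apply: aeW => p _; rewrite normrM mulrC ler_wpM2r.
Qed.

Lemma bump_tensor_norm a b c d n m p :
  `|tensor (bump a b n) (bump c d m) p| <= 1.
Proof.
rewrite /tensor normrM !ger0_norm ?bump_ge0//.
by rewrite mulr_ile1 ?bump_ge0 ?bump_le1.
Qed.

Lemma bump_tensor_integrable Om g a b c d n m : measurable (Om : set (MR * MR)) ->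
  mu.-integrable Om (EFin \o g) ->
  mu.-integrable Om (EFin \o (fun p => g p * tensor (bump a b n) (bump c d m) p)).
Proof.
move=> mOm ig; apply: tensor_integrable => //.
- exact/smooth_continuous/smooth_bump.
- exact/smooth_continuous/smooth_bump.
- by exists 1 => p; exact: bump_tensor_norm.
Qed.

(** As [n] grows, the tensors tend to the indicator of the smaller open rectangle and [|g|]
    dominates the products. *)
Lemma bump_tensor_ae0 Om g a b c d : measurable (Om : set (MR * MR)) ->
  mu.-integrable Om (EFin \o g) -> orect a b c d `<=` Om ->
  (forall a' b' c' d' n, a <= a' -> b' <= b -> c <= c' -> d' <= d ->
    \int[mu]_(p in Om) (g p * tensor (bump a' b' n) (bump c' d' n) p) = 0) ->
  g = cst 0 %[ae mu in orect a b c d].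
Proof.
move=> mOm ig QOm g0.
have mQ := @measurable_orect R.
have mg : measurable_fun Om g by apply/measurable_EFinP; exact: (measurable_int mu ig).
apply: orect_ae0; first by apply: integrableS ig.
move=> a' b' c' d' aa bb cc dd.
have sub : orect a' b' c' d' `<=` Om.
  apply: subset_trans QOm => -[x y]; rewrite /orect /= !in_itv /=.
  move=> [/andP[h1 h2] /andP[h3 h4]].
  by rewrite (le_lt_trans aa h1) (lt_le_trans h2 bb) (le_lt_trans cc h3) (lt_le_trans h4 dd).
pose f_ n p := (g p * tensor (bump a' b' n) (bump c' d' n) p)%:E.
pose f p := (g p * (p \in orect a' b' c' d')%:R)%:E.
have mf n : measurable_fun Om (f_ n).
  exact: (measurable_int mu (bump_tensor_integrable a' b' c' d' n n mOm ig)).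
have fE : f = (EFin \o g) \_ (orect a' b' c' d').
  by apply/funext => p; rewrite /f patchE; case: ifP => _; rewrite ?mulr1 ?mulr0.
have mf' : measurable_fun Om f.
  rewrite fE; apply/(measurable_restrict _ (mQ _ _ _ _) mOm).
  by apply/measurable_EFinP; apply: measurable_funS mg => // p [].
have f_f : {ae mu, forall p, Om p -> f_ ^~ p @ \oo --> f p}.
  apply: aeW => -[x y] _; apply: cvg_EFin; first exact: nearW.
  apply: cvgMr.
  suff -> : ((x, y) \in orect a' b' c' d')%:R =
      ((a' < x < b')%R%:R * (c' < y < d')%R%:R : R).
    exact: (cvgM (@bump_cvg R a' b' x) (@bump_cvg R c' d' y)).
  rewrite -natrM mulnb; congr (nat_of_bool _)%:R; apply/idP/idP.
    by rewrite inE /orect /= !in_itv => -[-> ->].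
  by move=> /andP[h1 h2]; rewrite inE /orect /= !in_itv.
have fg : {ae mu, forall p n, Om p -> (`|f_ n p| <= `|(g p)%:E|)%E}.
  apply: aeW => p n _; rewrite /f_ lee_fin normrM.
  by rewrite ler_piMr// bump_tensor_norm.
have [_ _ cv] := dominated_convergence mOm mf mf' f_f (integrable_abse ig) fg.
have : (\int[mu]_(p in Om) f p = 0)%E.
  rewrite -(cvg_lim _ cv)//.
  rewrite (_ : (fun n => _) = cst 0%E) ?lim_cst//.
  apply/funext => n; have := g0 a' b' c' d' n aa bb cc dd.
  rewrite /Rintegral => /eqP; rewrite fine_eq0; first by move/eqP.
  by apply: integrable_fin_num => //; exact: bump_tensor_integrable.
by rewrite fE -integral_mkcondr (setIidr sub).
Qed.

Lemma fundamental_lemma Om g a b c d : measurable (Om : set (MR * MR)) ->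
  mu.-integrable Om (EFin \o g) -> crect a b c d `<=` Om ->
  (forall phi, test_function Om phi -> \int[mu]_(p in Om) (g p * phi p) = 0) ->
  g = cst 0 %[ae mu in orect a b c d].
Proof.
move=> mOm ig QOm g0; apply: (bump_tensor_ae0 mOm ig).
  move=> [x y] []; rewrite /= !in_itv /= => /andP[h1 h2] /andP[h3 h4].
  by apply: QOm; rewrite /crect /= !in_itv /= !ltW.
move=> a' b' c' d' n aa bb cc dd; apply: g0.
apply: (@test_function_tensor _ a b c d) => //; try exact: smooth_bump.
- move=> x h; apply: bump_eq0; apply: contra h => /andP[h1 h2].
  by rewrite (le_lt_trans aa h1) (lt_le_trans h2 bb).
- move=> x h; apply: bump_eq0; apply: contra h => /andP[h1 h2].
  by rewrite (le_lt_trans cc h1) (lt_le_trans h2 dd).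
Qed.

End tensor.

Lemma ae_imp d (T : measurableType d) (R : realType)
    (mu : {measure set T -> \bar R}) (P Q : T -> Prop) :
  (forall x, P x -> Q x) -> (\forall x \ae mu, P x) -> \forall x \ae mu, Q x.
Proof. by move=> PQ; apply: filterS. Qed.

Lemma ae_imp2 d (T : measurableType d) (R : realType)
    (mu : {measure set T -> \bar R}) (P Q S : T -> Prop) :
  (forall x, P x -> Q x -> S x) -> (\forall x \ae mu, P x) ->
  (\forall x \ae mu, Q x) -> \forall x \ae mu, S x.
Proof. by move=> PQ; apply: filterS2. Qed.

Lemma ae_and d (T : measurableType d) (R : realType)
    (mu : {measure set T -> \bar R}) (P Q : T -> Prop) :
  (\forall x \ae mu, P x) -> (\forall x \ae mu, Q x) ->
  \forall x \ae mu, P x /\ Q x.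
Proof. by apply: ae_imp2 => x; split. Qed.

Lemma bounded_support_integrable d (T : measurableType d) (R : realType)
    (mu : {measure set T -> \bar R}) (A : set T) (f : T -> R) (C : R) :
  measurable A -> (mu A < +oo)%E -> measurable_fun setT f ->
  (forall x, `|f x| <= C) -> (forall x, ~ A x -> f x = 0) ->
  mu.-integrable setT (EFin \o f).
Proof.
move=> mA Afin mf fC f0.
have fE : f = f \_ A.
  by apply/funext => x; rewrite patchE; case: ifPn => // /negP xA;
    rewrite f0// => Ax; apply: xA; rewrite inE.
rewrite fE; have -> : EFin \o f \_ A = (EFin \o f) \_ A.
  by apply/funext => x; rewrite /= !patchE; case: ifP.
apply/(integrable_mkcond _ mA).
apply: measurable_bounded_integrable => //; first exact: measurable_funTS.
by exists C; split; [exact: num_real | move=> M CM x _ /=; rewrite (le_trans (fC x))// ltW].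
Qed.

(** * Bumps and primitives on the line *)

Section line.
Context {R : realType}.
Local Notation leb := (@lebesgue_measure R).
Implicit Types (f : R -> R) (a b : R).

Lemma itv_fin (a b : R) : (leb `[a, b] < +oo)%E.
Proof. by rewrite lebesgue_measure_itv /=; case: ifP => _; rewrite ?ltry// -EFinB ltry. Qed.

Lemma bump_integrable a b n : leb.-integrable setT (EFin \o bump a b n).
Proof.
apply: (@bounded_support_integrable _ _ _ leb `[a, b]%classic _ 1).
- exact: measurable_itv.
- exact: itv_fin.
- by apply: continuous_measurable_fun; exact: smooth_continuous (smooth_bump _ _ _).
- by move=> x; rewrite ger0_norm ?bump_ge0// bump_le1.
- move=> x; rewrite /= in_itv /= => /negP xab; apply: bump_eq0.
  by apply: contra xab => /andP[? ?]; rewrite !ltW.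
Qed.

Definition mass f := \int[leb]_x f x.

Lemma bump_mass_gt0 a b : a < b -> 0 < mass (bump a b 1).
Proof.
move=> ab; rewrite lt_neqAle Rintegral_ge0 ?andbT; last first.
  by move=> x _; exact: bump_ge0.
apply/negP => /eqP m0.
have ib := bump_integrable a b 1.
have : (\int[leb]_x `|(bump a b 1 x)%:E| = 0)%E.
  under eq_integral do rewrite gee0_abs ?lee_fin ?bump_ge0//.
  rewrite -[RHS](_ : (mass (bump a b 1))%:E = 0%E); last by rewrite -m0.
  by rewrite /mass /Rintegral fineK//; exact: integrable_fin_num.
move/(ae_eq_integral_abs _ measurableT (measurable_int _ ib)).1 => h.
have neg : leb.-negligible `]a, b[.
  apply: negligibleS h => x xab /= h; have [] := h I; apply/eqP.
  by rewrite gt_eqF//; apply: bump_gt0; move: xab; rewrite /= in_itv.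
have : leb `]a, b[ = 0%E.
  exact: (negligibleP leb (measurable_itv `]a, b[)).1 neg.
move/eqP; by rewrite lebesgue_measure_itv /= lte_fin ab -EFinB eqe subr_eq0 gt_eqF.
Qed.

(** The primitive from [-oo] is zero to the left of [a]; to the right of [b] it equals the mass of
    [f]. Zero mass is thus what makes it compactly supported. *)
Lemma primitive a b f : smooth f -> leb.-integrable setT (EFin \o f) ->
  (forall x, ~~ (a < x < b) -> f x = 0) -> mass f = 0 ->
  exists F, [/\ smooth F, derive1 F = f & forall x, ~~ (a < x < b) -> F x = 0].
Proof.
move=> sf intf f0 m0; pose F x := \int[leb]_(t in `]-oo, x]) f t.
have dF x : is_derive x (1 : R) F (f x).
  have i1 : leb.-integrable `]-oo, (x + 1)] (EFin \o f).
    by apply: integrableS intf => //; exact: measurable_itv.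
  have x1 : x < x + 1 by rewrite ltrDl.
  have [|d1 d2] := continuous_FTC1 x1 i1 _ (smooth_continuous sf (x := x)).
    by rewrite ltNyr.
  by split; [exact: d1 | rewrite -derive1E; exact: d2].
exists F; split.
- by case=> // k; exists f.
- by apply/funext => x; rewrite derive1E; have [_ ->] := dF x.
- move=> x; rewrite negb_and -!leNgt => /orP[xa|bx].
    rewrite /F (@eq_Rintegral _ _ _ _ _ (cst 0)); first by rewrite Rintegral_cst// mul0r.
    move=> y; rewrite inE /= in_itv /= => yx; apply: f0.
    by rewrite negb_and -!leNgt (le_trans yx xa).
  rewrite /F Rintegral_mkcond -[RHS]m0; apply: eq_Rintegral => y _.
  rewrite patchE; case: ifPn => //; rewrite notin_setE /= in_itv /= => /negP.
  by rewrite -ltNge => xy; rewrite f0// negb_and -!leNgt (le_trans bx (ltW xy)) orbT.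
Qed.

End line.

(** The algebra of [rect_constant]: two exchanges of a bump for a reference bump, one in each
    variable. *)
Lemma cross_ratio (F : fieldType) (k k0 k1 ma mc m m' : F) :
  ma != 0 -> mc != 0 -> ma * k = m * k1 -> mc * k1 = m' * k0 ->
  k - k0 / (ma * mc) * (m * m') = 0.
Proof.
move=> ma0 mc0 e1 e2.
have -> : k = m * k1 / ma by rewrite -e1; field.
have -> : k1 = m' * k0 / mc by rewrite -e2; field.
by field; rewrite ma0 mc0.
Qed.

(** * Open sets of the plane and functions with zero weak gradient *)

Section plane.
Context {R : realType}.
Local Notation MR := (measurableTypeR R).
Local Notation mu := (@lebesgue2 R).
Local Notation leb := (@lebesgue_measure R).
Implicit Types (a b c d : R) (Om : set (R * R)) (s : R * R -> R).

Lemma open_rat_rect Om p : open Om -> Om p -> exists q : rat * rat * (rat * rat),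
  let Q := (ratr q.1.1, ratr q.1.2, ratr q.2.1, ratr q.2.2) : R * R * R * R in
  crect Q.1.1.1 Q.1.1.2 Q.1.2 Q.2 `<=` Om /\
  orect Q.1.1.1 Q.1.1.2 Q.1.2 Q.2 p.
Proof.
move=> oOm Omp; have /nbhs_ballP[e /= e0 sub] : nbhs p Om by exact: open_nbhs_nbhs.
have h1 (x : R) : exists q : rat, x - e < ratr q < x.
  by have [|q] := @rat_in_itvoo R (x - e) x; [rewrite gtrBl|rewrite in_itv; exists q].
have h2 (x : R) : exists q : rat, x < ratr q < x + e.
  by have [|q] := @rat_in_itvoo R x (x + e); [rewrite ltrDl|rewrite in_itv; exists q].
have [q1 /andP[q11 q12]] := h1 p.1; have [q2 /andP[q21 q22]] := h2 p.1.
have [q3 /andP[q31 q32]] := h1 p.2; have [q4 /andP[q41 q42]] := h2 p.2.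
exists (q1, q2, (q3, q4)) => /=; split.
  move=> [x y] []; rewrite /= !in_itv /= => /andP[a1 a2] /andP[b1 b2].
  apply: sub; split; rewrite /= /ball /= ltr_norml; lra.
by split; rewrite /= in_itv /=; apply/andP.
Qed.

(** Rational rectangles cover an open set and are countable; [pickle] numbers them, so that the
    exceptional null sets can be united. *)
Lemma ae_cover (P : R * R -> Prop) Om : open Om ->
  (forall a b c d, crect a b c d `<=` Om ->
     \forall p \ae mu, orect a b c d p -> P p) ->
  \forall p \ae mu, Om p -> P p.
Proof.
move=> oOm HP.
pose A (n : nat) p := forall q : rat * rat * (rat * rat), unpickle n = Some q ->
  crect (ratr q.1.1) (ratr q.1.2) (ratr q.2.1) (ratr q.2.2) `<=` Om ->
  orect (ratr q.1.1) (ratr q.1.2) (ratr q.2.1) (ratr q.2.2) p -> P p.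
have : \forall p \ae mu, forall n, A n p.
  apply: ae_foralln => n; rewrite /A.
  case: (unpickle n) => [q|]; last by apply: aeW => p q.
  have [sub|nsub] := pselect (crect (ratr q.1.1) (ratr q.1.2) (ratr q.2.1) (ratr q.2.2) `<=` Om).
    by apply: ae_imp (HP _ _ _ _ sub) => p h _ [<-] _; exact: h.
  by apply: aeW => p q' [<-].
apply: ae_imp => p h Omp.
have [q [sub qp]] := open_rat_rect oOm Omp.
exact: (h (pickle q) q (pickleK q) sub qp).
Qed.

(** The measurable sets are generated by products of Borel sets, whereas open sets come from the
    product topology: a countable union of rational rectangles links the two. *)
Lemma open_measurable2 Om : open Om -> measurable (Om : set (MR * MR)).
Proof.
move=> oOm.
pose S (n : nat) : set (R * R) :=
  if @unpickle (rat * rat * (rat * rat))%type n is Some q then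
    if `[< crect (ratr q.1.1) (ratr q.1.2) (ratr q.2.1) (ratr q.2.2) `<=` Om >] then
      orect (ratr q.1.1) (ratr q.1.2) (ratr q.2.1) (ratr q.2.2) else set0
  else set0.
have -> : Om = \bigcup_n S n.
  apply/seteqP; split=> p.
    move=> Omp; have [q [sub qp]] := open_rat_rect oOm Omp.
    exists (pickle q); first exact: I.
    rewrite /S pickleK; case: asboolP => [_|/(_ sub)[]].
    exact: qp.
  move=> [n _]; rewrite /S; case: unpickle => // q; case: asboolP => // sub.
  case=> h1 h2; apply: sub; split.
    by move: h1; rewrite /= !in_itv /= => /andP[? ?]; rewrite !ltW.
  by move: h2; rewrite /= !in_itv /= => /andP[? ?]; rewrite !ltW.
apply: (@bigcupT_measurable _ (MR * MR)%type) => n; rewrite /S.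
case: unpickle => // q; case: asboolP => // _; exact: measurable_orect.
Qed.

Lemma lebesgue2X (A B : set MR) : measurable A -> measurable B ->
  mu (A `*` B) = (leb A * leb B)%E.
Proof. by move=> mA mB; exact: product_measure1E. Qed.

Lemma orect_measure a b c d : a < b -> c < d ->
  mu (orect a b c d) = ((b - a) * (d - c))%:E.
Proof.
move=> ab cd; rewrite /orect /crect lebesgue2X; try exact: measurable_itv.
by rewrite !lebesgue_measure_itv /= !lte_fin ab cd -!EFinB -EFinM.
Qed.

Lemma open_orect a b c d : open (orect a b c d).
Proof.
rewrite openE => -[x y] [/= xab ycd].
by exists (`]a, b[%classic, `]c, d[%classic) => //=; split;
  apply: open_nbhs_nbhs; split => //; exact: interval_open.
Qed.

Lemma orect_not_negligible a b c d : a < b -> c < d -> ~ mu.-negligible (orect a b c d).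
Proof.
move=> ab cd neg.
have : mu (orect a b c d) = 0%E.
  exact: (negligibleP mu (measurable_orect a b c d)).1 neg.
rewrite orect_measure// => /eqP.
by rewrite eqe mulf_eq0 !subr_eq0 !gt_eqF.
Qed.

Lemma open_not_negligible Om : open Om -> Om !=set0 -> ~ mu.-negligible Om.
Proof.
move=> oOm [p Omp]; have [q [sub qp]] := open_rat_rect oOm Omp.
case: qp; rewrite /= !in_itv /= => /andP[h1 h2] /andP[h3 h4].
have h12 := lt_trans h1 h2; have h34 := lt_trans h3 h4.
move/(negligibleS _ ) => /(_ (orect (ratr q.1.1) (ratr q.1.2) (ratr q.2.1) (ratr q.2.2))) h.
apply: (orect_not_negligible h12 h34); apply: h.
apply: subset_trans sub => -[x y] []; rewrite /= !in_itv /= => /andP[? ?] /andP[? ?].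
by split; rewrite /= in_itv /= !ltW.
Qed.

Lemma bounded_finite Om : measurable (Om : set (MR * MR)) -> bounded_set Om ->
  (mu Om < +oo)%E.
Proof.
move=> mOm [M [_ hM]].
have h := hM (`|M| + 1) _.
have sub : Om `<=` crect (- (`|M| + 1)) (`|M| + 1) (- (`|M| + 1)) (`|M| + 1).
  move=> [x y] Oxy; have := h _ _ Oxy; rewrite /= prod_normE /= => hh.
  have {}hh : Num.max `|x| `|y| <= `|M| + 1.
    by apply: hh; rewrite (le_lt_trans (ler_norm M))// ltrDl.
  move: hh; rewrite ge_max => /andP[].
  by rewrite !ler_norml => h1 h2; split; rewrite /= in_itv.
have mc a b c d : measurable (crect a b c d : set (MR * MR)).
  by apply: measurableX; exact: measurable_itv.
apply: (@le_lt_trans _ _ (mu (crect (- (`|M| + 1)) (`|M| + 1) (- (`|M| + 1)) (`|M| + 1)))).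
  by apply: le_measure => //; rewrite inE //; exact: mc.
rewrite /orect /crect lebesgue2X; try exact: measurable_itv.
by rewrite lte_mul_pinfty ?itv_fin// ge0_fin_numE// itv_fin.
Qed.

Lemma bump_tensor_mass Om a b c d n : crect a b c d `<=` Om ->
  \int[mu]_(p in Om) tensor (bump a b n) (bump c d n) p =
  mass (bump a b n) * mass (bump c d n).
Proof.
move=> sub.
have it : mu.-integrable setT (EFin \o tensor (bump a b n) (bump c d n)).
  apply: (@bounded_support_integrable _ _ _ mu (crect a b c d) _ 1).
  - by apply: measurableX; exact: measurable_itv.
  - rewrite /orect /crect lebesgue2X; try exact: measurable_itv.
    by rewrite lte_mul_pinfty ?itv_fin// ge0_fin_numE// itv_fin.
  - by apply: measurable_tensor; exact/smooth_continuous/smooth_bump.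
  - by move=> p; exact: bump_tensor_norm.
  - move=> [x y]; rewrite /crect /= !in_itv /= => /not_andP[] /negP xab.
      rewrite /tensor /= bump_eq0 ?mul0r//; apply: contra xab => /andP[? ?].
      by rewrite !ltW.
    rewrite /tensor /= (@bump_eq0 _ c d) ?mulr0//; apply: contra xab => /andP[? ?].
    by rewrite !ltW.
transitivity (\int[mu]_p tensor (bump a b n) (bump c d n) p).
  rewrite Rintegral_mkcond; apply: eq_Rintegral => -[x y] _.
  rewrite patchE; case: ifPn => //; rewrite notin_setE => nOm.
  have : ~ crect a b c d (x, y) by move=> /sub.
  rewrite /crect /= !in_itv /= => /not_andP[] /negP xab.
    rewrite /tensor /= bump_eq0 ?mul0r//; apply: contra xab => /andP[? ?].
    by rewrite !ltW.
  rewrite /tensor /= (@bump_eq0 _ c d) ?mulr0//; apply: contra xab => /andP[? ?].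
  by rewrite !ltW.
rewrite {1}/Rintegral -integral12_prod_meas1//.
have ic := bump_integrable c d n; have ia := bump_integrable a b n.
transitivity (fine (\int[leb]_x ((bump a b n x)%:E * (mass (bump c d n))%:E))%E).
  congr fine; apply: eq_integral => x _; rewrite /fubini_F /tensor /=.
  under eq_integral do rewrite EFinM.
  rewrite integralZl//; congr (_ * _)%E.
  by rewrite /mass /Rintegral fineK//; exact: integrable_fin_num.
rewrite integralZr// fineM//; exact: integrable_fin_num.
Qed.

Definition zero_weak_gradient Om s := forall phi, test_function Om phi ->
  \int[mu]_(p in Om) (s p * partial1 phi p) = 0 /\
  \int[mu]_(p in Om) (s p * partial2 phi p) = 0.

Section rect_constant.
Variables (Om : set (R * R)) (s : R * R -> R) (a b c d : R).
Hypotheses (mOm : measurable (Om : set (MR * MR))) (fOm : (mu Om < +oo)%E).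
Hypothesis is_ : mu.-integrable Om (EFin \o s).
Hypotheses (ab : a < b) (cd : c < d) (sub : crect a b c d `<=` Om).
Hypothesis gs : zero_weak_gradient Om s.

Let K al be := \int[mu]_(p in Om) (s p * tensor al be p).

Let bump_off (l r l' r' : R) n x : l <= l' -> r' <= r -> ~~ (l < x < r) -> bump l' r' n x = 0.
Proof.
move=> ll rr xlr; apply: bump_eq0; apply: contra xlr => /andP[h1 h2].
by rewrite (le_lt_trans ll h1) (lt_le_trans h2 rr).
Qed.

(** The combination has zero mass, hence is the derivative of an admissible factor of a test
    function: a zero weak gradient cannot tell the two bumps apart, up to their masses. *)
Let combination (l r l' r' : R) n : l <= l' -> r' <= r -> exists F, [/\ smooth F,
  derive1 F = (fun x => mass (bump l r 1) * bump l' r' n x - mass (bump l' r' n) * bump l r 1 x)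
  & forall x, ~~ (l < x < r) -> F x = 0].
Proof.
move=> ll rr; set m0 := mass (bump l r 1); set m := mass (bump l' r' n).
have i1 := bump_integrable l' r' n; have i2 := bump_integrable l r 1.
have i3 := integrableZl measurableT m0 i1.
have i4 := integrableZl measurableT m i2.
apply: primitive.
- move=> k; apply: smooth_uptoD.
    by apply: (smooth_uptoM (smooth_upto_cst k m0)); exact: smooth_bump.
  have := smooth_uptoM (smooth_upto_cst k (- m)) (@smooth_bump _ l r 1 k).
  by congr smooth_upto; apply/funext => x /=; rewrite mulNr.
- by have := integrableB measurableT i3 i4; apply: eq_integrable.
- by move=> x xlr; rewrite (bump_off n ll rr)// (bump_off 1 (lexx l) (lexx r))// !mulr0 subrr.
- rewrite /mass RintegralB// !RintegralZl//.
  by rewrite -/(mass _) -/m -/(mass (bump l r 1)) -/m0; ring.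
Qed.

Let K_lin m0 m a1 b1 n1 a2 b2 n2 a3 b3 n3 :
  K (fun x => m0 * bump a1 b1 n1 x - m * bump a2 b2 n2 x) (bump a3 b3 n3) =
  m0 * K (bump a1 b1 n1) (bump a3 b3 n3) - m * K (bump a2 b2 n2) (bump a3 b3 n3).
Proof.
have i1 := bump_tensor_integrable a1 b1 a3 b3 n1 n3 mOm is_.
have i2 := bump_tensor_integrable a2 b2 a3 b3 n2 n3 mOm is_.
have i3 := integrableZl mOm m0 i1; have i4 := integrableZl mOm m i2.
rewrite /K -!RintegralZl// -RintegralB//.
by apply: eq_Rintegral => p _; rewrite /tensor; ring.
Qed.

Let K_linr m0 m a1 b1 n1 a2 b2 n2 a3 b3 n3 :
  K (bump a3 b3 n3) (fun x => m0 * bump a1 b1 n1 x - m * bump a2 b2 n2 x) =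
  m0 * K (bump a3 b3 n3) (bump a1 b1 n1) - m * K (bump a3 b3 n3) (bump a2 b2 n2).
Proof.
have i1 := bump_tensor_integrable a3 b3 a1 b1 n3 n1 mOm is_.
have i2 := bump_tensor_integrable a3 b3 a2 b2 n3 n2 mOm is_.
have i3 := integrableZl mOm m0 i1; have i4 := integrableZl mOm m i2.
rewrite /K -!RintegralZl// -RintegralB//.
by apply: eq_Rintegral => p _; rewrite /tensor; ring.
Qed.

(** The mean of [s] weighted by the reference bump of the rectangle. *)
Let C := K (bump a b 1) (bump c d 1) / (mass (bump a b 1) * mass (bump c d 1)).

Lemma rect_constant : s = cst C %[ae mu in orect a b c d].
Proof.
have ma := bump_mass_gt0 ab; have mc := bump_mass_gt0 cd.
have ic : mu.-integrable Om (EFin \o (fun _ : R * R => C)).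
  apply: measurable_bounded_integrable => //.
  by exists `|C|; split; [exact: num_real | move=> M CM x _ /=; exact: ltW].
suff h : (fun p => s p - C) = cst 0 %[ae mu in orect a b c d].
  by apply: ae_imp h => p h Qp; have /eqP := h Qp; rewrite subr_eq0 => /eqP.
apply: (bump_tensor_ae0 mOm).
- by have := integrableB mOm is_ ic; apply: eq_integrable.
- move=> [x y] []; rewrite /= !in_itv /= => /andP[? ?] /andP[? ?].
  by apply: sub; split; rewrite /= in_itv /= !ltW.
move=> a' b' c' d' n aa bb cc dd.
have i1 := bump_tensor_integrable a' b' c' d' n n mOm is_.
have i2 := bump_tensor_integrable a' b' c' d' n n mOm ic.
have -> : \int[mu]_(p in Om) ((s p - C) * tensor (bump a' b' n) (bump c' d' n) p) =
    K (bump a' b' n) (bump c' d' n) -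
    C * \int[mu]_(p in Om) tensor (bump a' b' n) (bump c' d' n) p.
  have i3 : mu.-integrable Om (EFin \o tensor (bump a' b' n) (bump c' d' n)).
    have i1c : mu.-integrable Om (EFin \o (fun _ : R * R => 1 : R)).
      apply: measurable_bounded_integrable => //.
      by exists 1; split; [exact: num_real | move=> M CM x _ /=; rewrite normr1 ltW].
    have := bump_tensor_integrable a' b' c' d' n n mOm i1c.
    by apply: eq_integrable => // p _ /=; rewrite mul1r.
  rewrite -RintegralZl// /K -RintegralB//.
  by apply: eq_Rintegral => p _; ring.
have sub' : crect a' b' c' d' `<=` Om.
  apply: subset_trans sub => -[x y] []; rewrite /= !in_itv /= => /andP[h1 h2] /andP[h3 h4].
  by split; rewrite /= in_itv /= ?(le_trans aa h1) ?(le_trans h2 bb)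
    ?(le_trans cc h3) ?(le_trans h4 dd).
rewrite bump_tensor_mass//.
(* The weak derivative in the first variable exchanges the first bump for the reference one; the
   other variable is treated likewise below. *)
have e1 : mass (bump a b 1) * K (bump a' b' n) (bump c' d' n) =
    mass (bump a' b' n) * K (bump a b 1) (bump c' d' n).
  have [F [sF dF F0]] := combination n aa bb.
  have [] := gs (test_function_tensor sub sF (smooth_bump c' d' n) F0
    (fun x => @bump_off c d c' d' n x cc dd)).
  by rewrite partial1_tensor// dF -/(K _ _) K_lin => /eqP; rewrite subr_eq0 => /eqP.
have e2 : mass (bump c d 1) * K (bump a b 1) (bump c' d' n) =
    mass (bump c' d' n) * K (bump a b 1) (bump c d 1).
  have [F [sF dF F0]] := combination n cc dd.
  have [_] := gs (test_function_tensor sub (smooth_bump a b 1) sF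
    (fun x => @bump_off a b a b 1 x (lexx _) (lexx _)) F0).
  by rewrite partial2_tensor// dF -/(K _ _) K_linr => /eqP; rewrite subr_eq0 => /eqP.
exact: (cross_ratio (lt0r_neq0 ma) (lt0r_neq0 mc) e1 e2).
Qed.

End rect_constant.

(** The sets [good k] are open, cover [Om] and are disjoint for distinct [k], so connectedness
    leaves only one of them. *)
Lemma connected_constant Om s : open Om -> connected Om -> (mu Om < +oo)%E ->
  mu.-integrable Om (EFin \o s) -> zero_weak_gradient Om s ->
  exists k : R, s = cst k %[ae mu in Om].
Proof.
move=> oOm cOm fOm is_ gs.
have [->|/set0P[p0 Op0]] := eqVneq Om set0.
  by exists 0; apply: aeW.
have mOm := open_measurable2 oOm.
pose good k p := exists a b c d, [/\ crect a b c d `<=` Om, orect a b c d p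
  & s = cst k %[ae mu in orect a b c d]].
have goodP p : Om p -> exists k, good k p.
  move=> Op; have [q [qs qp]] := open_rat_rect oOm Op.
  have [] := qp; rewrite /= !in_itv /= => /andP[h1 h2] /andP[h3 h4].
  have := rect_constant mOm fOm is_ (lt_trans h1 h2) (lt_trans h3 h4) qs gs.
  by set C := (C in cst C) => hC; exists C, (ratr q.1.1), (ratr q.1.2), (ratr q.2.1), (ratr q.2.2).
have good_uniq k k' p : good k p -> good k' p -> k = k'.
  move=> [a [b [c [d [_ Q1 s1]]]]] [a' [b' [c' [d' [_ Q2 s2]]]]].
  apply: contrapT => kk'.
  have Q12 : (orect a b c d `&` orect a' b' c' d') p by split.
  (* On the intersection, a nonempty open set, [s] would equal both [k] and [k'] almost
     everywhere. *)
  apply: (@open_not_negligible (orect a b c d `&` orect a' b' c' d')).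
  - by rewrite orectI; exact: open_orect.
  - by exists p.
  apply: negligibleS (negligibleU s1 s2) => q [q1 q2] /=.
  apply: contrapT => /not_orP[/contrapT h1 /contrapT h2].
  by apply: kk'; rewrite -(h1 q1) -(h2 q2).
have open_good k : open (good k).
  rewrite openE => p [a [b [c [d [Qs Qp sk]]]]].
  have : nbhs p (orect a b c d).
    apply: open_nbhs_nbhs; split => //; exact: open_orect.
  by apply: filterS => q Qq; exists a, b, c, d.
have good_Om k : good k `<=` Om.
  move=> p [a [b [c [d [Qs [] ]]]]]; rewrite /= !in_itv /= => /andP[? ?] /andP[? ?] _.
  by apply: Qs; split; rewrite /= in_itv /= !ltW.
have [k0 gk0] := goodP _ Op0.
have E : good k0 = Om.
  apply: cOm.
  - by exists p0.
  - by exists (good k0) => //; apply/esym/setIidPr.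
  (* [good k0] is closed in [Om], as the complement of the union of the other open sets [good k]. *)
  - exists (~` (\bigcup_(k in [set k | k != k0]) good k)).
      by apply: open_closedC; apply: bigcup_open => k _; exact: open_good.
    apply/seteqP; split=> p.
      move=> gp; split; first exact: good_Om gp.
      by move=> [k /= /eqP kk0 gkp]; apply: kk0; exact: good_uniq gkp gp.
    move=> [Op ng]; have [k gk] := goodP _ Op.
    have [<-//|kk0] := eqVneq k k0.
    by exfalso; apply: ng; exists k.
exists k0; apply: ae_cover => // a b c d sub.
have [ab|ba] := ltP a b; last first.
  by apply: aeW => -[x y] []; rewrite /= !in_itv /= => /andP[h1 h2];
    have := lt_trans h1 h2; rewrite ltNge ba.
have [cd|dc] := ltP c d; last first.
  by apply: aeW => -[x y] [_]; rewrite /= !in_itv /= => /andP[h1 h2];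
    have := lt_trans h1 h2; rewrite ltNge dc.
have := rect_constant mOm fOm is_ ab cd sub gs.
set C := (C in cst C) => hC.
suff <- : C = k0 by [].
pose p := ((a + b) / 2, (c + d) / 2).
have Qp : orect a b c d p.
  by split; rewrite /p /= in_itv /=; apply/andP; split; lra.
apply: (@good_uniq _ _ p); first by exists a, b, c, d.
rewrite E; apply: sub; have [] := Qp; rewrite /= !in_itv /= => /andP[? ?] /andP[? ?].
by split; rewrite /= in_itv /= !ltW.
Qed.

End plane.

(** * Test functions on a bounded domain *)

Section test_functions.
Context {R : realType}.
Local Notation MR := (measurableTypeR R).
Local Notation mu := (@lebesgue2 R).
Local Notation leb := (@lebesgue_measure R).
Implicit Types (Om : set (R * R)) (f phi : R * R -> R).

Lemma continuous_measurable2 f : continuous f ->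
  measurable_fun setT (f : MR * MR -> R).
Proof.
move=> cf; apply: (measurability _ (RGenOpens.measurableE R)).
move=> _ [_ [a [b ->]] <-]; rewrite setTI; apply: open_measurable2.
by move/continuousP : cf; apply; exact: interval_open.
Qed.

Lemma bounded_set_rect (A : set (R * R)) : bounded_set A ->
  exists2 M : R, 0 < M & forall p, A p -> `|p.1| <= M /\ `|p.2| <= M.
Proof.
move=> [M [_ hM]]; exists (`|M| + 1) => [|[x y] Axy]; first by rewrite ltr_wpDl.
have : `|(x, y)| <= `|M| + 1.
  by apply: hM => //; rewrite (le_lt_trans (ler_norm M))// ltrDl.
by rewrite prod_normE /= ge_max => /andP[].
Qed.

Lemma continuous_bounded_on Om f : bounded_set Om -> continuous f ->
  exists2 C : R, 0 <= C & forall p, Om p -> `|f p| <= C.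
Proof.
move=> /bounded_set_rect[M M0 hM] cf.
have cK : compact (crect (- M) M (- M) M).
  by apply: compact_setX; exact: segment_compact.
have : bounded_set (f @` crect (- M) M (- M) M).
  by apply/compact_bounded/continuous_compact => //; exact: continuous_subspaceT.
move=> [C [_ hC]]; exists (`|C| + 1) => [|p Op]; first by rewrite addr_ge0.
apply: (hC (`|C| + 1)); first by rewrite (le_lt_trans (ler_norm C))// ltrDl.
exists p => //; have [h1 h2] := hM _ Op.
by split; rewrite /= in_itv /= -ler_norml.
Qed.

Lemma integral_derive1_compact (F : R -> R) (M : R) : 0 < M ->
  (forall x, derivable F x 1) -> continuous (derive1 F) ->
  (forall x, M <= `|x| -> F x = 0) -> (forall x, M <= `|x| -> derive1 F x = 0) ->
  (\int[leb]_x (derive1 F x)%:E = 0)%E.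
Proof.
move=> M0 dF cF F0 F'0.
have MM : - M < M by lra.
have cFx x : {for x, continuous F}.
  by apply/differentiable_continuous/derivable1_diffP.
transitivity (\int[leb]_(x in `[(- M)%R, M]) (derive1 F x)%:E)%E.
  rewrite [RHS]integral_mkcond; apply: eq_integral => x _.
  rewrite patchE; case: ifPn => //; rewrite notin_setE /= in_itv /= => /negP.
  rewrite -ler_norml -ltNge => h; rewrite F'0//; exact: ltW.
have c1 : {within `[- M, M], continuous (derive1 F)} by exact: continuous_subspaceT.
have d1 : derivable_oo_LRcontinuous F (- M) M.
  split.
  - by move=> x _; exact: dF.
  - by apply: cvg_at_right_filter; exact: cFx.
  - by apply: cvg_at_left_filter; exact: cFx.
have e1 : {in `]- M, M[, derive1 F =1 derive1 F} by [].
have FM : F M = 0 by apply: F0; rewrite gtr0_norm.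
have FNM : F (- M) = 0 by apply: F0; rewrite normrN gtr0_norm.
by rewrite (continuous_FTC2 MM c1 d1 e1) FM FNM subee.
Qed.

Section fixed.
Variables (Om : set (R * R)) (phi : R * R -> R).
Hypothesis bOm : bounded_set Om.
Hypothesis tphi : test_function Om phi.

Lemma test_continuous : continuous phi.
Proof. by have [/(_ 0%N)] := tphi. Qed.

Lemma test_partial1_continuous : continuous (partial1 phi).
Proof. by have [/(_ 1%N)[]] := tphi. Qed.

Lemma test_partial2_continuous : continuous (partial2 phi).
Proof. by have [/(_ 1%N)[]] := tphi. Qed.

Let cv1 (y x : R) : {for x, continuous (fun t : R => (t, y))}.
Proof.
move=> S [[A B] [/= Ax By] AB]; apply: filterS Ax => t At.
by apply: AB; split => //=; exact: nbhs_singleton By.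
Qed.

Let cv2 (x y : R) : {for y, continuous (fun t : R => (x, t))}.
Proof.
move=> S [[A B] [/= Ax By] AB]; apply: filterS By => t Bt.
by apply: AB; split => //=; exact: nbhs_singleton Ax.
Qed.

(** The complement of the compact support is open, so [phi] is locally zero there and its partial
    derivatives vanish as well. *)
Lemma test_support : exists2 M : R, 0 < M & forall p, ~ (Om p /\ `|p.1| < M /\ `|p.2| < M) ->
  [/\ phi p = 0, partial1 phi p = 0 & partial2 phi p = 0].
Proof.
have [_ [K [cK KOm K0]]] := tphi.
have [M M0 hM] := bounded_set_rect (compact_bounded cK).
(* The bound on the support is not strict, hence the [+ 1]. *)
exists (M + 1) => [|p np]; first by rewrite addr_gt0.
have nKp : ~ K p.
  move=> Kp; apply: np; have [h1 h2] := hM _ Kp; split; first exact: KOm.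
  have MM1 : M < M + 1 by rewrite ltrDl.
  by split; [exact: le_lt_trans h1 MM1 | exact: le_lt_trans h2 MM1].
have oK : open (~` K).
  by apply: closed_openC; apply: compact_closed => //; exact: norm_hausdorff.
have nK : nbhs p (~` K) by exact: open_nbhs_nbhs.
split; first exact: K0.
  rewrite /partial1 derive1E -(derive_cst (0 : R) p.1 (1 : R)).
  apply: near_eq_derive; have : nbhs p.1 ((fun t => (t, p.2)) @^-1` (~` K)).
    by apply: cv1; case: p nK {np nKp}.
  by apply: filterS => t; exact: K0.
rewrite /partial2 derive1E -(derive_cst (0 : R) p.2 (1 : R)).
apply: near_eq_derive; have : nbhs p.2 ((fun t => (p.1, t)) @^-1` (~` K)).
  by apply: cv2; case: p nK {np nKp}.
by apply: filterS => t; exact: K0.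
Qed.

Let integrable_supp f M : continuous f -> 0 < M ->
  (forall p, ~ (Om p /\ `|p.1| < M /\ `|p.2| < M) -> f p = 0) ->
  mu.-integrable setT (EFin \o f).
Proof.
move=> cf M0 f0.
have [C C0 hC] := continuous_bounded_on bOm cf.
apply: (@bounded_support_integrable _ _ _ mu (crect (- M) M (- M) M) _ C).
- by apply: measurableX; exact: measurable_itv.
- rewrite /orect /crect lebesgue2X; try exact: measurable_itv.
  by rewrite lte_mul_pinfty ?itv_fin// ge0_fin_numE// itv_fin.
- exact: continuous_measurable2.
- move=> p; have [Op|nOp] := pselect (Om p); first exact: hC.
  by rewrite f0 ?normr0// => -[].
- move=> p np; apply: f0 => -[_ [h1 h2]]; apply: np.
  by split; rewrite /= in_itv /= -ler_norml ltW.
Qed.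

(** As the derivatives vanish off a part of [Om] inside a square, the integrals extend to the plane,
    where Fubini and the fundamental theorem of calculus apply line by line. This is why constants
    have zero weak gradient. *)
Lemma integral_partial_test :
  \int[mu]_(p in Om) partial1 phi p = 0 /\ \int[mu]_(p in Om) partial2 phi p = 0.
Proof.
have [M M0 hM] := test_support.
have toT f : (forall p, ~ (Om p /\ `|p.1| < M /\ `|p.2| < M) -> f p = 0) ->
    \int[mu]_(p in Om) f p = \int[mu]_p f p.
  move=> f0; rewrite Rintegral_mkcond; apply: eq_Rintegral => p _.
  rewrite patchE; case: ifPn => //; rewrite notin_setE => np.
  by rewrite f0// => -[].
have p1 p : ~ (Om p /\ `|p.1| < M /\ `|p.2| < M) -> partial1 phi p = 0.
  by move=> /hM[].
have p2 p : ~ (Om p /\ `|p.1| < M /\ `|p.2| < M) -> partial2 phi p = 0.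
  by move=> /hM[].
have [/(_ 1%N)[_ d1 d2 _ _] _] := tphi.
split; rewrite toT//.
  rewrite {1}/Rintegral -integral21_prod_meas1; last first.
    exact: (integrable_supp test_partial1_continuous M0 p1).
  rewrite integral0_eq// => y _; rewrite /fubini_G.
  apply: (@integral_derive1_compact (fun t => phi (t, y)) M M0).
  - by move=> x; exact: (d1 (x, y)).
  - move=> x; apply: (@continuous_comp _ _ _ (fun t : R => (t, y)) (partial1 phi)).
      exact: cv1.
    exact: test_partial1_continuous.
  - by move=> x Mx; have [] := hM (x, y); rewrite //= => -[_ []]; rewrite ltNge Mx.
  - move=> x Mx; apply: (p1 (x, y)); rewrite //= => -[_ []]; by rewrite ltNge Mx.
rewrite {1}/Rintegral -integral12_prod_meas1; last first.
  exact: (integrable_supp test_partial2_continuous M0 p2).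
rewrite integral0_eq// => x _; rewrite /fubini_F.
apply: (@integral_derive1_compact (fun t => phi (x, t)) M M0).
- by move=> y; exact: (d2 (x, y)).
- move=> y; apply: (@continuous_comp _ _ _ (fun t : R => (x, t)) (partial2 phi)).
    exact: cv2.
  exact: test_partial2_continuous.
- by move=> y Mx; have [] := hM (x, y); rewrite //= => -[_ [_]]; rewrite ltNge Mx.
- move=> y Mx; apply: (p2 (x, y)); rewrite //= => -[_ [_]]; by rewrite ltNge Mx.
Qed.

Hypothesis oOm : open Om.

Lemma continuous_ae_bounded f : continuous f -> ae_bounded mu Om f.
Proof.
move=> cf; split; first by apply: measurable_funTS; exact: continuous_measurable2.
have [C C0 hC] := continuous_bounded_on bOm cf.
by exists C; apply: aeW => p; exact: hC.
Qed.

End fixed.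

Lemma cst_sqi Om (k : R) : bounded_set Om -> open Om ->
  sqi mu Om (cst k).
Proof.
move=> bOm oOm; have mOm := open_measurable2 oOm; split; first exact: measurable_cst.
apply: measurable_bounded_integrable => //.
- exact: bounded_finite.
- by apply: measurable_funX; exact: measurable_cst.
by exists (k ^+ 2); split; [exact: num_real | move=> M CM x _ /=; rewrite ger0_norm ?sqr_ge0// ltW].
Qed.

Lemma ae_bounded_sqi Om f : bounded_set Om -> open Om -> ae_bounded mu Om f ->
  sqi mu Om f.
Proof.
move=> bOm oOm hf; have mOm := open_measurable2 oOm.
have -> : f = (fun x => f x * cst 1 x) by apply/funext => x; rewrite /= mulr1.
exact: (ae_boundedM mOm hf (cst_sqi 1 bOm oOm)).
Qed.

Lemma sqi_integrable Om f : bounded_set Om -> open Om -> sqi mu Om f ->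
  mu.-integrable Om (EFin \o f).
Proof.
move=> bOm oOm hf; have mOm := open_measurable2 oOm.
have := sqi_mul_integrable mOm hf (cst_sqi 1 bOm oOm).
by apply: eq_integrable => // x _ /=; rewrite mulr1.
Qed.

End test_functions.

Lemma lin2 (A : pzRingType) (k a b a' b' : A) :
  k * a + a' + (k * b + b') = k * (a + b) + (a' + b').
Proof. by rewrite mulrDr addrACA. Qed.

(** * Weak gradients and Sobolev functions *)

Section sobolev.
Context {R : realType}.
Local Notation MR := (measurableTypeR R).
Local Notation mu := (@lebesgue2 R).
Variable Om : set (R * R).
Hypotheses (oOm : open Om) (bOm : bounded_set Om) (cOm : connected Om).
Implicit Types (s f phi : R * R -> R) (G : (R * R -> R) * (R * R -> R)) (k : R).

Let mOm : measurable (Om : set (MR * MR)) := open_measurable2 oOm.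
Let fOm : (mu Om < +oo)%E := bounded_finite mOm bOm.

Lemma L2P f : L2 Om f <-> sqi mu Om f.
Proof. exact: sqi_Lfun. Qed.

Lemma continuous_sqi phi : continuous phi -> sqi mu Om phi.
Proof. by move=> cphi; apply: ae_bounded_sqi => //; exact: continuous_ae_bounded. Qed.

Lemma sqi_test_integrable f phi : sqi mu Om f -> continuous phi ->
  mu.-integrable Om (EFin \o (fun p => f p * phi p)).
Proof. by move=> hf cphi; apply: sqi_mul_integrable => //; exact: continuous_sqi. Qed.

Lemma Rintegral_lin f f' phi k : sqi mu Om f -> sqi mu Om f' -> continuous phi ->
  \int[mu]_(p in Om) ((k *: f + f') p * phi p) =
  k * \int[mu]_(p in Om) (f p * phi p) + \int[mu]_(p in Om) (f' p * phi p).
Proof.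
move=> hf hf' cphi.
have i1 := sqi_test_integrable hf cphi; have i2 := sqi_test_integrable hf' cphi.
have i3 := integrableZl mOm k i1.
rewrite -RintegralZl// -RintegralD//.
by apply: eq_Rintegral => p _; rewrite !fctE /= /GRing.scale /=; ring.
Qed.

Lemma weak_gradientP k s s' G G' : sqi mu Om s -> sqi mu Om s' ->
  weak_gradient Om s G -> weak_gradient Om s' G' ->
  weak_gradient Om (k *: s + s') (k *: G.1 + G'.1, k *: G.2 + G'.2).
Proof.
move=> hs hs' [/L2P g1 /L2P g2 Gs] [/L2P g1' /L2P g2' Gs'].
split; [exact/L2P/sqiP|exact/L2P/sqiP|move=> phi tphi].
have [e1 e2] := Gs _ tphi; have [e1' e2'] := Gs' _ tphi.
have c0 := test_continuous tphi.
have c1 := test_partial1_continuous tphi; have c2 := test_partial2_continuous tphi.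
split; rewrite !Rintegral_lin//.
  by rewrite e1 e1' mulrN -opprD.
by rewrite e2 e2' mulrN -opprD.
Qed.

Lemma sqi_ae0 f : sqi mu Om f ->
  (forall phi, test_function Om phi -> \int[mu]_(p in Om) (f p * phi p) = 0) ->
  f = cst 0 %[ae mu in Om].
Proof.
move=> hf f0; apply: ae_cover => // a b c d sub.
by apply: (fundamental_lemma mOm _ sub) => //; exact: sqi_integrable.
Qed.

Lemma weak_gradient_uniq s G G' : weak_gradient Om s G -> weak_gradient Om s G' ->
  G.1 = G'.1 %[ae mu in Om] /\ G.2 = G'.2 %[ae mu in Om].
Proof.
move=> [/L2P g1 /L2P g2 Gs] [/L2P g1' /L2P g2' Gs'].
have key f f' : sqi mu Om f -> sqi mu Om f' ->
    (forall phi, test_function Om phi ->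
      \int[mu]_(p in Om) (f p * phi p) = \int[mu]_(p in Om) (f' p * phi p)) ->
    f = f' %[ae mu in Om].
  move=> hf hf' ff'; have h : sqi mu Om ((-1) *: f' + f) by exact: sqiP.
  have : ((-1) *: f' + f) = cst 0 %[ae mu in Om].
    apply: sqi_ae0 => // phi tphi.
    by rewrite Rintegral_lin// ?ff'//; [lra | exact: test_continuous tphi].
  apply: ae_imp => p hp Op; have := hp Op.
  by rewrite !fctE /= /GRing.scale /=; lra.
by split; apply: key => // phi tphi; have [] := Gs _ tphi; have [] := Gs' _ tphi;
  move=> -> -> /oppr_inj // _ /oppr_inj.
Qed.

Lemma weak_gradient_ae s s' G : sqi mu Om s -> sqi mu Om s' ->
  s = s' %[ae mu in Om] -> weak_gradient Om s G -> weak_gradient Om s' G.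
Proof.
move=> hs hs' ss' [g1 g2 Gs]; split => // phi tphi.
have [<- <-] := Gs _ tphi.
have c1 := test_partial1_continuous tphi; have c2 := test_partial2_continuous tphi.
have m f : continuous f -> measurable_fun Om (f : MR * MR -> R).
  by move=> cf; apply: measurable_funTS; exact: continuous_measurable2.
split; apply: ae_eq_Rintegral => //.
- by apply: measurable_funM; [case: hs' | exact: m].
- by apply: measurable_funM; [case: hs | exact: m].
- by apply: ae_imp ss' => p h Op; rewrite h.
- by apply: measurable_funM; [case: hs' | exact: m].
- by apply: measurable_funM; [case: hs | exact: m].
- by apply: ae_imp ss' => p h Op; rewrite h.
Qed.

Lemma weak_gradient0 s : zero_weak_gradient Om s <->
  weak_gradient Om s (cst 0, cst 0).
Proof.
have z phi : \int[mu]_(p in Om) (cst (0 : R) p * phi p) = 0.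
  rewrite (@eq_Rintegral _ _ _ _ _ (cst 0)); first by rewrite Rintegral_cst// mul0r.
  by move=> p _; rewrite /= mul0r.
split=> [h|[_ _ h] phi tphi]; last by have := h _ tphi; rewrite !z oppr0.
split; [exact/L2P/sqi0|exact/L2P/sqi0|].
by move=> phi tphi; rewrite !z oppr0; exact: h.
Qed.

Lemma weak_gradient_cst k : weak_gradient Om (cst k) (cst 0, cst 0).
Proof.
apply/weak_gradient0 => phi tphi.
have [h1 h2] := integral_partial_test bOm tphi.
have c1 := test_partial1_continuous tphi; have c2 := test_partial2_continuous tphi.
by split; rewrite RintegralZl ?h1 ?h2 ?mulr0//; apply: sqi_integrable => //; exact: continuous_sqi.
Qed.

Lemma gradP s : sobolev1 Om s -> weak_gradient Om s (grad Om s).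
Proof.
by move=> [_ [G hG]]; rewrite /grad; apply: (xgetPex _ (P := weak_gradient Om s)); exists G.
Qed.

Lemma sobolev1_sqi s : sobolev1 Om s -> sqi mu Om s.
Proof. by move=> [/L2P]. Qed.

Lemma grad_sqi s : sobolev1 Om s ->
  sqi mu Om (grad Om s).1 /\ sqi mu Om (grad Om s).2.
Proof. by move=> /gradP[/L2P ? /L2P ?]. Qed.

Lemma sobolev1P k s s' : sobolev1 Om s -> sobolev1 Om s' -> sobolev1 Om (k *: s + s').
Proof.
move=> hs hs'; split.
  by apply/L2P/sqiP => //; exact: sobolev1_sqi.
by eexists; apply: weak_gradientP (gradP hs) (gradP hs'); exact: sobolev1_sqi.
Qed.

(** [grad] is a choice among weak gradients, so it is linear only almost everywhere, by
    uniqueness. *)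
Lemma grad_lin k s s' : sobolev1 Om s -> sobolev1 Om s' ->
  (grad Om (k *: s + s')).1 = k *: (grad Om s).1 + (grad Om s').1 %[ae mu in Om] /\
  (grad Om (k *: s + s')).2 = k *: (grad Om s).2 + (grad Om s').2 %[ae mu in Om].
Proof.
move=> hs hs'.
have := weak_gradientP k (sobolev1_sqi hs) (sobolev1_sqi hs') (gradP hs) (gradP hs').
exact: (weak_gradient_uniq (gradP (sobolev1P k hs hs'))).
Qed.

Lemma sobolev1_cst k : sobolev1 Om (cst k).
Proof.
split; first exact/L2P/cst_sqi.
by exists (cst 0, cst 0); exact: weak_gradient_cst.
Qed.

Lemma grad_ae_cst k s : sqi mu Om s -> s = cst k %[ae mu in Om] ->
  (grad Om s).1 = cst 0 %[ae mu in Om] /\ (grad Om s).2 = cst 0 %[ae mu in Om].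
Proof.
move=> hs sk.
have wg : weak_gradient Om s (cst 0, cst 0).
  apply: (@weak_gradient_ae (cst k)) => //; first exact: cst_sqi.
    by apply: ae_imp sk => p h Op; rewrite h.
  exact: weak_gradient_cst.
have hs1 : sobolev1 Om s by split; [exact/L2P | exists (cst 0, cst 0)].
exact: (weak_gradient_uniq (gradP hs1) wg).
Qed.

Lemma wip_vdot w s s' : ae_bounded mu Om w -> sobolev1 Om s -> sobolev1 Om s' ->
  mu.-integrable Om (EFin \o (fun p => w p * vdot (grad Om s) (grad Om s') p)) /\
  \int[mu]_(p in Om) (w p * vdot (grad Om s) (grad Om s') p) =
  wip mu Om w (grad Om s).1 (grad Om s').1 + wip mu Om w (grad Om s).2 (grad Om s').2.
Proof.
move=> hw /grad_sqi[h1 h2] /grad_sqi[h1' h2'].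
have i1 := sqi_wmul_integrable mOm hw h1 h1'.
have i2 := sqi_wmul_integrable mOm hw h2 h2'.
split.
  have := integrableD mOm i1 i2; apply: eq_integrable => // p _ /=.
  by rewrite /vdot -EFinD; congr EFin; ring.
by rewrite /wip -RintegralD//; apply: eq_Rintegral => p _; rewrite /vdot; ring.
Qed.

Definition gform w s s' := wip mu Om w (grad Om s).1 (grad Om s').1 +
  wip mu Om w (grad Om s).2 (grad Om s').2.

Lemma gform_lin w k s s' v : ae_bounded mu Om w -> sobolev1 Om s -> sobolev1 Om s' ->
  sobolev1 Om v -> gform w (k *: s + s') v = k * gform w s v + gform w s' v.
Proof.
move=> hw hs hs' hv; have [e1 e2] := grad_lin k hs hs'.
have [h1 h2] := grad_sqi hs; have [h1' h2'] := grad_sqi hs'.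
have [k1 k2] := grad_sqi hv.
have [l1 l2] := grad_sqi (sobolev1P k hs hs').
have q1 := sqiP mOm k h1 h1'; have q2 := sqiP mOm k h2 h2'.
rewrite /gform (wip_ae mOm hw l1 q1 k1 e1) (wip_ae mOm hw l2 q2 k2 e2).
rewrite (wip_linear mOm k hw h1 h1' k1) (wip_linear mOm k hw h2 h2' k2).
exact: lin2.
Qed.

Lemma gformC w s s' : gform w s s' = gform w s' s.
Proof.
rewrite /gform (wipC mu Om w (grad Om s).1 (grad Om s').1).
by rewrite (wipC mu Om w (grad Om s).2 (grad Om s').2).
Qed.

Lemma gform_ge0 w s : ae_bounded mu Om w -> (\forall p \ae mu, Om p -> 0 <= w p) ->
  sobolev1 Om s -> 0 <= gform w s s.
Proof.
move=> hw w0 /grad_sqi[h1 h2].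
by rewrite addr_ge0// (semi_inner_ge0 (wip_semi_inner mOm hw w0)).
Qed.

Lemma gform_le w w' s : ae_bounded mu Om w -> ae_bounded mu Om w' ->
  (\forall p \ae mu, Om p -> w p <= w' p) ->
  sobolev1 Om s -> gform w s s <= gform w' s s.
Proof. by move=> hw hw' ww' /grad_sqi[h1 h2]; rewrite lerD// wip_le. Qed.

Lemma gform_ae_cst w k s v : ae_bounded mu Om w -> sobolev1 Om s ->
  s = cst k %[ae mu in Om] -> sobolev1 Om v -> gform w s v = 0.
Proof.
move=> hw hs sk hv; have [h1 h2] := grad_sqi hs; have [k1 k2] := grad_sqi hv.
have [e1 e2] := grad_ae_cst (sobolev1_sqi hs) sk.
have z : sqi mu Om (cst 0) by exact: sqi0.
rewrite /gform (wip_ae mOm hw h1 z k1 e1) (wip_ae mOm hw h2 z k2 e2).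
have z0 f : wip mu Om w (cst 0) f = 0.
  rewrite /wip (@eq_Rintegral _ _ _ _ _ (cst 0)); first by rewrite Rintegral_cst// mul0r.
  by move=> p _; rewrite /= mulr0 mul0r.
by rewrite !z0 addr0.
Qed.

Local Notation sq := (wip mu Om (cst 1)).

Let Hs : semi_inner (sqi mu Om) sq.
Proof.
apply: wip_semi_inner => //; first exact: ae_bounded_cst.
by apply: aeW => x _ /=.
Qed.

Let sqE f phi : \int[mu]_(p in Om) (f p * phi p) = sq f phi.
Proof. by apply: eq_Rintegral => p _; rewrite /= mul1r. Qed.

Lemma sq_cvg0 (u : nat -> R * R -> R) f : (forall n, sqi mu Om (u n)) -> sqi mu Om f ->
  sq (u n) (u n) @[n --> \oo] --> 0 -> sq (u n) f @[n --> \oo] --> 0.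
Proof.
move=> hu hf u0; rewrite -(ip0l Hs hf).
apply: (cvg_ip Hs) => //; first exact: (semi_inner0 Hs).
by under eq_fun do rewrite subr0.
Qed.

(** The L^2 limit exists by completeness; passing to the limit in the definition of the weak
    gradient shows that its own is zero, so connectedness makes it constant. *)
Lemma gradient_closed (u : nat -> R * R -> R) : (forall n, sobolev1 Om (u n)) ->
  (forall eps : R, 0 < eps -> \forall N \near \oo, forall M, (N <= M)%N ->
     sq (u M - u N) (u M - u N) < eps) ->
  gform (cst 1) (u n) (u n) @[n --> \oo] --> 0 ->
  exists k : R, sq (u n - k *: cst 1) (u n - k *: cst 1) @[n --> \oo] --> 0.
Proof.
move=> hu cu gu.
have su n : sqi mu Om (u n) by exact: sobolev1_sqi.
have [v [hv uv]] := L2_complete mOm su cu.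
have g0 i : sq ((if i : bool then fst else snd) (grad Om (u n)))
    ((if i then fst else snd) (grad Om (u n))) @[n --> \oo] --> 0.
  apply: (squeeze_cvgr _ (cvg_cst 0) gu); apply: nearW => n.
  have [h1 h2] := grad_sqi (hu n).
  rewrite /gform; case: i; rewrite (semi_inner_ge0 Hs)//= ?lerDl ?lerDr (semi_inner_ge0 Hs)//.
have zv : zero_weak_gradient Om v.
  move=> phi tphi.
  have c0 := continuous_sqi (test_continuous tphi).
  have c1 := continuous_sqi (test_partial1_continuous tphi).
  have c2 := continuous_sqi (test_partial2_continuous tphi).
  rewrite !sqE; split.
    apply: (cvg_unique _ (cvg_ip Hs su hv c1 uv)) => //.
    have -> : (fun n => sq (u n) (partial1 phi)) = (fun n => - sq (grad Om (u n)).1 phi).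
      apply/funext => n; have [_ _ /(_ _ tphi)[+ _]] := gradP (hu n).
      by rewrite !sqE.
    rewrite -oppr0; apply: cvgN; apply: sq_cvg0 => //; last exact: (g0 true).
    by move=> n; have [] := grad_sqi (hu n).
  apply: (cvg_unique _ (cvg_ip Hs su hv c2 uv)) => //.
  have -> : (fun n => sq (u n) (partial2 phi)) = (fun n => - sq (grad Om (u n)).2 phi).
    apply/funext => n; have [_ _ /(_ _ tphi)[_ +]] := gradP (hu n).
    by rewrite !sqE.
  rewrite -oppr0; apply: cvgN; apply: sq_cvg0 => //; last exact: (g0 false).
  by move=> n; have [] := grad_sqi (hu n).
have [k vk] := connected_constant oOm cOm fOm (sqi_integrable bOm oOm hv) zv.
exists k.
have sk : sqi mu Om (k *: cst 1) by apply: (sub_Z Hs); exact: cst_sqi.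
have E n : sq (u n - k *: cst 1) (u n - k *: cst 1) = sq (u n - v) (u n - v).
  have h1 := sub_B Hs (su n) sk; have h2 := sub_B Hs (su n) hv.
  have ae : u n - k *: cst 1 = u n - v %[ae mu in Om].
    apply: ae_imp vk => p hp Op; rewrite !fctE /= hp//.
    by rewrite /GRing.scale /= mulr1.
  have b1 := @ae_bounded_cst _ _ R mu Om 1.
  by rewrite (wip_ae mOm b1 h1 h2 h1 ae) wipC (wip_ae mOm b1 h1 h2 h2 ae).
by under eq_fun do rewrite E.
Qed.

End sobolev.

(** * Traces and arc length *)

Section translation.
Context {R : realType}.
Implicit Types (A N : set (R * R)) (t : R * R).

Let shift t A : set (R * R) := (fun p => p + t) @^-1` A.

Lemma ediam_translate t A : (ediam (shift t A) <= ediam A)%E.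
Proof.
apply: ge_ereal_sup => x [->|[[p q] [Ap Aq] <-]]; first exact: ediam_ge0.
apply: ereal_sup_ubound; right; exists (p + t, q + t) => //=.
by rewrite /edist opprD addrACA subrr addr0.
Qed.

Lemma hausdorff1_translate t A : (hausdorff1 (shift t A) <= hausdorff1 A)%E.
Proof.
apply: ge_ereal_sup => _ [d /= d0 <-].
apply: (@le_trans _ _ (hausdorff_delta d A)); last first.
  by apply: ereal_sup_ubound; exists d.
apply: le_ereal_inf_tmp => _ [F [AF Fd] <-].
apply: (@le_trans _ _ (\sum_(k <oo) ediam (shift t (F k)))%E).
  apply: ereal_inf_lbound; exists (fun k => shift t (F k)) => //; split.
    by move=> p /AF[k _ Fk]; exists k.
  by move=> k; exact: le_trans (ediam_translate t (F k)) (Fd k).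
apply: lee_nneseries => [k _ _|k _]; first exact: ediam_ge0.
exact: ediam_translate.
Qed.

(** A negligible set needs a measurable witness. Null sets are always Carathéodory measurable, so a
    translated witness is measurable as soon as its outer measure is still 0. *)
Lemma hausdorff1_null_measurable N : hausdorff1 N = 0%E -> measurable_arc N.
Proof.
move=> N0; apply: le_caratheodory_measurable => X.
have -> : hausdorff1_outer (X `&` N) = 0%E.
  apply/eqP; rewrite eq_le outer_measure_ge0 andbT -N0.
  by apply: le_outer_measure; exact: subIsetr.
by rewrite add0e; apply: le_outer_measure; exact: subIsetl.
Qed.

(** Periodicity compares traces at [p] and [p + tau], so identities between traces that hold almost
    everywhere have to be transported by the translation. *)
Lemma arclength_translate t (P : R * R -> Prop) :
  (\forall p \ae arclength, P p) -> \forall p \ae arclength, P (p + t).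
Proof.
move=> [N [mN N0 sub]].
have N0' : hausdorff1 (shift t N) = 0%E.
  apply/eqP; rewrite eq_le; apply/andP; split.
    by apply: le_trans (hausdorff1_translate t N) _; rewrite -N0.
  exact: (@outer_measure_ge0 _ _ hausdorff1_outer).
exists (shift t N); split => //; first exact: hausdorff1_null_measurable.
by move=> p /= nP; apply: sub.
Qed.

End translation.

Section trace.
Context {R : realType}.
Local Notation mu := (@lebesgue2 R).
Local Notation arc := (@arclength R).
Variable Om : set (R * R).
Hypotheses (oOm : open Om) (bOm : bounded_set Om) (cOm : connected Om).
Variable tr : (R * R -> R) -> (R * R -> R).
Hypothesis htr : trace_operator Om tr.
Implicit Types (s f : R * R -> R) (k : R) (A : set (R * R)).

Let mOm := open_measurable2 oOm.
Local Notation sq := (wip mu Om (cst 1)).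
Local Notation asq A := (wip arc A (cst 1)).

Lemma gform_semi_inner w : ae_bounded mu Om w ->
  (\forall p \ae mu, Om p -> 0 <= w p) ->
  semi_inner (sobolev1 Om) (gform Om w).
Proof.
move=> hw w0; split.
- exact: (sobolev1_cst oOm bOm 0).
- by move=> k x y; exact: sobolev1P.
- by move=> k x y z hx hy hz; exact: gform_lin.
- by move=> x y _ _; exact: gformC.
- by move=> x hx; exact: gform_ge0.
Qed.

Lemma trace_sqi A s : measurable_arc A -> A `<=` boundary Om -> sobolev1 Om s ->
  sqi arc A (tr s).
Proof.
move=> mA AB hs; have [/(_ _ hs) h _ _ _] := htr.
have patchA p : A p -> ((tr s) \_ (boundary Om)) p = tr s p.
  by move=> Ap; rewrite patchE mem_set//; exact: AB.
split.
  move: (h); rewrite inE => /andP[+ _]; rewrite inE /= => m0.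
  have m1 := measurable_funS measurableT (@subsetT (caratheodory_type (@hausdorff1 R)) A) m0.
  by apply: eq_measurable_fun m1 => p; rewrite inE => /patchA.
have := Lfun2_integrable_sqr h.
move/(integrableS measurableT mA (@subsetT (caratheodory_type (@hausdorff1 R)) A)).
by apply: eq_integrable => // p; rewrite inE => /patchA /= ->.
Qed.

Lemma trace_lin A k s s' : A `<=` boundary Om -> sobolev1 Om s -> sobolev1 Om s' ->
  tr (k *: s + s') = k *: tr s + tr s' %[ae arc in A].
Proof.
move=> AB hs hs'; have [_ h _ _] := htr.
by apply: ae_imp (h k _ _ hs hs') => p hp Ap; apply: hp; exact: AB.
Qed.

Lemma trace_cst A k : A `<=` boundary Om -> tr (cst k) = cst k %[ae arc in A].
Proof.
move=> AB; have [_ _ _ h] := htr.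
have c : {within closure Om, continuous (cst k : R * R -> R)}.
  by apply: continuous_subspaceT => x; exact: cvg_cst.
by apply: ae_imp (h _ (sobolev1_cst oOm bOm k) c) => p hp Ap; apply: hp; exact: AB.
Qed.

Lemma trace_le : exists2 C : R, 0 <= C & forall A s, measurable_arc A ->
  A `<=` boundary Om -> sobolev1 Om s ->
  asq A (tr s) (tr s) <= C * (sq s s + gform Om (cst 1) s s).
Proof.
have [hL _ [C hC] _] := htr.
exists `|C| => // A s mA AB hs.
have b1 := @ae_bounded_cst _ _ R mu Om 1.
have ss : sqi mu Om s by exact: sobolev1_sqi.
have [i1 e1] := wip_vdot oOm b1 hs hs.
have E : \int[mu]_(p in Om) (s p ^+ 2 + vdot (grad Om s) (grad Om s) p) =
    sq s s + gform Om (cst 1) s s.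
  rewrite /gform -e1 -RintegralD//.
    by apply: eq_Rintegral => p _; rewrite /= !mul1r expr2.
  exact: sqi_wmul_integrable.
have p0 : 0 <= sq s s + gform Om (cst 1) s s.
  rewrite -E; apply: Rintegral_ge0 => p _.
  by rewrite /vdot -!expr2 !addr_ge0 ?sqr_ge0.
apply: (@le_trans _ _ (C * (sq s s + gform Om (cst 1) s s))); last first.
  by apply: ler_wpM2r => //; exact: ler_norm.
rewrite -E; apply: le_trans (hC _ hs).
have i2 := Lfun2_integrable_sqr (hL _ hs).
have h := trace_sqi mA AB hs.
have i3 : arc.-integrable setT (EFin \o ((fun p => tr s p ^+ 2) \_ A)).
  have -> : EFin \o ((fun p => tr s p ^+ 2) \_ A) = (EFin \o (fun p => tr s p ^+ 2)) \_ A.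
    by apply/funext => p; rewrite /= !patchE; case: ifP.
  by apply/(integrable_mkcond _ mA); case: h.
have -> : asq A (tr s) (tr s) = \int[arc]_p ((fun p => tr s p ^+ 2) \_ A) p.
  by rewrite -Rintegral_mkcond; apply: eq_Rintegral => p _; rewrite /= mul1r expr2.
rewrite [leRHS]Rintegral_mkcond.
have i4 : arc.-integrable setT (EFin \o ((fun p => tr s p ^+ 2) \_ (boundary Om))).
  apply: eq_integrable i2 => // p _ /=; rewrite !patchE.
  by case: ifP; rewrite ?expr0n.
apply: le_Rintegral => // p _; rewrite !patchE.
case: ifPn => [|_]; last by case: ifP => //; rewrite sqr_ge0.
by rewrite inE => /AB Bp; rewrite mem_set.
Qed.

(** [tr] acts on functions rather than classes; the trace inequality makes it insensitive to null
    functions, whose gradient is null too. *)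
Lemma trace_ae0 A s : measurable_arc A -> A `<=` boundary Om -> sobolev1 Om s ->
  s = cst 0 %[ae mu in Om] -> asq A (tr s) (tr s) = 0.
Proof.
move=> mA AB hs s0; have [C C0 hC] := trace_le.
have b1 := @ae_bounded_cst _ _ R mu Om 1.
have ba := @ae_bounded_cst _ _ R arc A 1.
have ss : sqi mu Om s by exact: sobolev1_sqi.
have e1 : sq s s = 0.
  rewrite (wip_ae mOm b1 ss (sqi0 _ mOm) ss s0) (ip0l (wip_semi_inner mOm b1 _) ss)//.
  by apply: aeW => p _ /=.
have e2 : gform Om (cst 1) s s = 0 by exact: (gform_ae_cst oOm bOm b1 hs s0).
have := hC A s mA AB hs; rewrite e1 e2 addr0 mulr0 => le0.
apply/eqP; rewrite eq_le le0 /=.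
apply: (semi_inner_ge0 (wip_semi_inner mA ba _)); last exact: trace_sqi.
by apply: aeW => p _ /=.
Qed.

(** [u n - k] tends to 0 in H^1, hence so does its trace on [A]. As the trace of [u n] also tends to
    0, that of the constant [k] is null on a set of positive length, where it equals [k]. *)
Lemma trace_limit_cst A (u : nat -> R * R -> R) k : measurable_arc A ->
  A `<=` boundary Om -> (0 < arc A)%E -> (forall n, sobolev1 Om (u n)) ->
  sq (u n - k *: cst 1) (u n - k *: cst 1) @[n --> \oo] --> 0 ->
  gform Om (cst 1) (u n) (u n) @[n --> \oo] --> 0 ->
  asq A (tr (u n)) (tr (u n)) @[n --> \oo] --> 0 -> k = 0.
Proof.
move=> mA AB A0 hu uk gu tu.
have b1 := @ae_bounded_cst _ _ R mu Om 1.
have ba := @ae_bounded_cst _ _ R arc A 1.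
have Hs : semi_inner (sqi mu Om) sq.
  by apply: wip_semi_inner => //; apply: aeW => p _ /=.
have Ha : semi_inner (sqi arc A) (asq A).
  by apply: wip_semi_inner => //; apply: aeW => p _ /=.
have Hg : semi_inner (sobolev1 Om) (gform Om (cst 1)).
  by apply: gform_semi_inner => //; apply: aeW => p _ /=.
have [C C0 hC] := trace_le.
have hk := sobolev1_cst oOm bOm k.
(* The difference is written in the form for which linearity of [tr] is available. *)
pose w n := (-1) *: cst k + u n.
have hw n : sobolev1 Om (w n) by exact: sobolev1P.
have wE n : w n = u n - k *: cst 1.
  apply/funext => p; rewrite /w !fctE /= /GRing.scale /= mulN1r mulr1.
  by rewrite addrC.
have gw n : gform Om (cst 1) (w n) (w n) = gform Om (cst 1) (u n) (u n).
  have z v : sobolev1 Om v -> gform Om (cst 1) (cst k) v = 0.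
    by move=> hv; apply: (gform_ae_cst oOm bOm b1 hk _ hv); exact: aeW.
  have -> : w n = u n - cst k by rewrite /w scaleN1r addrC.
  rewrite (ip_sqB Hg (hu n) hk) (gformC _ _ (u n)) (z _ (hu n)) (z _ hk).
  by rewrite mulr0 subr0 addr0.
pose T := tr (cst k).
have hT : sqi arc A T by exact: trace_sqi.
have ht n : sqi arc A (tr (u n)) by exact: trace_sqi.
have htw n : sqi arc A (tr (w n)) by exact: trace_sqi.
have tw n : asq A (tr (w n)) (tr (w n)) = asq A (tr (u n) - T) (tr (u n) - T).
  have e := trace_lin (-1) AB hk (hu n).
  have h := sub_B Ha (ht n) hT.
  have e' : tr (w n) = tr (u n) - T %[ae arc in A].
    apply: ae_imp e => p hp Ap; rewrite /w hp// !fctE /= scaleN1r addrC.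
    by [].
  by rewrite (wip_ae mA ba (htw n) h (htw n) e') wipC (wip_ae mA ba (htw n) h h e').
have lim0 : asq A (tr (w n)) (tr (w n)) @[n --> \oo] --> 0.
  have cv : C * (sq (w n) (w n) + gform Om (cst 1) (w n) (w n)) @[n --> \oo] --> C * (0 + 0).
    apply: cvgMr; apply: cvgD; last by under eq_fun do rewrite gw.
    by under eq_fun do rewrite wE.
  rewrite addr0 mulr0 in cv.
  apply: (squeeze_cvgr _ (cvg_cst 0) cv); apply: nearW => n.
  by rewrite (semi_inner_ge0 Ha (htw n)) hC.
have TT : asq A T T = 0.
  have cv : 2 * asq A (tr (w n)) (tr (w n)) + 2 * asq A (tr (u n)) (tr (u n))
      @[n --> \oo] --> (2 * 0 + 2 * 0 : R).
    by apply: cvgD; apply: cvgMr.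
  rewrite mulr0 addr0 in cv.
  apply/eqP; rewrite eq_le (semi_inner_ge0 Ha hT) andbT -(cvg_lim _ cv)//.
  apply: limr_ge; first by apply/cvg_ex; eexists; exact: cv.
  apply: nearW => n; rewrite tw.
  have h := sub_B Ha (ht n) hT.
  have -> : T = tr (u n) - (tr (u n) - T) by rewrite opprB addrC subrK.
  have := semi_inner_ge0 Ha (sub_D Ha (ht n) h).
  rewrite (ip_sqB Ha (ht n) h) (ip_sqD Ha (ht n) h).
  have -> : tr (u n) - (tr (u n) - (tr (u n) - T)) = tr (u n) - T.
    by rewrite opprB addrC subrK.
  by move: (asq A _ _) (asq A _ _) (asq A _ _) => x y z; lra.
have T0 : T = cst 0 %[ae arc in A].
  by apply: (wip_eq0 mA ba _ hT TT); apply: aeW => p _ /=.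
have Tk := trace_cst k AB.
apply: contrapT => k0.
have : arc.-negligible A.
  apply: negligibleS (negligibleU T0 Tk) => p Ap /=.
  apply: contrapT => /not_orP[/contrapT h1 /contrapT h2].
  by apply: k0; have := h2 Ap; rewrite -/T (h1 Ap).
move/(negligibleP arc mA) => A00.
by move: A0; rewrite A00 ltxx.
Qed.

End trace.

(** * The operator of the problem *)

Section problem.
Context {R : realType} (D : pb_data R) (tr : (R * R -> R) -> (R * R -> R)).
Hypotheses (hD : admissible D) (htr : trace_operator (dom D) tr).
Local Notation mu := (@lebesgue2 R).
Local Notation arc := (@arclength R).
Local Notation Om := (dom D).
Local Notation h := (coef_h D).
Local Notation c := (coef_c D).
Local Notation sigma := (coef_sigma D).
Local Notation a := (coef_a D).
Local Notation state := ((R * R -> R) * (R * R -> R))%type.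
Local Notation V := (V D tr).
Implicit Types (s v f : R * R -> R) (k : R).

Lemma dom_open : open Om. Proof. by have [[_ + _ _ _] _ _ _] := hD. Qed.
Lemma dom_bounded : bounded_set Om. Proof. by have [[_ _ _ + _] _ _ _] := hD. Qed.
Lemma dom_connected : connected Om. Proof. by have [[_ _ + _ _] _ _ _] := hD. Qed.
Lemma dom_nonempty : Om !=set0. Proof. by have [[+ _ _ _ _] _ _ _] := hD. Qed.
Lemma dom_measurable : measurable (Om : set (measurableTypeR R * measurableTypeR R)).
Proof. exact: open_measurable2 dom_open. Qed.

Let oOm := dom_open.
Let bOm := dom_bounded.
Let cOm := dom_connected.
Let mOm := dom_measurable.

Lemma GD_arc : [/\ GD D `<=` boundary Om, measurable_arc (GD D) &
  GD D !=set0 -> (0 < arc (GD D))%E].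
Proof. by have [_ [+ _ _ _] _ _] := hD; apply; constructor 2. Qed.

Lemma GR_arc : [/\ GR D `<=` boundary Om, measurable_arc (GR D) &
  GR D !=set0 -> (0 < arc (GR D))%E].
Proof. by have [_ [+ _ _ _] _ _] := hD; apply; constructor 3. Qed.

Lemma Gper_boundary : Gper D `<=` boundary Om.
Proof. by have [_ [+ _ _ _] _ _ p] := hD; move=> /(_ (Gper D))[|+ _ _]; [constructor 4|apply]. Qed.

Lemma c_bounded : ae_bounded mu Om c.
Proof. by have [_ _ _ [_ [+ _ _] _ _]] := hD; exact: Linfty_ae_bounded. Qed.
Lemma cV_bounded : ae_bounded mu Om (fun p => (c p)^-1).
Proof. by have [_ _ _ [_ [_ + _] _ _]] := hD; exact: Linfty_ae_bounded. Qed.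
Lemma c_gt0 : \forall p \ae mu, Om p -> 0 < c p.
Proof. by have [_ _ _ [_ [_ _ +] _ _]] := hD. Qed.
Lemma sigma_bounded : ae_bounded mu Om sigma.
Proof. by have [_ _ _ [_ _ [+ _ _] _]] := hD; exact: Linfty_ae_bounded. Qed.
Lemma sigmaV_bounded : ae_bounded mu Om (fun p => (sigma p)^-1).
Proof. by have [_ _ _ [_ _ [_ + _] _]] := hD; exact: Linfty_ae_bounded. Qed.
Lemma sigma_gt0 : \forall p \ae mu, Om p -> 0 < sigma p.
Proof. by have [_ _ _ [_ _ [_ _ +] _]] := hD. Qed.
Lemma h_bounded : ae_bounded mu Om h.
Proof. by have [_ _ _ [+ _ _ _]] := hD; exact: Linfty_ae_bounded. Qed.
Lemma a_gt0 : 0 < a. Proof. by have [_ _ _ [_ _ _ +]] := hD. Qed.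

Local Notation cip := (wip mu Om c).
Local Notation hip := (wip mu Om h).
Local Notation sq := (wip mu Om (cst 1)).

Lemma cip_semi_inner : semi_inner (sqi mu Om) cip.
Proof.
apply: wip_semi_inner => //; first exact: c_bounded.
by apply: ae_imp c_gt0 => p hp Op; rewrite ltW// hp.
Qed.

Lemma ae_lower_bound w : ae_bounded mu Om (fun p => (w p)^-1) ->
  (\forall p \ae mu, Om p -> 0 < w p) ->
  exists2 C : R, 0 < C & \forall p \ae mu, Om p -> 1 <= C * w p.
Proof.
move=> [_ [C hC]] w0; exists (`|C| + 1); first by rewrite ltr_wpDl.
apply: ae_imp2 hC w0 => p h1 h2 Op.
rewrite -ler_pdivrMr ?h2// div1r (le_trans (ler_norm _))// (le_trans (h1 Op))//.
by rewrite (le_trans (ler_norm _))// lerDl.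
Qed.

Lemma ae_boundedZ k w : ae_bounded mu Om w -> ae_bounded mu Om (fun p => k * w p).
Proof.
move=> [mw [C hC]]; split; first exact: measurable_funM.
exists (`|k| * C); apply: ae_imp hC => p hp Op.
by rewrite normrM ler_wpM2l// hp.
Qed.

Lemma wip_scale k w f g : ae_bounded mu Om w -> sqi mu Om f -> sqi mu Om g ->
  wip mu Om (fun p => k * w p) f g = k * wip mu Om w f g.
Proof.
move=> hw hf hg; rewrite /wip -RintegralZl//; last exact: sqi_wmul_integrable.
by apply: eq_Rintegral => p _; rewrite !mulrA.
Qed.

Lemma sq_le_cip : exists2 C : R, 0 < C & forall f, sqi mu Om f -> sq f f <= C * cip f f.
Proof.
have [C C0 hC] := ae_lower_bound cV_bounded c_gt0; exists C => // f hf.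
have hc := c_bounded; rewrite -wip_scale//; apply: wip_le => //.
- exact: ae_bounded_cst.
- exact: ae_boundedZ.
Qed.

Lemma cip_le_sq : exists2 C : R, 0 <= C & forall f, sqi mu Om f -> cip f f <= C * sq f f.
Proof.
have hc := c_bounded; have [_ [C hC]] := hc; exists `|C| => // f hf.
have b1 := @ae_bounded_cst _ _ R mu Om 1.
rewrite -wip_scale//; apply: wip_le => //; first exact: ae_boundedZ.
apply: ae_imp hC => p hp Op; rewrite mulr1 (le_trans (ler_norm _))//.
by rewrite (le_trans (hp Op))// ler_norm.
Qed.

Lemma gform1_le : exists2 C : R, 0 < C & forall s, sobolev1 Om s ->
  gform Om (cst 1) s s <= C * gform Om sigma s s.
Proof.
have [C C0 hC] := ae_lower_bound sigmaV_bounded sigma_gt0; exists C => // s hs.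
have hb := sigma_bounded; have [h1 h2] := grad_sqi oOm hs.
have -> : C * gform Om sigma s s = gform Om (fun p => C * sigma p) s s.
  by rewrite /gform !wip_scale// mulrDr.
apply: gform_le => //.
- exact: ae_bounded_cst.
- exact: ae_boundedZ.
Qed.

Lemma hip_le : exists2 eta : R, 0 < eta &
  forall f, sqi mu Om f -> `|hip f f| <= eta * cip f f.
Proof.
have [C C0 hC] := ae_lower_bound cV_bounded c_gt0.
have hh := h_bounded; have hc := c_bounded; have [_ [M hM]] := hh.
exists ((`|M| + 1) * C) => [|f hf]; first by rewrite mulr_gt0// ltr_wpDl.
have bound : \forall p \ae mu, Om p -> `|h p| <= (`|M| + 1) * C * c p.
  apply: ae_imp2 hM hC => p h1 h2 Op.
  apply: (@le_trans _ _ (`|M| + 1)).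
    by rewrite (le_trans (h1 Op))// (le_trans (ler_norm _))// lerDl.
  by rewrite -mulrA ler_peMr// ?h2// addr_ge0.
rewrite ler_norml -wip_scale//; apply/andP; split; last first.
  apply: wip_le => //; first exact: ae_boundedZ.
  by apply: ae_imp bound => p hp Op; rewrite (le_trans (ler_norm _))// hp.
rewrite lerNl -[- _]mulN1r -wip_scale//; apply: wip_le => //.
- exact: ae_boundedZ.
- exact: ae_boundedZ.
- apply: ae_imp bound => p hp Op; rewrite mulN1r.
  by rewrite (le_trans (ler_norm _))// normrN hp.
Qed.

Lemma hip1 : exists2 g, sqi mu Om g & forall f, sqi mu Om f -> hip f (cst 1) = cip f g.
Proof.
exists (fun p => (c p)^-1 * h p).
  apply: ae_boundedM => //; first exact: cV_bounded.
  by apply: ae_bounded_sqi => //; exact: h_bounded.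
move=> f [mf f2]; have [mc _] := c_bounded; have [mh _] := h_bounded.
have [mcV _] := cV_bounded.
apply: ae_eq_Rintegral => //.
- by apply: measurable_funM; [exact: measurable_funM | exact: measurable_cst].
- by apply: measurable_funM; [exact: measurable_funM | exact: measurable_funM].
- apply: ae_imp c_gt0 => p hp Op /=.
  by have := hp Op => cp; field; rewrite gt_eqF.
Qed.

Lemma cip_pos : 0 < cip (cst 1) (cst 1).
Proof.
have h1 := cst_sqi 1 bOm oOm.
rewrite lt_neqAle (semi_inner_ge0 cip_semi_inner h1) andbT; apply/negP => /eqP/esym E.
have := wip_eq0 mOm c_bounded c_gt0 h1 E => n0.
apply: (open_not_negligible oOm dom_nonempty).
apply: negligibleS n0 => p Op /= h0; have /eqP := h0 Op.
by rewrite oner_eq0.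
Qed.

Definition hform s v := gform Om sigma s v + wip arc (GR D) (cst a) (tr s) (tr v).

Lemma V_sobolev s : V s -> sobolev1 Om s. Proof. by case. Qed.

Lemma V_sqi s : V s -> sqi mu Om s.
Proof. by move=> /V_sobolev/(sobolev1_sqi oOm). Qed.

Lemma Gm_boundary i p : Gm D i p -> boundary Om p /\ boundary Om (p + tau D i).
Proof.
move=> Gp; split; apply: Gper_boundary.
  by exists i => //; left.
exists i => //; right; have [_ _ [_ + _ _ _] _] := hD.
by move=> ->; exists p.
Qed.

Lemma V0 : V 0.
Proof.
have h0 := sobolev1_cst oOm bOm 0.
split => //; first by have [GB _ _] := GD_arc; exact: (trace_cst oOm bOm htr 0 GB).
move=> i.
have e := trace_cst oOm bOm htr 0 (@subset_refl _ (boundary Om)).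
apply: ae_imp2 e (arclength_translate (tau D i) e) => p h1 h2 Gp.
by have [B1 B2] := Gm_boundary Gp; rewrite h1// h2.
Qed.

Lemma V_cst k : ~ controlled D -> V (cst k).
Proof.
move=> nc.
have h0 := sobolev1_cst oOm bOm k.
split => //; first by apply: aeW => p Gp; exfalso; apply: nc; exists p; left.
move=> i.
have e := trace_cst oOm bOm htr k (@subset_refl _ (boundary Om)).
apply: ae_imp2 e (arclength_translate (tau D i) e) => p h1 h2 Gp.
by have [B1 B2] := Gm_boundary Gp; rewrite h1// h2.
Qed.

Lemma VP k s s' : V s -> V s' -> V (k *: s + s').
Proof.
move=> [hs d1 p1] [hs' d2 p2].
have e := trace_lin htr k (@subset_refl _ (boundary Om)) hs hs'.
split; first exact: sobolev1P.
  have [GB _ _] := GD_arc.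
  apply: ae_imp2 (trace_lin htr k GB hs hs') (ae_and d1 d2) => p h1 [h2 h3] Gp.
  by rewrite h1// !fctE /= h2// h3// /GRing.scale /= mulr0 addr0.
move=> i.
apply: ae_imp2 (ae_and e (arclength_translate (tau D i) e)) (ae_and (p1 i) (p2 i)).
move=> p [h1 h2] [h3 h4] Gp; have [B1 B2] := Gm_boundary Gp.
by rewrite h1// h2// !fctE /= h3// h4.
Qed.

Lemma trace_GR s : sobolev1 Om s -> sqi arc (GR D) (tr s).
Proof. by move=> hs; have [B m _] := GR_arc; exact: (trace_sqi htr m B hs). Qed.

Lemma asq_semi_inner : semi_inner (sqi arc (GR D)) (wip arc (GR D) (cst a)).
Proof.
have [_ m _] := GR_arc; apply: wip_semi_inner => //; first exact: ae_bounded_cst.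
by apply: aeW => p _ /=; exact: ltW a_gt0.
Qed.

Lemma sigma_semi_inner : semi_inner (sobolev1 Om) (gform Om sigma).
Proof.
apply: gform_semi_inner => //; first exact: sigma_bounded.
by apply: ae_imp sigma_gt0 => p hp Op; rewrite ltW// hp.
Qed.

Lemma hform_semi_inner : semi_inner V hform.
Proof.
have Hg := sigma_semi_inner; have Ha := asq_semi_inner.
have [B m _] := GR_arc; have ba := @ae_bounded_cst _ _ R arc (GR D) a.
split.
- exact: V0.
- by move=> k s s'; exact: VP.
- move=> k s s' v /V_sobolev hs /V_sobolev hs' /V_sobolev hv.
  have ts := trace_GR hs; have ts' := trace_GR hs'; have tv := trace_GR hv.
  rewrite /hform (semi_innerl Hg)//.
  have hlin : sobolev1 Om (k *: s + s') by exact: sobolev1P.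
  rewrite (wip_ae m ba (trace_GR hlin) (semi_innerP Ha k ts ts') tv (trace_lin htr k B hs hs')).
  by rewrite (semi_innerl Ha)// lin2.
- move=> s v /V_sobolev hs /V_sobolev hv.
  have ts := trace_GR hs; have tv := trace_GR hv.
  by rewrite /hform (semi_innerC Hg)// (semi_innerC Ha).
- move=> s /V_sobolev hs; rewrite /hform addr_ge0//.
    exact: (semi_inner_ge0 Hg).
  exact: (semi_inner_ge0 Ha (trace_GR hs)).
Qed.

Lemma GR_uncontrolled : ~ controlled D -> GR D = set0.
Proof.
by move=> nc; apply/seteqP; split=> // p Gp; apply: nc; exists p; right.
Qed.

(** One half of the description of the null vectors of [hform]; [hform_nondegenerate] is the other.
    When the constants are not controlled, the Robin term is over an empty set. *)
Lemma hform_ae_cst k s v : V s -> V v -> s = cst k %[ae mu in Om] ->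
  (controlled D -> k = 0) -> hform s v = 0.
Proof.
move=> Vs Vv sk ck; have hs := V_sobolev Vs; have hv := V_sobolev Vv.
have g0 : gform Om sigma s v = 0 by exact: (gform_ae_cst oOm bOm sigma_bounded hs sk).
rewrite /hform g0 add0r.
have [ctrl|nc] := pselect (controlled D); last first.
  by rewrite (GR_uncontrolled nc) /wip Rintegral_set0.
have [B m _] := GR_arc.
have s0 : s = cst 0 %[ae mu in Om] by rewrite -(ck ctrl).
have t0 := trace_ae0 oOm bOm htr m B hs s0.
apply: (ip_null asq_semi_inner (trace_GR hs) (trace_GR hv)).
by rewrite (wipZ m a (trace_GR hs) (trace_GR hs)) t0 mulr0.
Qed.

Lemma hform_one : ~ controlled D -> V (cst 1) /\ forall v, V v -> hform (cst 1) v = 0.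
Proof.
move=> nc; split; first exact: V_cst.
move=> v Vv; apply: (@hform_ae_cst 1) => //; first exact: V_cst.
exact: aeW.
Qed.

(** [gradient_closed] yields the constant. In the controlled case it vanishes by [trace_limit_cst]:
    traces are zero on [GD], and [a^-1 * hform] bounds their squares on [GR]. *)
Lemma V_closed (u : nat -> R * R -> R) : (forall n, V (u n)) ->
  (forall eps : R, 0 < eps -> \forall N \near \oo, forall M, (N <= M)%N ->
     cip (u M - u N) (u M - u N) < eps) ->
  hform (u n) (u n) @[n --> \oo] --> 0 ->
  exists k : R, (controlled D -> k = 0) /\
    cip (u n - k *: cst 1) (u n - k *: cst 1) @[n --> \oo] --> 0.
Proof.
move=> Vu cu hu.
have Hc := cip_semi_inner.
have su n : sobolev1 Om (u n) := V_sobolev (Vu n).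
have lu n : sqi mu Om (u n) := V_sqi (Vu n).
have [C1 C10 hC1] := sq_le_cip; have [C2 C20 hC2] := cip_le_sq.
have [C3 C30 hC3] := gform1_le.
have cu' (eps : R) : 0 < eps -> \forall N \near \oo, forall M, (N <= M)%N ->
     sq (u M - u N) (u M - u N) < eps.
  move=> e0; have e1 : 0 < eps / C1 by rewrite divr_gt0.
  apply: filterS (cu _ e1) => N hN M NM.
  apply: (le_lt_trans (hC1 _ (sub_B Hc (lu M) (lu N)))).
  by rewrite mulrC -ltr_pdivlMr// hN.
have Hg := sigma_semi_inner; have Ha := asq_semi_inner.
have gs0 n : 0 <= gform Om sigma (u n) (u n) := semi_inner_ge0 Hg (su n).
have ga0 n : 0 <= wip arc (GR D) (cst a) (tr (u n)) (tr (u n)) :=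
  semi_inner_ge0 Ha (trace_GR (su n)).
have b1 := @ae_bounded_cst _ _ R mu Om 1.
have gu : gform Om (cst 1) (u n) (u n) @[n --> \oo] --> 0.
  have cv : C3 * hform (u n) (u n) @[n --> \oo] --> C3 * 0 by exact: cvgMr.
  rewrite mulr0 in cv.
  apply: (squeeze_cvgr _ (cvg_cst 0) cv); apply: nearW => n; apply/andP; split.
    by apply: gform_ge0 => //; apply: aeW => p _ /=.
  apply: (le_trans (hC3 _ (su n))); apply: ler_wpM2l; first exact: ltW.
  by rewrite lerDl.
have [k uk] := gradient_closed oOm bOm dom_connected su cu' gu.
exists k; split; last first.
  have cv : C2 * sq (u n - k *: cst 1) (u n - k *: cst 1) @[n --> \oo] --> C2 * 0.
    exact: cvgMr.
  rewrite mulr0 in cv; apply: (squeeze_cvgr _ (cvg_cst 0) cv); apply: nearW => n.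
  have hk : sqi mu Om (u n - k *: cst 1).
    by apply: (sub_B Hc) => //; apply: (sub_Z Hc); exact: cst_sqi.
  by rewrite (semi_inner_ge0 Hc hk) hC2.
case=> p0 [Gp|Gp].
  have [B m pos] := GD_arc.
  apply: (trace_limit_cst oOm bOm htr m B (pos _) su uk gu); first by exists p0.
  have ba := @ae_bounded_cst _ _ R arc (GD D) 1.
  have z n : wip arc (GD D) (cst 1) (tr (u n)) (tr (u n)) = 0.
    have [_ d0 _] := Vu n; have ht := trace_sqi htr m B (su n).
    rewrite (wip_ae m ba ht (sqi0 _ m) ht d0).
    apply: (ip0l (wip_semi_inner m ba _) ht).
    by apply: aeW => p _ /=.
  by under eq_fun do rewrite z; exact: cvg_cst.
have [B m pos] := GR_arc.
apply: (trace_limit_cst oOm bOm htr m B (pos _) su uk gu); first by exists p0.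
have cv : a^-1 * hform (u n) (u n) @[n --> \oo] --> a^-1 * 0 by exact: cvgMr.
rewrite mulr0 in cv; apply: (squeeze_cvgr _ (cvg_cst 0) cv); apply: nearW => n.
have ht := trace_GR (su n).
have a0 := a_gt0.
have wa : wip arc (GR D) (cst a) (tr (u n)) (tr (u n)) =
    a * wip arc (GR D) (cst 1) (tr (u n)) (tr (u n)) by exact: wipZ.
apply/andP; split.
  by rewrite -(pmulr_rge0 _ a0) -wa.
by rewrite ler_pdivlMl// -wa lerDr.
Qed.

(** [V_closed] applied to a constant sequence. *)
Lemma hform_nondegenerate s : V s -> hform s s = 0 ->
  exists k : R, (controlled D -> k = 0) /\ s = cst k %[ae mu in Om].
Proof.
move=> Vs s0; have Hc := cip_semi_inner; have ls := V_sqi Vs.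
have [|eps e0||k [ck uk]] := @V_closed (fun=> s) => //.
- apply: nearW => N M _; rewrite subrr (ip0l Hc)//; exact: (semi_inner0 Hc).
- by under eq_fun do rewrite s0; exact: cvg_cst.
exists k; split => //.
have lk : sqi mu Om (k *: cst 1) by apply: (sub_Z Hc); exact: cst_sqi.
have hk := sub_B Hc ls lk.
have E : cip (s - k *: cst 1) (s - k *: cst 1) = 0.
  by have := cvg_unique _ uk (cvg_cst _) => // <-.
have := wip_eq0 mOm c_bounded c_gt0 hk E.
apply: ae_imp => p hp Op; have := hp Op; rewrite !fctE /= => /eqP.
by rewrite subr_eq0 => /eqP ->; rewrite /GRing.scale /= mulr1.
Qed.

Lemma sprodE (x y : state) : HH D tr x -> HH D tr y ->
  sprod D tr x y = cip x.1 y.1 + hform x.2 y.2.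
Proof.
move=> [/(L2P oOm) x1 /V_sobolev x2] [/(L2P oOm) y1 /V_sobolev y2].
have [i e] := wip_vdot oOm sigma_bounded x2 y2.
have ic := sqi_wmul_integrable mOm c_bounded x1 y1.
rewrite /sprod (RintegralD mOm ic i) e /hform.
exact: esym (addrA _ _ _).
Qed.

Lemma HHE (x : state) : HH D tr x <-> pair_space (sqi mu Om) V x.
Proof. by split=> -[/(L2P oOm) ? ?]; split => //; exact/(L2P oOm). Qed.

End problem.

(** * Eigenvectors in weak form *)

Section weak_form.
Context {R : realType} (D : pb_data R) (tr : (R * R -> R) -> (R * R -> R)).
Hypotheses (hD : admissible D) (htr : trace_operator (dom D) tr).
Local Notation mu := (@lebesgue2 R).
Local Notation arc := (@arclength R).
Local Notation Om := (dom D).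
Local Notation h := (coef_h D).
Local Notation c := (coef_c D).
Local Notation sigma := (coef_sigma D).
Local Notation a := (coef_a D).
Local Notation state := ((R * R -> R) * (R * R -> R))%type.
Local Notation V := (V D tr).
Local Notation cip := (wip mu Om c).
Local Notation hip := (wip mu Om h).
Local Notation sq := (wip mu Om (cst 1)).
Local Notation hform := (hform D tr).
Local Notation HS := (pair_space (sqi mu Om) V).
Local Notation ip := (pair_ip cip hform).
Local Notation relA := (pencil_rel (sqi mu Om) V cip hip hform).
Implicit Types (s v f : R * R -> R) (k : R) (x y z : state).

Let oOm := dom_open hD.
Let bOm := dom_bounded hD.
Let mOm := dom_measurable hD.

Let Hc := cip_semi_inner hD.
Let Hv := hform_semi_inner hD htr.
Let H : semi_inner HS ip := pair_semi_inner Hc Hv.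
Let b1 := @ae_bounded_cst _ _ R mu Om 1.

Lemma sq_test d v : \int[mu]_(p in Om) (d p * v p) = sq d v.
Proof. by apply: eq_Rintegral => p _; rewrite /= mul1r. Qed.

Lemma divergence_sqi F : has_div D F -> sqi mu Om (divg Om F).
Proof.
move=> [d hd]; apply/(L2P oOm).
have : weak_divergence Om F (divg Om F).
  by apply: (xgetPex _ (P := weak_divergence Om F)); exists d.
by case.
Qed.

Lemma flux_weak s v : V s -> has_div D (flux D s) -> flux_conditions D tr s -> V v ->
  hform s v = - sq (divg Om (flux D s)) v.
Proof.
move=> Vs hd hf Vv; have := hf v Vv; rewrite /normal_trace.
have sd := divergence_sqi hd; have sv := V_sqi hD Vv.
have [i e] := wip_vdot oOm (sigma_bounded hD) (V_sobolev Vs) (V_sobolev Vv).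
have vE p : vdot (flux D s) (grad Om v) p = sigma p * vdot (grad Om s) (grad Om v) p.
  by rewrite /vdot /flux /vscale /= !fctE mulrDr !mulrA.
have i' : mu.-integrable Om (EFin \o vdot (flux D s) (grad Om v)).
  by apply: eq_integrable i => // p _ /=; rewrite vE.
rewrite (RintegralD mOm i' (sqi_mul_integrable mOm sd sv)) sq_test.
have -> : \int[mu]_(p in Om) vdot (flux D s) (grad Om v) p = gform Om sigma s v.
  rewrite -[RHS]e; apply: eq_Rintegral => p _; exact: vE.
rewrite /hform -/(wip arc (GR D) (cst a) (tr s) (tr v)).
by move: (gform _ _ _ _) (wip _ _ _ _ _) (wip _ _ _ _ _) => A B C; lra.
Qed.

Let hc := c_bounded hD.
Let hh := h_bounded hD.

Lemma relA_eigvec (l : R) (u : R * R -> R) : l != 0 ->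
  domA D tr (u, l^-1 *: u) ->
  eqHH D (opA D (u, l^-1 *: u)) (l *: ((u, l^-1 *: u) : state)) ->
  relA (u, l^-1 *: u) (l *: ((u, l^-1 *: u) : state)).
Proof.
move=> l0 [hx Vu hd hf] [e _].
have hz : HS (u, l^-1 *: u) := (HHE tr hD _).1 hx.
have su := hz.1; have Vs := hz.2.
split=> //; first exact: (sub_Z H).
- move=> v Vv; rewrite (flux_weak Vs hd hf Vv).
  have sd := divergence_sqi hd; have sv := V_sqi hD Vv.
  rewrite /= (ipZl Hc)//.
  set d := divg Om _ in sd e *.
  have [md _] := sd; have [mu' _] := su; have [mv _] := sv.
  have [mc _] := hc; have [mh _] := hh.
  have ic := sqi_wmul_integrable mOm hc su sv.
  have ih := sqi_wmul_integrable mOm hh su sv.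
  have icl := integrableZl mOm l ic.
  have -> : sq d v = hip u v - l * cip u v.
    rewrite /wip -RintegralZl// -RintegralB//.
    apply: ae_eq_Rintegral => //.
    + by apply: measurable_funM => //; apply: measurable_funM => //; exact: measurable_cst.
    + apply: measurable_funB; first by do 2 apply: measurable_funM => //.
      by apply: measurable_funM; [exact: measurable_cst | do 2 apply: measurable_funM => //].
    + apply: ae_imp2 e (c_gt0 hD) => p hp cp Op.
      have c0 := cp Op; have := hp Op; rewrite /= !fctE /GRing.scale /= -/d => E.
      (* The eigenvalue equation holds in the unweighted form; multiplying by [c] solves it for the
         divergence. *)
      have : c p * ((c p)^-1 * h p * u p - (c p)^-1 * d p) = c p * (l * u p) by rewrite E.
      rewrite mulrBr !mulrA divff ?gt_eqF// !mul1r => E'.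
      have -> : d p = h p * u p - c p * l * u p by rewrite -E'; ring.
      by ring.
  by rewrite opprB.
- by move=> v Vv; rewrite /= scalerA divff// scale1r.
Qed.

(** The first component of A phi_0 vanishes since the divergence is [h]; its second component is the
    constant 1, which is null for [hform] in the balanced case. *)
Lemma relA_kervec s0 : balanced D -> is_Delta_inv D tr h s0 ->
  relA (kervec s0) (0 *: (kervec s0 : state)).
Proof.
move=> [nc _] [Vs wd hf].
have s1 := cst_sqi 1 bOm oOm.
have hz : HS (kervec s0) by split.
have [V1 h1] := hform_one hD htr nc.
have hd : has_div D (flux D s0) by exists h.
have sh : sqi mu Om h by exact: ae_bounded_sqi.
have sd := divergence_sqi hd.
split=> //; first exact: (sub_Z H).
- move=> v Vv; rewrite (flux_weak Vs hd hf Vv) /=.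
  have sv := V_sqi hD Vv.
  rewrite (ipZl Hc)// mul0r sub0r; congr (- _).
  (* [divg] is a choice among weak divergences, equal to [h] only almost everywhere. *)
  have dh : divg Om (flux D s0) = h %[ae mu in Om].
    have wd' : weak_divergence Om (flux D s0) (divg Om (flux D s0)).
      by apply: (xgetPex _ (P := weak_divergence Om (flux D s0))); exists h.
    have sdh : sqi mu Om (divg Om (flux D s0) - h).
      by apply: (sub_B Hc).
    have : divg Om (flux D s0) - h = cst 0 %[ae mu in Om].
      apply: (sqi_ae0 oOm bOm sdh) => phi tphi.
      have sp := continuous_sqi oOm bOm (test_continuous tphi).
      rewrite sq_test.
      have Hs : semi_inner (sqi mu Om) sq.
        by apply: wip_semi_inner => //; apply: aeW => p _ /=.
      rewrite (ipBl Hs)// -!sq_test; apply/eqP; rewrite subr_eq0; apply/eqP.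
      have [_ /(_ _ tphi) e1] := wd'; have [_ /(_ _ tphi) e2] := wd.
      by apply: oppr_inj; rewrite -e1 -e2.
    apply: ae_imp => p hp Op; have := hp Op; rewrite !fctE /= => /eqP.
    by rewrite subr_eq0 => /eqP.
  rewrite (wip_ae mOm b1 sd sh sv dh).
  by apply: eq_Rintegral => p _; rewrite /= mul1r mulr1.
- by move=> v Vv; rewrite /= scale0r (ip0l Hv)// h1.
Qed.

(** Symmetry of A read on the weak form. It provides the orthogonality of the kernel vector to the
    other modes, which [eigenbasis] does not state. *)
Lemma relA_sym z y z' y' : relA z y -> relA z' y' -> ip y z' = ip y' z.
Proof.
move=> [[z1 z2] [y1 y2] Vz A1 A2] [[z1' z2'] [y1' y2'] Vz' A1' A2'].
rewrite /pair_ip A2// A2'//.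
rewrite (semi_innerC Hv Vz z2') (semi_innerC Hv Vz' z2) A1'// A1//.
rewrite (wipC mu Om h z'.1 z.1).
by move: (wip _ _ _ _ _) (wip _ _ _ _ _) (wip _ _ _ _ _) => A B C; ring.
Qed.

Lemma null_eqHH x y : HS x -> HS y -> ip (x - y) (x - y) = 0 -> eqHH D x y.
Proof.
move=> hx hy xy0; have [d1 d2] := sub_B H hx hy.
have c0 := semi_inner_ge0 Hc d1; have v0 := semi_inner_ge0 Hv d2.
have c1 : cip (x - y).1 (x - y).1 = 0.
  by apply/eqP; rewrite eq_le c0 andbT -xy0 lerDl.
have v1 : hform (x - y).2 (x - y).2 = 0.
  by apply/eqP; rewrite eq_le v0 andbT -xy0 lerDr.
split.
  have := wip_eq0 mOm hc (c_gt0 hD) d1 c1.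
  apply: ae_imp => p hp Op; have := hp Op; rewrite !fctE /= => /eqP.
  by rewrite subr_eq0 => /eqP.
have [k [ck sk]] := hform_nondegenerate hD htr d2 v1.
exists k => //; apply: ae_imp sk => p hp Op; have := hp Op.
by rewrite /= !fctE /= => <-; rewrite subrKC.
Qed.

Lemma eqHH_null x y : HS x -> HS y -> eqHH D x y -> ip (x - y) (x - y) = 0.
Proof.
move=> hx hy [e1 [k ck e2]]; have [d1 d2] := sub_B H hx hy.
have c1 : cip (x - y).1 (x - y).1 = 0.
  have z : (x - y).1 = cst 0 %[ae mu in Om].
    by apply: ae_imp e1 => p hp Op; rewrite /= !fctE /= hp// subrr.
  by rewrite (wip_ae mOm hc d1 (semi_inner0 Hc) d1 z) (ip0l Hc).
rewrite /pair_ip c1 add0r; apply: (hform_ae_cst hD htr d2 d2 _ ck).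
by apply: ae_imp e2 => p hp Op; rewrite /= !fctE /= hp// addrC addKr.
Qed.

End weak_form.

(** * The spectral family *)

Section spectral.
Context {R : realType} (D : pb_data R) (tr : (R * R -> R) -> (R * R -> R)).
Variables (lam : int -> R) (U : int -> R * R -> R) (s0 : R * R -> R).
Hypotheses (hD : admissible D) (htr : trace_operator (dom D) tr).
Hypothesis hbasis : eigenbasis D tr lam U s0.
Local Notation mu := (@lebesgue2 R).
Local Notation Om := (dom D).
Local Notation state := ((R * R -> R) * (R * R -> R))%type.
Local Notation V := (V D tr).
Local Notation cip := (wip mu Om (coef_c D)).
Local Notation hip := (wip mu Om (coef_h D)).
Local Notation hform := (hform D tr).
Local Notation HS := (pair_space (sqi mu Om) V).
Local Notation ip := (pair_ip cip hform).
Local Notation relA := (pencil_rel (sqi mu Om) V cip hip hform).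
Implicit Types (x y z psi : state) (n : nat) (i : int).

Let oOm := dom_open hD.
Let bOm := dom_bounded hD.
Let mOm := dom_measurable hD.
Let Hc := cip_semi_inner hD.
Let Hv := hform_semi_inner hD htr.
Let H : semi_inner HS ip := pair_semi_inner Hc Hv.
Let s1 := cst_sqi 1 bOm oOm.
Let VL : V `<=` sqi mu Om := fun s Vs => V_sqi hD Vs.

Let sprod_ip x y : HS x -> HS y -> sprod D tr x y = ip x y.
Proof. by move=> hx hy; rewrite (sprodE hD)//; exact/(HHE tr hD). Qed.

Let hnorm_lt x (eps : R) : 0 < eps -> HS x -> hnorm D tr x < eps -> ip x x < eps ^+ 2.
Proof.
move=> e0 hx; rewrite /hnorm sprod_ip// => lt.
have x0 := semi_inner_ge0 H hx.
by rewrite -(sqr_sqrtr x0) ltr_pXn2r// ?nnegrE ?sqrtr_ge0// ltW.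
Qed.

(** The index 0, free among the nonzero eigenvalues, carries the kernel; outside the balanced case
    it carries the zero vector, which the theory of orthogonal families tolerates. *)
Definition mode i : state :=
  if i == 0 then (if `[< balanced D >] then kervec s0 else 0) else eigvec lam U i.
Definition mode_val i : R := if i == 0 then 0 else lam i.

(* Indices which code no integer give 0. *)
Definition nmode n : state := if pickle_inv n is Some i then mode i else 0.
Definition nval n : R := if pickle_inv n is Some i then mode_val i else 0.

Let lam_neq0 i : i != 0 -> lam i != 0.
Proof.
have [[pos neg _ _ _] _ _ _ _] := hbasis.
case: (ltrgtP i 0) => // [/neg h|/pos h] _; first by rewrite lt_eqF.
by rewrite gt_eqF.
Qed.

Let relA0 : relA 0 (0 *: 0).
Proof.
rewrite scaler0; apply: (pencil_rel0 Hc Hv VL).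
by move=> k x y z hx hy hz; exact: wip_linear (h_bounded hD) hx hy hz.
Qed.

Let relA_mode i : relA (mode i) (mode_val i *: mode i).
Proof.
rewrite /mode /mode_val; have [_|i0] := eqVneq i 0.
  case: asboolP => bal; last exact: relA0.
  have [_ _ _ h _] := hbasis.
  exact: (relA_kervec hD htr bal (h bal)).
have [_ /(_ _ i0)[h1 _ h2] _ _ _] := hbasis.
exact: (relA_eigvec hD htr (lam_neq0 i0) h1 h2).
Qed.

Lemma relA_nmode n : relA (nmode n) (nval n *: nmode n).
Proof. by rewrite /nmode /nval; case: pickle_inv => [i|]; [exact: relA_mode|exact: relA0]. Qed.

Let Hn n : HS (nmode n). Proof. by have [] := relA_nmode n. Qed.
Let Hm i : HS (mode i). Proof. by have [] := relA_mode i. Qed.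

Let mode_orth i j : i != j -> ip (mode i) (mode j) = 0.
Proof.
move=> ij.
have [li|li] := eqVneq (mode_val i) (mode_val j); last first.
  have := relA_sym hD htr (relA_mode i) (relA_mode j).
  rewrite (ipZl H)// (ipZl H)// (semi_innerC H (Hm j) (Hm i)) => /eqP.
  by rewrite -subr_eq0 -mulrBl mulf_eq0 subr_eq0 (negbTE li) /= => /eqP.
move: li; rewrite /mode_val; have [i0|i0] := eqVneq i 0; have [j0|j0] := eqVneq j 0.
- by move: ij; rewrite i0 j0 eqxx.
- by move/esym/eqP; rewrite (negbTE (lam_neq0 j0)).
- by move/eqP; rewrite (negbTE (lam_neq0 i0)).
move=> _; have [_ _ o _ _] := hbasis.
rewrite -(sprod_ip (Hm i) (Hm j)) /mode (negbTE i0) (negbTE j0).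
exact: o.
Qed.

Let pickle_of n i : @pickle_inv int n = Some i -> pickle i = n.
Proof. by move=> h; have := @pickle_invK int n; rewrite h /=; apply. Qed.

Lemma nmode_orth n m : n != m -> ip (nmode n) (nmode m) = 0.
Proof.
move=> nm; have h0 := semi_inner0 H; have := Hn m; have := Hn n; rewrite /nmode.
case En : pickle_inv => [i|] hi; last by move=> hm; rewrite (ip0l H).
case Em : pickle_inv => [j|] hj; last by rewrite (ip0r H).
apply: mode_orth; apply: contra nm => /eqP ij.
by rewrite -(pickle_of En) -(pickle_of Em) ij.
Qed.

Lemma nmode_pickle i : nmode (pickle i) = mode i.
Proof. by rewrite /nmode pickleK_inv. Qed.

Lemma nval_pickle i : nval (pickle i) = mode_val i.
Proof. by rewrite /nval pickleK_inv. Qed.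

Lemma nmode_total x : HS x -> forall eps : R, 0 < eps ->
  exists n (k : 'I_n -> R) (j : 'I_n -> nat),
    let z := x - \sum_m k m *: nmode (j m) in ip z z < eps.
Proof.
move=> hx eps e0.
have [_ _ _ _ /(_ x ((HHE tr hD x).2 hx))[_ tot]] := hbasis.
have se0 : 0 < Num.sqrt eps by rewrite sqrtr_gt0.
have [n [k [y [Sy lt]]]] := tot _ se0.
have /choice[j hj] m : exists q, y m = nmode q.
  case: (Sy m) => [[i i0 ->]|[bal ->]].
    by exists (pickle i); rewrite nmode_pickle /mode (negbTE i0).
  exists (pickle (0 : int)); rewrite nmode_pickle /mode eqxx.
  by case: asboolP.
exists n, k, j => /=.
have E : lin_comb k y = \sum_m k m *: nmode (j m).
  by apply: eq_bigr => m _; rewrite hj.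
have hz : HS (x - \sum_m k m *: nmode (j m)).
  apply: (sub_B H) => //; apply: (sub_sum H) => m; exact: (sub_Z H).
rewrite -[ltRHS](sqr_sqrtr (ltW e0)); apply: (hnorm_lt se0 hz).
by rewrite -E.
Qed.

Lemma closed_span_orth (S : set state) z x : HS z -> (forall y, S y -> HS y) ->
  (forall y, S y -> ip z y = 0) -> closed_span D tr S x -> ip z x = 0.
Proof.
move=> hz SH zS [/(HHE tr hD) hx apx].
have zz := semi_inner_ge0 H hz.
have small (e : R) : 0 < e -> ip z x ^+ 2 <= ip z z * e ^+ 2.
  move=> e0; have [n [k [y [Sy lt]]]] := apx _ e0.
  have hy m : HS (y m) by exact: SH.
  have hl : HS (lin_comb k y) by apply: (sub_sum H) => m; exact: (sub_Z H).
  have hxl := sub_B H hx hl.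
  have {}lt := hnorm_lt e0 hxl lt.
  have -> : ip z x = ip z (x - lin_comb k y).
    rewrite (ipBr H)// (semi_innerC H hz hl) (ip_suml H)//; last first.
      by move=> m; exact: (sub_Z H).
    rewrite big1 ?subr0// => m _.
    by rewrite (ipZl H)// (semi_innerC H (hy m) hz) zS ?mulr0.
  apply: (le_trans (cauchy_schwarz H hz hxl)).
  by apply: ler_wpM2l => //; exact: ltW.
apply/eqP; rewrite -sqrf_eq0 eq_le sqr_ge0 andbT.
apply/ler_addgt0Pr => e e0; rewrite add0r.
have d0 : 0 < ip z z + 1 by rewrite ltr_wpDl.
(* With this tolerance the bound becomes [ip z z * (e / (ip z z + 1)) <= e], also when [z] is
   null. *)
have q0 : 0 < Num.sqrt (e / (ip z z + 1)) by rewrite sqrtr_gt0 divr_gt0.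
apply: (le_trans (small _ q0)).
rewrite sqr_sqrtr ?divr_ge0 ?(ltW e0) ?(ltW d0)//.
rewrite mulrCA ger_pMr// ler_pdivrMr// mul1r lerDl.
by [].
Qed.

Lemma closed_span_gen (S : set state) y : (forall x, S x -> HS x) -> S y ->
  closed_span D tr S y.
Proof.
move=> SH Sy; split; first exact/(HHE tr hD)/SH.
move=> eps e0; exists 1%N, (fun=> 1), (fun=> y); split => //.
have -> : y - @lin_comb R 1 (fun=> 1) (fun=> y) = 0.
  by rewrite /lin_comb big_ord1 scale1r subrr.
have h0 := semi_inner0 H.
by rewrite /hnorm sprod_ip// (ip0l H)// sqrtr0.
Qed.

Let Spos : set state := [set eigvec lam U i | i in [set i : int | 0 < i]].
Let Sneg : set state := [set eigvec lam U i | i in [set i : int | i < 0]].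

Let eig_mode i : i != 0 -> eigvec lam U i = mode i.
Proof. by move=> i0; rewrite /mode (negbTE i0). Qed.

Let SposH y : Spos y -> HS y.
Proof. by move=> [i /= i0 <-]; rewrite eig_mode ?gt_eqF. Qed.

Let SnegH y : Sneg y -> HS y.
Proof. by move=> [i /= i0 <-]; rewrite eig_mode ?lt_eqF. Qed.

Let nmode_nval n : nmode n = 0 \/ exists2 i, nmode n = mode i & nval n = mode_val i.
Proof.
by rewrite /nmode /nval; case: pickle_inv => [i|]; [right; exists i | left].
Qed.

Let nval_pos n : 0 < nval n -> Spos (nmode n).
Proof.
rewrite /nmode /nval; case: pickle_inv => [i|]; rewrite ?ltxx// /mode_val.
have [_|i0] := eqVneq i 0; rewrite ?ltxx// => l0; exists i; last exact: eig_mode.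
have [[_ neg _ _ _] _ _ _ _] := hbasis.
rewrite /= lt_neqAle eq_sym i0 leNgt; apply/negP => /neg h.
by have := lt_trans l0 h; rewrite ltxx.
Qed.

Let nval_neg n : nval n < 0 -> Sneg (nmode n).
Proof.
rewrite /nmode /nval; case: pickle_inv => [i|]; rewrite ?ltxx// /mode_val.
have [_|i0] := eqVneq i 0; rewrite ?ltxx// => l0; exists i; last exact: eig_mode.
have [[pos _ _ _ _] _ _ _ _] := hbasis.
rewrite /= lt_neqAle i0 leNgt; apply/negP => /pos h.
by have := lt_trans l0 h; rewrite ltxx.
Qed.

Let pos_nval y n : Spos y -> nval n <= 0 -> ip y (nmode n) = 0.
Proof.
move=> [i /= i0 <-] ln; have h0 : i != 0 by rewrite gt_eqF.
have [[pos _ _ _ _] _ _ _ _] := hbasis.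
case: (nmode_nval n) => [->|[j -> lj]].
  by rewrite (ip0r H)// eig_mode.
rewrite eig_mode//; apply: mode_orth; apply/eqP => ij.
by move: ln; rewrite lj -ij /mode_val (negbTE h0) leNgt pos.
Qed.

Let neg_nval y n : Sneg y -> 0 <= nval n -> ip y (nmode n) = 0.
Proof.
move=> [i /= i0 <-] ln; have h0 : i != 0 by rewrite lt_eqF.
have [[_ neg _ _ _] _ _ _ _] := hbasis.
case: (nmode_nval n) => [->|[j -> lj]].
  by rewrite (ip0r H)// eig_mode.
rewrite eig_mode//; apply: mode_orth; apply/eqP => ij.
by move: ln; rewrite lj -ij /mode_val (negbTE h0) leNgt neg.
Qed.

Lemma nval_gap : exists2 delta : R, 0 < delta &
  forall n, (0 < nval n -> delta <= nval n) /\ (nval n < 0 -> nval n <= - delta).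
Proof.
have [[pos neg nd _ _] _ _ _ _] := hbasis.
exists (Num.min (lam 1) (- lam (-1))).
  by rewrite lt_min pos//= oppr_gt0 neg.
move=> n; rewrite /nval; case: pickle_inv => [i|]; rewrite ?ltxx//.
rewrite /mode_val; have [_|i0] := eqVneq i 0; rewrite ?ltxx//.
split=> l0.
  rewrite ge_min nd// -gtz0_ge1 lt_neqAle eq_sym i0 leNgt.
  by apply/negP => /neg h; have := lt_trans l0 h; rewrite ltxx.
rewrite lerNr ge_min lerN2 nd ?orbT// -ltzD1 addNr lt_neqAle i0 leNgt.
by apply/negP => /pos h; have := lt_trans l0 h; rewrite ltxx.
Qed.

(** * The operator B_- and the three cases *)

Section solutions.
Variables (pip pim T : state -> state).
Hypothesis hpip : orth_proj D tr (pos_space D tr lam U) pip.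
Hypothesis hpim : orth_proj D tr (neg_space D tr lam U) pim.
Hypothesis hT : bounded_inverse_on D tr (proj_range D tr pim)
            (fun x => pim (opP (pim x))) T.

Local Notation B := (opB pim T).
Implicit Types (phi : state).

(** The range of pi_- described by orthogonality to the other modes, which avoids handling closed
    spans; [range_free] and [free_range] give the equivalence. *)
Definition nonpos_free x := HS x /\ forall n, 0 <= nval n -> ip x (nmode n) = 0.

Let pim_free x : HS x -> nonpos_free (pim x).
Proof.
move=> hx; have [hS _] := hpim ((HHE tr hD x).2 hx).
have hpx : HS (pim x) by have [/(HHE tr hD)] := hS.
split=> // n ln; rewrite (semi_innerC H hpx (Hn n)).
apply: (closed_span_orth (Hn n) SnegH _ hS) => y Sy.
by rewrite (semi_innerC H (Hn n) (SnegH Sy)) neg_nval.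
Qed.

Let pim_orth_neg x n : HS x -> nval n < 0 -> ip (x - pim x) (nmode n) = 0.
Proof.
move=> hx ln; have [hpx _] := pim_free hx.
have [_ orth] := hpim ((HHE tr hD x).2 hx).
rewrite -(sprod_ip (sub_B H hx hpx) (Hn n)); apply: orth.
by apply: (closed_span_gen SnegH); exact: nval_neg.
Qed.

(** Each mode is orthogonal to one of the two vectors: negative modes to [x - pim x], the others to
    [y]. *)
Let pim_orth x y : HS x -> nonpos_free y -> ip (x - pim x) y = 0.
Proof.
move=> hx [hy y0]; have [hpx _] := pim_free hx.
apply: (orth_complement H Hn nmode_orth nmode_total (sub_B H hx hpx) hy) => n.
by have [ln|ln] := ltP (nval n) 0; [left; exact: pim_orth_neg | right; exact: y0].
Qed.

Let pim_ip x y : HS x -> nonpos_free y -> ip (pim x) y = ip x y.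
Proof.
move=> hx hy; have [hpx _] := pim_free hx; have := pim_orth hx hy.
by rewrite (ipBl H hx hpx hy.1) => /eqP; rewrite subr_eq0 => /eqP.
Qed.

Let free_sub x y : nonpos_free x -> nonpos_free y -> nonpos_free (x - y).
Proof.
move=> [hx x0] [hy y0]; split; first exact: (sub_B H).
by move=> n ln; rewrite (ipBl H hx hy (Hn n)) x0// y0// subrr.
Qed.

Let pim_null x : nonpos_free x -> ip (x - pim x) (x - pim x) = 0.
Proof.
move=> fx; have [hx _] := fx; apply: pim_orth => //.
by apply: free_sub => //; exact: pim_free.
Qed.

Let ip_null_eq x y z : HS x -> HS y -> HS z -> ip (x - y) (x - y) = 0 -> ip x z = ip y z.
Proof.
move=> hx hy hz xy0; have := ip_null H (sub_B H hx hy) hz xy0.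
by rewrite (ipBl H hx hy hz) => /eqP; rewrite subr_eq0 => /eqP.
Qed.

Let eqHH_ip x y z : HS x -> HS y -> HS z -> eqHH D x y -> ip x z = ip y z.
Proof. by move=> hx hy hz xy; apply: ip_null_eq => //; exact: (eqHH_null hD htr). Qed.

Let range_free x : proj_range D tr pim x -> nonpos_free x.
Proof.
move=> [/(HHE tr hD) hx [y /(HHE tr hD) hy xy]]; split => // n ln.
have [hpy p0] := pim_free hy.
by rewrite (eqHH_ip hx hpy (Hn n) xy) p0.
Qed.

Let eqHH_refl x : eqHH D x x.
Proof.
split; first exact: aeW.
by exists 0 => //; apply: aeW => p _ /=; rewrite addr0.
Qed.

Let range_pim x : HS x -> proj_range D tr pim (pim x).
Proof.
move=> hx; have [hpx _] := pim_free hx; split; first exact/(HHE tr hD).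
by exists x; [exact/(HHE tr hD) | exact: eqHH_refl].
Qed.

Let free_range x : nonpos_free x -> proj_range D tr pim x.
Proof.
move=> fx; have [hx _] := fx; have [hpx _] := pim_free hx.
split; first exact/(HHE tr hD).
exists x; first exact/(HHE tr hD).
by apply: (null_eqHH hD htr) => //; exact: pim_null.
Qed.

Let opP_HS x : HS x -> HS (opP x).
Proof. by move=> [x1 _]; split => //; exact: (semi_inner0 Hv). Qed.

Let opP_ip x y : HS x -> HS y -> ip (opP x) y = cip x.1 y.1.
Proof. by move=> [x1 _] [y1 y2]; rewrite /pair_ip /= (ip0l Hv)// addr0. Qed.

Let opB_free x : HS x -> nonpos_free (B x).
Proof.
move=> hx; apply: pim_free; have [rT _ _ _] := hT.
exact: (range_free (rT _ (range_pim hx))).1.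
Qed.

(** The identity pi_- P B_- = pi_-, tested against the range of pi_-. *)
Let opB_ip x y : HS x -> nonpos_free y -> ip (opP (B x)) y = ip x y.
Proof.
move=> hx fy; have [rT MT _ _] := hT; have [hy _] := fy.
have rx := range_pim hx; have [hpx _] := pim_free hx.
have [hB _] := opB_free hx.
rewrite -(pim_ip (opP_HS hB) fy) -(pim_ip hx fy).
apply: eqHH_ip => //; last exact: MT rx.
by have [] := pim_free (opP_HS hB).
Qed.

(** By [opB_ip] both sides equal [cip (B x).1 (B y).1], so no symmetry of [T] is called for. *)
Let opB_sym x y : HS x -> HS y -> ip (B x) y = ip x (B y).
Proof.
move=> hx hy; have fx := opB_free hx; have fy := opB_free hy.
have [hBx _] := fx; have [hBy _] := fy.
rewrite (semi_innerC H hBx hy) -(opB_ip hy fx) (opP_ip hBy hBx).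
rewrite -(opB_ip hx fy) (opP_ip hBx hBy).
by rewrite (semi_innerC Hc hBy.1 hBx.1).
Qed.

(** P is injective on the range of pi_-: if [d.1] is null, so is [Md], the bound on [T] makes [T Md]
    null, and [T Md] is [d] up to a null state. The bound replaces the linearity of [T]. *)
Let free_uniq d : nonpos_free d -> cip d.1 d.1 = 0 -> ip d d = 0.
Proof.
move=> fd d0; have [hd _] := fd; have [hpd _] := pim_free hd.
have [rT _ TM [C hC]] := hT; have rd := free_range fd.
pose Md := pim (opP (pim d)).
have hP := opP_HS hpd; have fM := pim_free hP; have [hM _] := fM.
have P0 : ip (opP (pim d)) (opP (pim d)) = 0.
  rewrite (opP_ip hpd hP) /=.
  have n0 := pim_null fd.
  have [d1 d2] := hd; have [p1 p2] := hpd.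
  have c0 : cip (d - pim d).1 (d - pim d).1 = 0.
    have := semi_inner_ge0 Hc (sub_B Hc d1 p1); have := semi_inner_ge0 Hv (sub_B Hv d2 p2).
    move: n0; rewrite /pair_ip /=; move: (cip _ _) (hform _ _) => r s; lra.
  have -> : (pim d).1 = d.1 - (d.1 - (pim d).1) by rewrite opprB addrC subrK.
  have h1 := sub_B Hc d1 p1.
  rewrite (ip_sqB Hc d1 h1) d0 (ip_null Hc d1 h1 d0).
  by rewrite [X in _ + X]c0 mulr0 subr0 addr0.
have M0 : ip Md Md = 0.
  by rewrite (pim_ip hP fM) (ip_null H hP hM P0).
have rM : proj_range D tr pim Md by exact: range_pim.
have hTM := (range_free (rT _ rM)).1.
have TM0 : ip (T Md) (T Md) = 0.
  have := hC _ rM; rewrite /hnorm (sprod_ip hTM hTM) (sprod_ip hM hM) M0 sqrtr0 mulr0.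
  rewrite leNgt sqrtr_gt0 -leNgt => le0; apply/eqP; rewrite eq_le le0.
  exact: (semi_inner_ge0 H hTM).
have e := TM _ rd; rewrite -/Md in e.
rewrite -(eqHH_ip hTM hd hd e); exact: (ip_null H hTM hd TM0).
Qed.

Let pip_HS x : HS x -> HS (pip x).
Proof. by move=> hx; have [[/(HHE tr hD)]] := hpip ((HHE tr hD x).2 hx). Qed.

Lemma solutionP phi psi : HS phi -> solution D tr pip phi psi <->
  [/\ HS psi, cip (psi.1 - phi.1) (psi.1 - phi.1) = 0 &
      forall n, 0 < nval n -> ip psi (nmode n) = 0].
Proof.
move=> hphi; split.
  move=> [/(HHE tr hD) hpsi [e1 _] e2]; split => //.
    have [h1 _] := hphi; have [h2 _] := hpsi; have h3 := sub_B Hc h2 h1.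
    have z : psi.1 - phi.1 = cst 0 %[ae mu in Om].
      by apply: ae_imp e1 => p hp Op; have := hp Op; rewrite /= !fctE /= => ->; rewrite subrr.
    by rewrite (wip_ae mOm (c_bounded hD) h3 (semi_inner0 Hc) h3 z) (ip0l Hc).
  move=> n ln; have hp := pip_HS hpsi.
  have [_ /(_ (nmode n)) o] := hpip ((HHE tr hD psi).2 hpsi).
  have := o (closed_span_gen SposH (nval_pos ln)).
  rewrite (sprod_ip (sub_B H hpsi hp) (Hn n)) (ipBl H hpsi hp (Hn n)).
  by rewrite (eqHH_ip hp (semi_inner0 H) (Hn n) e2) (ip0l H)// subr0.
move=> [hpsi c0 o]; have hp := pip_HS hpsi; split.
- exact/(HHE tr hD).
- apply: (null_eqHH hD htr (opP_HS hpsi) (opP_HS hphi)).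
  by rewrite /pair_ip /= subrr (ip0l Hv (semi_inner0 Hv)) addr0.
- have h0 := semi_inner0 H.
  apply: (null_eqHH hD htr hp h0); rewrite subr0.
  have [pS q] := hpip ((HHE tr hD psi).2 hpsi).
  have := q _ pS; rewrite (sprod_ip (sub_B H hpsi hp) hp) (ipBl H hpsi hp hp).
  suff -> : ip psi (pip psi) = 0 by rewrite sub0r => /eqP; rewrite oppr_eq0 => /eqP.
  apply: (orth_complement H Hn nmode_orth nmode_total hpsi hp) => n.
  have [ln|ln] := ltP 0 (nval n); first by left; exact: o.
  right; rewrite (semi_innerC H hp (Hn n)).
  apply: (closed_span_orth (Hn n) SposH _ pS) => y Sy.
  by rewrite (semi_innerC H (Hn n) (SposH Sy)) pos_nval.
Qed.

Let hip_lin (k : R) (f g v : R * R -> R) : sqi mu Om f -> sqi mu Om g -> sqi mu Om v ->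
  hip (k *: f + g) v = k * hip f v + hip g v.
Proof. by move=> hf hg hv; exact: wip_linear (h_bounded hD) hf hg hv. Qed.

Let nval0 n : nval n = 0 -> nmode n = 0 \/ (balanced D /\ n = pickle (0 : int)).
Proof.
rewrite /nval /nmode; case E : pickle_inv => [i|]; last by left.
rewrite /mode_val /mode; have [i0 _|i0 /eqP] := eqVneq i 0; last first.
  by rewrite (negbTE (lam_neq0 i0)).
by case: asboolP => bal; [right; split => //; rewrite -(pickle_of E) i0 | left].
Qed.

Let Phi : state := (cst 1, cst 0).
Let hPhi : HS Phi. Proof. by split => //; exact: (semi_inner0 Hv). Qed.

Definition residual phi := phi.1 - (B (opP phi)).1.

Let residual_sqi phi : HS phi -> sqi mu Om (residual phi).
Proof.
by move=> hphi; have [[b1 _] _] := opB_free (opP_HS hphi); exact: (sub_B Hc hphi.1 b1).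
Qed.

(** This is [opB_ip] again: P phi and P B_- P phi have the same projection by pi_-. *)
Let residual_orth phi y : HS phi -> nonpos_free y -> cip (residual phi) y.1 = 0.
Proof.
move=> hphi fy; have hP := opP_HS hphi; have [hb _] := opB_free hP.
have [hy _] := fy; have := opB_ip hP fy.
rewrite (opP_ip hb hy) (opP_ip hphi hy) => E.
by rewrite (ipBl Hc hphi.1 hb.1 hy.1) E subrr.
Qed.

Let nmode_free n : nval n < 0 -> nonpos_free (nmode n).
Proof.
move=> ln; split => // m lm; apply: nmode_orth; apply/eqP => nm.
by move: ln; rewrite nm ltNge lm.
Qed.

(** Self-adjointness moves P B_- from [Phi] to [phi]. The scalar products of the statement thus
    measure the component of the residual along the constant 1. *)
Let sprod_w phi : HS phi ->
  sprod D tr (Phi - opP (B Phi)) phi = cip (residual phi) (cst 1).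
Proof.
move=> hphi; have [hB _] := opB_free hPhi; have hPB := opP_HS hB.
have hP := opP_HS hphi; have [hb _] := opB_free hP.
rewrite (sprod_ip (sub_B H hPhi hPB) hphi) (ipBl H hPhi hPB hphi).
rewrite (opP_ip hB hphi) (semi_innerC Hc hB.1 hphi.1) -(opP_ip hphi hB).
rewrite (semi_innerC H hP hB) (opB_sym hPhi hP).
rewrite -[X in ip X phi]/(opP Phi) -[X in ip X (B _)]/(opP Phi).
rewrite (opP_ip hPhi hphi) (opP_ip hPhi hb) -(ipBr Hc hphi.1 hb.1 s1).
exact: (semi_innerC Hc s1 (residual_sqi hphi)).
Qed.

Let hip11 : hip (cst 1) (cst 1) = \int[mu]_(p in Om) coef_h D p.
Proof. by apply: eq_Rintegral => p _; rewrite /= !mulr1. Qed.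

(** [(f, 0)] only sees first components, and that of phi_0 is 1: in the balanced case orthogonality
    to the kernel is therefore a condition against [cst 1]. *)
Let positive_span_sqi f : sqi mu Om f -> (forall y, nonpos_free y -> cip f y.1 = 0) ->
  (balanced D -> cip f (cst 1) = 0) ->
  exists k : R, [/\ (controlled D -> k = 0),
    (~ controlled D -> k * hip (cst 1) (cst 1) = cip f (cst 1)) &
    (k * cip f (cst 1) <= 0 -> cip f f = 0)].
Proof.
move=> sf f0 fb; have [delta d0 gap] := nval_gap.
have fE y : HS y -> ip (f, 0) y = cip f y.1.
  by move=> [_ y2]; rewrite /pair_ip /= (ip0l Hv y2) addr0.
have P1 n : 0 < nval n -> delta <= nval n by have [] := gap n.
have P2 n : nval n <= 0 -> ip (f, 0) (nmode n) = 0.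
  rewrite le_eqVlt => /orP[/eqP /nval0[->|[bal ->]]|ln].
  - by rewrite (ip0r H)//; split => //; exact: (semi_inner0 Hv).
  - rewrite nmode_pickle (fE _ (Hm 0)) /mode eqxx.
    by case: asboolP => // _; exact: fb.
  - by rewrite fE// f0//; exact: nmode_free.
have V1 : ~ controlled D -> V (cst 1) /\ forall v, V v -> hform v (cst 1) = 0.
  move=> /(hform_one hD htr)[v1 h1]; split=> // v Vv.
  by rewrite (semi_innerC Hv Vv v1) h1.
have := positive_span Hc Hv VL hip_lin d0 s1 (hip1 hD) V1
  (V_closed hD htr) relA_nmode nmode_orth nmode_total sf P1 P2.
exact.
Qed.

Let opB_solution phi : HS phi -> cip (residual phi) (residual phi) = 0 ->
  solution D tr pip phi (B (opP phi)).
Proof.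
move=> hphi r0; apply/(solutionP (B (opP phi)) hphi).
have [hb b0] := opB_free (opP_HS hphi); split => //.
  by rewrite (ip_sqC Hc hb.1 hphi.1).
by move=> n ln; apply: b0; exact: ltW.
Qed.

Let solution_sub phi psi psi' : HS phi -> solution D tr pip phi psi ->
  solution D tr pip phi psi' -> [/\ HS psi, HS psi',
   cip (psi - psi').1 (psi - psi').1 = 0 &
   forall n, 0 < nval n -> ip (psi - psi') (nmode n) = 0].
Proof.
move=> hphi /(solutionP _ hphi)[h1 e1 o1] /(solutionP _ hphi)[h2 e2 o2].
split=> //; last by move=> n ln; rewrite (ipBl H h1 h2 (Hn n)) o1// o2// subrr.
have d1 := sub_B Hc h1.1 hphi.1; have d2 := sub_B Hc h2.1 hphi.1.
have -> : (psi - psi').1 = (psi.1 - phi.1) - (psi'.1 - phi.1).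
  by rewrite /= opprB addrA subrK.
by rewrite (ip_sqB Hc d1 d2) e1 e2 (ip_null Hc d1 d2 e1) mulr0 subr0 addr0.
Qed.

Let free_unique psi psi' : HS psi -> HS psi' -> nonpos_free (psi - psi') ->
  cip (psi - psi').1 (psi - psi').1 = 0 -> eqHH D psi psi'.
Proof.
move=> h1 h2 fd d0; apply: (null_eqHH hD htr h1 h2).
exact: (free_uniq fd d0).
Qed.

Let unbalanced_free psi : ~ balanced D -> HS psi ->
  (forall n, 0 < nval n -> ip psi (nmode n) = 0) -> nonpos_free psi.
Proof.
move=> nb hpsi o; split => // n; rewrite le_eqVlt => /orP[/eqP/esym/nval0[->|[]//]|].
  by rewrite (ip0r H).
exact: o.
Qed.

Let unbalanced_unique phi psi psi' : ~ balanced D -> HS phi ->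
  solution D tr pip phi psi -> solution D tr pip phi psi' -> eqHH D psi' psi.
Proof.
move=> nb hphi S1 S2; have [h2 h1 d0 o] := solution_sub hphi S2 S1.
by apply: free_unique => //; apply: unbalanced_free => //; exact: (sub_B H).
Qed.

Let unbalanced_solution phi : ~ balanced D -> HS phi ->
  cip (residual phi) (residual phi) = 0 ->
  unique_solution D tr pip phi (B (opP phi)).
Proof.
move=> nb hphi r0; have S := opB_solution hphi r0.
by split => // psi' S'; exact: (unbalanced_unique nb hphi S S').
Qed.

Lemma case_positive phi : HS phi -> ~ controlled D ->
  0 < \int[mu]_(p in Om) coef_h D p ->
  ((exists psi, solution D tr pip phi psi) <->
     sprod D tr (Phi - opP (B Phi)) phi = 0) /\
  (sprod D tr (Phi - opP (B Phi)) phi = 0 ->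
     unique_solution D tr pip phi (B (opP phi))).
Proof.
move=> hphi nc hpos; rewrite (sprod_w hphi).
have nb : ~ balanced D by move=> [_ E]; move: hpos; rewrite E ltxx.
have suff0 : cip (residual phi) (cst 1) = 0 -> cip (residual phi) (residual phi) = 0.
  move=> w0; have [k [_ _]] := positive_span_sqi (residual_sqi hphi)
    (fun y => residual_orth hphi) (fun=> w0).
  by rewrite w0 mulr0; apply.
split; last by move=> /suff0; exact: unbalanced_solution.
split=> [[psi S]|/suff0 r0]; last by exists (B (opP phi)); exact: opB_solution.
have [hpsi e1 o1] := (solutionP psi hphi).1 S.
have fpsi := unbalanced_free nb hpsi o1.
have hP := opP_HS hphi; have fb := opB_free hP; have [hb _] := fb.
have fd := free_sub fpsi fb.
have rs := residual_sqi hphi.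
(* For any solution, [psi - B (opP phi)] lies in the range of pi_-, to which the residual is
   orthogonal, while its first component is the residual up to a null function: the residual is
   orthogonal to itself. *)
have hd1 : sqi mu Om (psi.1 - phi.1) := sub_B Hc hpsi.1 hphi.1.
have r0 : cip (residual phi) (residual phi) = 0.
  have E : (psi - B (opP phi)).1 = (psi.1 - phi.1) + residual phi.
    by rewrite /residual /= addrA subrK.
  have := residual_orth hphi fd.
  by rewrite E (ipDr Hc hd1 rs rs) (ip_nullr Hc hd1 rs e1) add0r.
exact: (ip_null Hc rs s1 r0).
Qed.

Lemma case_other phi : HS phi ->
  controlled D \/ (~ controlled D /\ \int[mu]_(p in Om) coef_h D p < 0) ->
  unique_solution D tr pip phi (B (opP phi)).
Proof.
move=> hphi cases.
have nb : ~ balanced D.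
  move=> [nc E]; case: cases => [//|[_]]; by rewrite E ltxx.
apply: unbalanced_solution => //.
have [|k [kc kn r0]] := positive_span_sqi (residual_sqi hphi) (fun y => residual_orth hphi).
  by move=> /nb.
apply: r0; case: cases => [/kc ->|[nc hneg]]; first by rewrite mul0r.
(* Here [k * cip (residual phi) (cst 1)] is [k ^+ 2] times the negative integral of [h]. *)
by rewrite -(kn nc) hip11 mulrA -expr2 mulr_ge0_le0 ?sqr_ge0// ltW.
Qed.

Section balanced.
Hypothesis bal : balanced D.
Let n0 := @pickle int 0.
Let phi0 : state := kervec s0.

Let nmode0 : nmode n0 = phi0.
Proof. by rewrite nmode_pickle /mode eqxx; case: asboolP. Qed.

Let nval_n0 : nval n0 = 0.
Proof. by rewrite nval_pickle /mode_val eqxx. Qed.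

Let hphi0 : HS phi0. Proof. by rewrite -nmode0. Qed.

Let nonpositive_orth_phi0 psi : HS psi -> cip psi.1 psi.1 = 0 ->
  (forall n, 0 < nval n -> ip psi (nmode n) = 0) -> ip psi phi0 = 0.
Proof.
move=> hpsi p0 o; have [delta d0 gap] := nval_gap; have [eta e0 hle] := hip_le hD.
rewrite -nmode0.
apply: (nonpositive_orth_kernel Hc Hv VL hip_lin e0 d0 hle relA_nmode
  nmode_orth nmode_total hpsi p0 o).
- by move=> n; have [] := gap n.
- exact: nval_n0.
- by move=> n nn /nval0[//|[_ E]]; move: nn; rewrite E eqxx.
- by rewrite nmode0; exact: cip_pos.
Qed.

Let phi0_orth n : n != n0 -> ip phi0 (nmode n) = 0.
Proof. by move=> nn; rewrite -nmode0 nmode_orth// eq_sym. Qed.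

Let BPhi_free := opB_free hPhi.

Let residual_small phi : HS phi -> cip (residual phi) (cst 1) = 0 ->
  cip (residual phi) (residual phi) = 0.
Proof.
move=> hphi w0; have [k [_ _]] := positive_span_sqi (residual_sqi hphi)
  (fun y => residual_orth hphi) (fun=> w0).
by rewrite w0 mulr0; apply.
Qed.

Let pos_neq n : 0 < nval n -> n != n0.
Proof. by apply: contraTneq => ->; rewrite nval_n0 ltxx. Qed.

(** Since P phi_0 = Phi, its first component is [residual Phi]. It is orthogonal to the positive
    modes, so adding multiples of it alters the residual and preserves the other condition. *)
Let dir := phi0 - B Phi.
Let hdir : HS dir. Proof. by apply: (sub_B H) => //; case: BPhi_free. Qed.

Let dir_orth n : 0 < nval n -> ip dir (nmode n) = 0.
Proof.
move=> ln; have [hB B0] := BPhi_free.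
rewrite (ipBl H hphi0 hB (Hn n)) (phi0_orth (pos_neq ln)) B0 ?subrr//.
exact: ltW.
Qed.

(** Otherwise the residual of [Phi] is null, so [dir] has a null first component and is orthogonal
    to phi_0; but B_- Phi is orthogonal to phi_0, so that [ip dir phi0 = ip phi0 phi0 > 0]. *)
Lemma w_neq0 : sprod D tr (Phi - opP (B Phi)) Phi != 0.
Proof.
rewrite (sprod_w hPhi); apply/eqP => w0.
have r0 := residual_small hPhi w0.
have := nonpositive_orth_phi0 hdir r0 dir_orth.
have [hB B0] := BPhi_free.
rewrite (ipBl H hphi0 hB hphi0) -{3}nmode0 B0 ?nval_n0// subr0.
have := cip_pos hD; have := semi_inner_ge0 Hv hphi0.2.
rewrite /pair_ip /=; move: (cip _ _) (hform _ _) => r s; lra.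
Qed.

Lemma case_balanced phi : HS phi -> unique_solution D tr pip phi
  (B (opP phi) + (sprod D tr (Phi - opP (B Phi)) phi /
     sprod D tr (Phi - opP (B Phi)) Phi) *: (phi0 - B Phi)).
Proof.
move=> hphi; have wn0 := w_neq0.
rewrite (sprod_w hphi); rewrite (sprod_w hPhi) in wn0 *.
set beta := _ / _.
have hP := opP_HS hphi; have [hb b0] := opB_free hP.
have hbd : HS (beta *: dir) by exact: (sub_Z H).
have rs := residual_sqi hphi; have rs1 := residual_sqi hPhi.
have S : solution D tr pip phi (B (opP phi) + beta *: dir).
  apply/(solutionP _ hphi); split.
  - exact: (sub_D H).
  (* By [sprod_w], [beta] is the coefficient that makes [g] orthogonal to the constant 1; [g] is
     then orthogonal to the kernel as well as to the negative modes, hence null. *)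
  - pose g := residual phi - beta *: residual Phi.
    have hbr := sub_Z Hc beta rs1; have hg : sqi mu Om g := sub_B Hc rs hbr.
    have g1 : cip g (cst 1) = 0.
      by rewrite (ipBl Hc rs hbr s1) (ipZl Hc beta rs1 s1) /beta divfK// subrr.
    have g0 : cip g g = 0.
      have [||k [_ _]] := positive_span_sqi hg; last by rewrite g1 mulr0; apply.
        move=> y fy; have [hy _] := fy.
        rewrite (ipBl Hc rs hbr hy.1) (ipZl Hc beta rs1 hy.1).
        by rewrite (residual_orth hphi fy) (residual_orth hPhi fy) mulr0 subrr.
      by [].
    have -> : (B (opP phi) + beta *: dir).1 - phi.1 = - g.
      rewrite /g /residual opprB /= [RHS]addrC opprB -addrA [RHS]addrC.
      by rewrite addrCA addrC -!addrA addrCA.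
    by rewrite (ipNl Hc hg (sub_N Hc hg)) (ipNr Hc hg hg) opprK.
  - move=> n ln; rewrite (ipDl H hb hbd (Hn n)) (ipZl H beta hdir (Hn n)).
    by rewrite dir_orth// mulr0 addr0 b0// ltW.
split=> // psi' S'.
have [h' h d0 o] := solution_sub hphi S' S.
apply: free_unique => //.
(* The difference of two solutions has a null first component and no positive mode; being orthogonal
   to phi_0 as well, it lies in the range of pi_-, where P is injective. *)
have hd := sub_B H h' h.
split=> // n; rewrite le_eqVlt => /orP[/eqP/esym ln|]; last exact: o.
case: (nval0 ln) => [->|[_ ->]]; first by rewrite (ip0r H).
by rewrite -/n0 nmode0; exact: nonpositive_orth_phi0.
Qed.

End balanced.

End solutions.

End spectral.

Theorem theorem5 (R : realType) (D : pb_data R)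
    (tr : (R * R -> R) -> (R * R -> R))
    (lam : int -> R) (U : int -> R * R -> R) (s0 : R * R -> R)
    (pip pim T : (R * R -> R) * (R * R -> R) -> (R * R -> R) * (R * R -> R))
    (phi : (R * R -> R) * (R * R -> R))
    (hD : admissible D)
    (htr : trace_operator (dom D) tr)
    (hbasis : eigenbasis D tr lam U s0)
    (hpip : orth_proj D tr (pos_space D tr lam U) pip)
    (hpim : orth_proj D tr (neg_space D tr lam U) pim)
    (hT : bounded_inverse_on D tr (proj_range D tr pim)
            (fun x => pim (opP (pim x))) T)
    (hphi : HH D tr phi) :
  let B := opB pim T in
  let Phi := (cst 1, cst 0) in
  let w := Phi - opP (B Phi) in
  let phi0 := kervec s0 in
  let int_h := \int[lebesgue2]_(p in dom D) coef_h D p in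
  [/\ ~ controlled D -> 0 < int_h ->
        ((exists psi, solution D tr pip phi psi) <-> sprod D tr w phi = 0) /\
        (sprod D tr w phi = 0 -> unique_solution D tr pip phi (B (opP phi))),
      balanced D ->
        sprod D tr w Phi != 0 /\
        unique_solution D tr pip phi
          (B (opP phi) + (sprod D tr w phi / sprod D tr w Phi) *: (phi0 - B Phi)) &
      controlled D \/ (~ controlled D /\ int_h < 0) ->
        unique_solution D tr pip phi (B (opP phi))].
Proof.
move=> B Phi w phi0 int_h; have hphi' := (HHE tr hD phi).1 hphi.
split.
- exact: (case_positive hD htr hbasis hpip hpim hT hphi').
- move=> bal; split; first exact: (w_neq0 hD htr hbasis hpim hT bal).
  exact: (case_balanced hD htr hbasis hpip hpim hT bal hphi').
- exact: (case_other hD htr hbasis hpip hpim hT hphi').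
Qed.
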